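(* Let $\alpha,\beta>0$, let $$I(u)=\int_0^\infty \Big\{ 2(u')^2+\frac{(1-u^2)^2}{r^2} +\alpha\beta u^2\Big\}\,dr,$$ and consider the boundary value problem $$u''=\frac12\alpha\beta u+\frac1{r^2}(u^2-1)u,\quad r>0;\qquad \lim_{r\to0}u(r)=1,\quad \lim_{r\to\infty}u(r)=0.\tag{$**$}$$ Then: (a) $( ** )$ has a solution $u$ which minimizes $I$ over the class of functions $u$ on $(0,\infty)$ that are absolutely continuous on every compact subinterval of $(0,\infty)$, have $I(u)<\infty$, and satisfy $u(0^+)=1$, $u(\infty)=0$; such a solution satisfies $0<u(r)<1$ for $r>0$, is strictly decreasing, and $$1<\frac{I(u)}{\sqrt{2\alpha\beta}}<\sqrt{1+4\ln 2}.$$ (b) Every finite-energy solution $u$ of $( ** )$ satisfies $\lim_{r\to0}u'(r)=0$ and, for every $\varepsilon\in(0,1)$, $u(r),u'(r)=O\big(e^{-\sqrt{\frac{\alpha\beta}{2}}(1-\varepsilon)r}\big)$ as $r\to\infty$. (c) Every nonnegative solution $u$ of $( ** )$ satisfies $$e^{-\sqrt{\frac{\alpha\beta}{2}}\,r}<u(r)<1,\qquad r>0,$$ and a nonnegative (finite-energy) solution of $( ** )$ is unique. In particular, $I$ has a unique minimizer subject to the boundary conditions in $( ** )$.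
   Context: This is the limiting case $\gamma=\infty$ (infinite Higgs coupling, Higgs profile frozen at $f\equiv1$) of a radially reduced dark-monopole energy; $u(r)$ is the gauge-field profile function. *)

(* Defs.v *)
From HB Require Import structures.
From mathcomp Require Import all_boot all_order all_algebra.
From mathcomp Require Import all_classical all_reals all_analysis.
Set Implicit Arguments. Unset Strict Implicit. Unset Printing Implicit Defensive.
Import Order.TTheory GRing.Theory Num.Theory.
Import numFieldNormedType.Exports.
Local Open Scope classical_set_scope.
Local Open Scope ring_scope.

Definition abs_cont_on (R : realType) (x y : R) (f : R -> R) : Prop :=
  forall e : R, 0 < e -> exists2 d : R, 0 < d &
    forall (n : nat) (s t : nat -> R),
      (forall i, (i < n)%N -> [/\ x <= s i, s i <= t i & t i <= y]) ->
      (forall i j, (i < j)%N -> (j < n)%N -> t i <= s j) ->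
      \sum_(i < n) (t i - s i) < d ->
      \sum_(i < n) `|f (t i) - f (s i)| < e.

Definition loc_abs_cont_pos (R : realType) (f : R -> R) : Prop :=
  forall x y : R, 0 < x -> x <= y -> abs_cont_on x y f.

(* The energy I(u) = int_0^oo {2 u'^2 + (1-u^2)^2/r^2 + a b u^2} dr
   (Lebesgue integral of a nonnegative function, value in [0, +oo]).
   u^`() is the derivative (where it exists; a.e. for AC functions). *)
Definition energy (R : realType) (a b : R) (u : R -> R) : \bar R :=
  (\int[@lebesgue_measure R]_(r in `]0%R, +oo[%classic)
     (2 * (derive1 u r) ^+ 2 + (1 - u r ^+ 2) ^+ 2 / r ^+ 2 + a * b * u r ^+ 2)%:E)%E.

Definition bc (R : realType) (u : R -> R) : Prop :=
  u x @[x --> 0^'+] --> (1 : R) /\ u x @[x --> +oo] --> (0 : R).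

Definition admissible (R : realType) (a b : R) (u : R -> R) : Prop :=
  [/\ loc_abs_cont_pos u, (energy a b u < +oo)%E & bc u].

Definition minimizer (R : realType) (a b : R) (u : R -> R) : Prop :=
  admissible a b u /\ forall v, admissible a b v -> (energy a b u <= energy a b v)%E.

Definition solves (R : realType) (a b : R) (u : R -> R) : Prop :=
  (forall r : R, 0 < r ->
     [/\ derivable u r 1, derivable (derive1 u) r 1 &
         derive1 (derive1 u) r = 2^-1 * a * b * u r + (u r ^+ 2 - 1) * u r / r ^+ 2])
  /\ bc u.

(* Main.v *)
Require Import Defs.
From HB Require Import structures.
From mathcomp Require Import all_boot all_order all_algebra.
From mathcomp Require Import all_classical all_reals all_analysis.
From mathcomp Require Import measurable_realfun ring lra.
Import Order.TTheory GRing.Theory Num.Theory.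
Import numFieldNormedType.Exports.
Local Open Scope classical_set_scope.
Local Open Scope ring_scope.

(** Write k = sqrt (a b / 2).  The energy is convex in u^2: if u is a positive
    solution of the equation and p = u'/u, Picone's identity says that the energy
    density of any admissible v equals that of u plus
      2 (v' - p v)^2 + (v^2 - u^2)^2 / r^2 + 2 (p (v^2 - u^2))'.
    The boundary terms vanish because u' -> 0 at 0 and p >= - k, so every
    nonnegative solution is the unique minimizer, and no compactness or regularity
    theory for minimizers is needed.  For v merely absolutely continuous, the
    fundamental theorem of calculus comes from the total variation of v, its
    Stieltjes measure and the Radon-Nikodym theorem.

    A nonnegative solution is the increasing limit of the iterates, started at
    exp (- k r), of u |-> G ((3 u - u^3) / r^2), where G inverts
    - d^2/dr^2 + k^2 + 2/r^2: the right-hand side is increasing in u on [0, 1],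
    exp (- k r) is a subsolution, and 1 and 1 / (1 + k^2 r^2 / 10) bound the iterates.

    The qualitative properties of solutions follow from the maximum principle with
    the barriers r^(3/2) at 0 and exp (- l r) at infinity, and from the monotonicity
    of (u' + k u) exp (- k r).  The energy is bounded above by that of
    exp (- k r / sqrt (1 + 4 ln 2)), and below by
    2 u'^2 + 2 k^2 u^2 >= - 2 k (u^2)'. *)

Set Implicit Arguments.
Unset Strict Implicit.

(** * Absolutely continuous functions *)

(** The nonlinearity is split as [(u^2 - 1) u = 2 u - (3 u - u^3)]: the constant 2 is the largest
    slope of [u^3 - u] on [0, 1], so the remainder [3 u - u^3] is increasing there. Since 2 = 1 * 2,
    the operator to be inverted is the radial one of angular momentum one, and its kernel is
    elementary: up to constant factors, the Riccati-Bessel functions [x i_1(x)] and [x k_1(x)] at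
    [x = k r]. On the variational side the obstacle is the weakness of the competitors: [v] is only
    locally absolutely continuous, its energy density contains [derive1 v], and [v] may decay far
    more slowly than [u], so that [v^2 / u^2] is uncontrolled at infinity. Picone's identity is
    therefore used as an inequality on compact subintervals; only its continuous part is exhausted
    to the half-line, and the boundary terms are bounded from below only. Finiteness of the energy
    of a nonnegative solution is a consequence, by comparison with one exponential. A minimizer is
    not assumed to satisfy the equation: it is compared with the constructed solution and must
    coincide with it. *)

Section AbsCont.
Context {R : realType}.
Implicit Types (f g V : R -> R) (x y : R) (L : seq (R * R)).

(** Families of non-overlapping intervals are encoded as sorted lists, so that replacing one
    interval by the steps of a partition is a concatenation. *)
Fixpoint chain (x y : R) (L : seq (R * R)) : bool :=
  if L is p :: L' then [&& x <= p.1, p.1 <= p.2 & chain p.2 y L'] else x <= y.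

Definition total_length L : R := \sum_(p <- L) (p.2 - p.1).
Definition oscillation f L : R := \sum_(p <- L) `|f p.2 - f p.1|.

Lemma chain_le x y L : chain x y L -> x <= y.
Proof.
elim: L x => //= p L IH x /and3P[h1 h2 /IH h3].
exact: le_trans h1 (le_trans h2 h3).
Qed.

Lemma chain_nth x y L i : chain x y L -> (i < size L)%N ->
  let p := nth (y, y) L i in [/\ x <= p.1, p.1 <= p.2 & p.2 <= y].
Proof.
elim: L x i => //= p L IH x [|i] /and3P[h1 h2 h3] //= hi.
  by split => //; exact: chain_le h3.
have [k1 k2 k3] := IH _ _ h3 hi; split => //.
exact: le_trans h1 (le_trans h2 k1).
Qed.

Lemma chain_nth_lt x y L i j : chain x y L -> (i < j)%N -> (j < size L)%N ->
  (nth (y, y) L i).2 <= (nth (y, y) L j).1.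
Proof.
elim: L x i j => //= p L IH x [|i] [|j] //= /and3P[h1 h2 h3] ij hj.
  by have [] := chain_nth h3 hj.
exact: (IH _ i j h3 ij hj).
Qed.

Lemma abs_cont_chain x y f : abs_cont_on x y f ->
  forall e, 0 < e -> exists2 d, 0 < d & forall L, chain x y L -> total_length L < d ->
    oscillation f L < e.
Proof.
move=> acf e /acf[d d0 H]; exists d => // L cL.
have := H (size L) (fun i => (nth (y, y) L i).1) (fun i => (nth (y, y) L i).2).
rewrite /total_length /oscillation !(big_nth (y, y)) !big_mkord; apply.
- by move=> i hi; exact: chain_nth cL hi.
- by move=> i j ij hj; exact: chain_nth_lt cL ij hj.
Qed.

Lemma chain_iota x y (s t : nat -> R) m k :
  x <= y ->
  (forall i, (m <= i < m + k)%N -> [/\ x <= s i, s i <= t i & t i <= y]) ->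
  (forall i j, (i < j)%N -> (j < m + k)%N -> t i <= s j) ->
  chain x y [seq (s i, t i) | i <- iota m k].
Proof.
elim: k m x => [|k IH] m x //= xy h1 h2.
have [a1 a2 a3] : [/\ x <= s m, s m <= t m & t m <= y].
  by apply: h1; rewrite leqnn/= -addSnnS leq_addr.
apply/and3P; split => //; apply: IH => //.
  move=> i /andP[mi ik]; have [] := h1 i.
    by rewrite (ltnW mi)/= -addSnnS.
  by split => //; apply: h2 => //; rewrite -addSnnS.
by move=> i j ij jk; apply: h2 => //; rewrite -addSnnS.
Qed.

Fixpoint steps (a : R) (s : seq R) : seq (R * R) :=
  if s is b :: s' then (a, b) :: steps b s' else [::].

Lemma variation_steps a b f s : itv_partition a b s ->
  variation a b f s = oscillation f (steps a s).
Proof.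
move=> abs; rewrite (variation_zip _ abs) /oscillation.
elim: s a abs => [|c s IH] a abs; first by rewrite !big_nil.
by rewrite /= !big_cons/= (IH c)//; exact: itv_partition_cons abs.
Qed.

Lemma len_steps a b s : itv_partition a b s -> total_length (steps a s) = b - a.
Proof.
elim: s a => [|c s IH] a abs.
  by rewrite /total_length big_nil (itv_partition_nil abs) subrr.
rewrite /total_length /= big_cons/= -/(total_length _) IH; last exact: itv_partition_cons abs.
by ring.
Qed.

Lemma chain_cat_steps x y a b s L1 L2 : itv_partition a b s ->
  chain x y (L1 ++ (a, b) :: L2) -> chain x y (L1 ++ steps a s ++ L2).
Proof.
move=> abs; elim: L1 x => [|p L1 IH] x /=; last first.
  by move=> /and3P[-> ->]/=; exact: IH.
move=> /and3P[xa _ c2].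
elim: s a x abs xa => [|c s IH] a x abs xa /=.
  have ab := itv_partition_nil abs; subst b.
  case: L2 c2 => [|q L2]/=; first exact: le_trans xa.
  by move=> /and3P[aq -> ->]; rewrite (le_trans xa aq).
rewrite xa/=; have [/=/andP[ac _] _] := abs.
by rewrite (ltW ac)/=; exact: (IH _ _ (itv_partition_cons abs) (lexx _)).
Qed.

Lemma chain_catr x y L1 L2 : chain x y (L1 ++ L2) -> exists z, chain z y L2.
Proof.
by elim: L1 x => [|p L1 IH] x /=; [exists x|move=> /and3P[_ _ /IH]].
Qed.

Lemma len_cat L1 L2 : total_length (L1 ++ L2) = total_length L1 + total_length L2.
Proof. by rewrite /total_length big_cat. Qed.
Lemma osc_cat f L1 L2 : oscillation f (L1 ++ L2) = oscillation f L1 + oscillation f L2.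
Proof. by rewrite /oscillation big_cat. Qed.

(* Refine the intervals one at a time: those of [L1] are already replaced by
   the steps of a partition, those of [L2] still carry their variation. *)
Lemma osc_total_variation x y f (d e : R) :
  (forall L, chain x y L -> total_length L < d -> oscillation f L < e) ->
  forall L2 L1, chain x y (L1 ++ L2) -> total_length (L1 ++ L2) < d ->
  ((oscillation f L1)%:E + \sum_(p <- L2) total_variation p.1 p.2 f <= e%:E)%E.
Proof.
move=> H; elim=> [|[a b] L2 IH] L1.
  by rewrite cats0 big_nil adde0 lee_fin => c l; exact/ltW/H.
move=> cL lL; rewrite big_cons/=.
have [z /= /and3P[_ ab cbL2]] := chain_catr cL.
(* Partitions are strictly increasing, so a degenerate interval has none but the empty one and is
   treated apart. *)
have [TV0|] := eqVneq a b.
  rewrite -TV0 total_variationxx add0e; apply: IH.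
    have := chain_cat_steps (s := [::]) _ cL; apply.
    by split => //=; rewrite TV0.
  by move: lL; rewrite !len_cat /total_length big_cons/= TV0 subrr add0r.
move=> aNb; have {aNb}ab' : a < b by rewrite lt_neqAle aNb.
set S := (\sum_(p <- L2) _)%E.
have S0 : (0 <= S)%E.
  rewrite /S; move: cbL2; clear; elim: L2 b => [|p L2 IH] b; first by rewrite big_nil.
  rewrite /= => /and3P[_ pp /IH h]; rewrite big_cons adde_ge0//.
  exact: total_variation_ge0.
have key s : itv_partition a b s -> ((oscillation f L1 + variation a b f s)%:E + S <= e%:E)%E.
  move=> abs; rewrite variation_steps// -osc_cat; apply: IH.
    by rewrite -catA; exact: chain_cat_steps cL.
  move: lL; rewrite !len_cat (len_steps abs) /total_length big_cons/=.
  by move=> h; rewrite -addrA.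
(* Once [S] is finite it can be moved to the other side, which leaves a bound on [variation a b f s]
   uniform in [s]; the supremum over [s] follows. *)
have Sf : S \is a fin_num.
  rewrite ge0_fin_numE// ltey; apply/eqP => Sy.
  by have := key _ (itv_partition1 ab'); rewrite Sy.
move: key; rewrite -(fineK Sf) => key.
apply: (@le_trans _ _ ((oscillation f L1)%:E + ((e - (oscillation f L1 + fine S))%:E + (fine S)%:E))%E).
  apply: leeD => //; apply: leeD => //.
  apply: ge_ereal_sup => _ /= [_ [s abs <-] <-].
  by have := key _ abs; rewrite -EFinD !lee_fin; lra.
by rewrite -!EFinD lee_fin; lra.
Qed.

End AbsCont.

Section AbsCont2.
Context {R : realType}.
Implicit Types (f g V : R -> R) (x y : R) (L : seq (R * R)).

Lemma abs_cont_sub x y x' y' f : x <= x' -> y' <= y ->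
  abs_cont_on x y f -> abs_cont_on x' y' f.
Proof.
move=> xx yy H e /H[d d0 Hd]; exists d => // n s t h1; apply: Hd => i /h1[a b c].
by split => //; [exact: le_trans a|exact: le_trans yy].
Qed.

Lemma abs_cont_id x y : abs_cont_on x y (@id R).
Proof.
move=> e e0; exists e => // n s t h1 _; apply: le_lt_trans.
apply: ler_sum => i _; have [_ st _] := h1 i (ltn_ord i).
by rewrite ger0_norm ?subr_ge0.
Qed.

(** The common source of absolute continuity for sums, products, C1 functions (with [f = g = id])
    and differences with the variation function. *)
Lemma abs_cont_dom x y f g F (C : R) : 0 < C ->
  abs_cont_on x y f -> abs_cont_on x y g ->
  (forall s t, x <= s -> s <= t -> t <= y ->
     `|F t - F s| <= C * (`|f t - f s| + `|g t - g s|)) ->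
  abs_cont_on x y F.
Proof.
move=> C0 acf acg H e e0.
have e1 : 0 < e / (2 * C) by rewrite divr_gt0// mulr_gt0.
have [d d0 Hd] := acf _ e1; have [c c0 Hc] := acg _ e1.
exists (Num.min d c); first by rewrite lt_min d0.
move=> n s t h1 h2; rewrite lt_min => /andP[/(Hd _ _ _ h1 h2) k1 /(Hc _ _ _ h1 h2) k2].
apply: (@le_lt_trans _ _ (\sum_(i < n) C * (`|f (t i) - f (s i)| + `|g (t i) - g (s i)|))).
  by apply: ler_sum => i _; have [a1 a2 a3] := h1 i (ltn_ord i); exact: H.
rewrite -mulr_sumr big_split/=.
have -> : e = C * (e / (2 * C) + e / (2 * C)) by field; rewrite gt_eqF.
by rewrite ltr_pM2l// ltrD.
Qed.

Lemma abs_cont_uniform x y f : abs_cont_on x y f -> forall e, 0 < e ->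
  exists2 d, 0 < d & forall s t, x <= s -> s <= t -> t <= y -> t - s < d ->
    `|f t - f s| < e.
Proof.
move=> acf e /acf[d d0 H]; exists d => // s t xs st ty ts.
have := H 1%N (fun=> s) (fun=> t); rewrite !big_ord1; apply => //.
by move=> i [|[]].
Qed.

Lemma abs_cont_total_variation_small x y f : abs_cont_on x y f ->
  forall e, 0 < e -> exists2 d, 0 < d & forall L, chain x y L -> total_length L < d ->
    (\sum_(p <- L) total_variation p.1 p.2 f <= e%:E)%E.
Proof.
move=> acf e /(abs_cont_chain acf)[d d0 H]; exists d => // L cL lL.
have := osc_total_variation H (L2 := L) (L1 := [::]) cL lL.
by rewrite /oscillation big_nil add0e.
Qed.

(** Cut [x, y] into [N] equal pieces shorter than the [d] that belongs to 1: the variation on each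
    piece is at most 1. *)
Lemma abs_cont_total_variation_fin x y f : x <= y -> abs_cont_on x y f ->
  total_variation x y f \is a fin_num.
Proof.
move=> xy acf; have [d d0 H] := abs_cont_total_variation_small acf ltr01.
have [N hN] : exists N, (y - x) / d < N%:R.
  by exists (Num.bound ((y - x) / d)); rewrite archi_boundP// divr_ge0 ?subr_ge0// ltW.
have N0 : 0 < N%:R :> R by apply: le_lt_trans hN; rewrite divr_ge0 ?subr_ge0// ltW.
pose h := (y - x) / N%:R.
have h0 : 0 <= h by rewrite divr_ge0 ?subr_ge0// ltW.
have hd : h < d by rewrite ltr_pdivrMr// mulrC -ltr_pdivrMr.
have hk k : (k <= N)%N -> (total_variation x (x + k%:R * h) f <= k%:R%:E)%E.
  elim: k => [_|k IH kN]; first by rewrite mul0r addr0 total_variationxx.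
  have hk0 : 0 <= k%:R * h by rewrite mulr_ge0.
  rewrite (@total_variationD _ _ _ (x + k%:R * h)) ?lerDl//; last first.
    by rewrite lerD2l ler_wpM2r// ler_nat.
  rewrite -natr1 EFinD; apply: leeD; first exact/IH/ltnW.
  have := H [:: (x + k%:R * h, x + (k%:R + 1) * h)].
  rewrite big_seq1/=; apply; last by rewrite /total_length big_seq1/=; lra.
  rewrite lerDl hk0 lerD2l ler_wpM2r//= ?lerDl//.
  have : (k%:R + 1) * h <= N%:R * h by rewrite ler_wpM2r// natr1 ler_nat.
  have -> : N%:R * h = y - x by rewrite /h mulrC divfK// gt_eqF.
  lra.
have := hk N (leqnn _).
have -> : x + N%:R * h = y by rewrite /h mulrC divfK ?gt_eqF//; lra.
move=> TVN; rewrite ge0_fin_numE ?total_variation_ge0//.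
exact: le_lt_trans TVN (ltry _).
Qed.

Lemma total_variation_fine x y f s t : abs_cont_on x y f ->
  x <= s -> s <= t -> t <= y ->
  total_variation s t f =
  (fine (total_variation x t f) - fine (total_variation x s f))%:E.
Proof.
move=> acf xs st ty; have xt := le_trans xs st.
have ft := abs_cont_total_variation_fin xt (abs_cont_sub (lexx _) ty acf).
have fs := abs_cont_total_variation_fin xs (abs_cont_sub (lexx _) (le_trans st ty) acf).
rewrite EFinB !fineK// (total_variationD f xs st) addeAC subee// add0e//.
Qed.

(** Makes both parts of the Jordan decomposition [f = V - (V - f)] absolutely continuous. *)
Lemma abs_cont_variation x y f : abs_cont_on x y f ->
  abs_cont_on x y (fun t => fine (total_variation x t f)).
Proof.
(* Passing to suprema over partitions loses strictness, hence [e / 2]. *)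
move=> acf e e0; have e2 : 0 < e / 2 by lra.
have [d d0 H] := abs_cont_total_variation_small acf e2; exists d => // n s t h1 h2 hd.
apply: (@le_lt_trans _ _ (e / 2)); last lra.
have [n0|n0] := posnP n; first by rewrite n0 big_ord0 ltW.
have xy : x <= y by have [a b c] := h1 _ n0; lra.
have cL := chain_iota (m := 0) (k := n) xy (fun i hi => h1 i (andP hi).2) h2.
have := H [seq (s i, t i) | i <- iota 0 n].
rewrite /total_length !big_map -/(index_iota 0 n) -[X in iota 0 X]subn0 -/(index_iota 0 n) !big_mkord.
move: cL; rewrite -[X in iota 0 X]subn0 -/(index_iota 0 n) => cL /(_ cL hd); rewrite -lee_fin.
have -> : (\sum_(i < n) total_variation (s i) (t i) f)%E =
  (\sum_(i < n) `|fine (total_variation x (t i) f) - fine (total_variation x (s i) f)|)%:E.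
  rewrite -sumEFin; apply: eq_bigr => i _; have [a1 a2 a3] := h1 i (ltn_ord i).
  rewrite (total_variation_fine acf)// ger0_norm// -lee_fin -(total_variation_fine acf)//.
  exact: total_variation_ge0.
by [].
Qed.

Lemma abs_cont_le_variation x y f s t : abs_cont_on x y f ->
  x <= s -> s <= t -> t <= y ->
  `|f t - f s| <= fine (total_variation x t f) - fine (total_variation x s f).
Proof.
by move=> acf xs st ty; rewrite -lee_fin -(total_variation_fine acf)// total_variation_ge.
Qed.

End AbsCont2.

(** * Stieltjes measures of absolutely continuous functions and their densities *)

Section Density.
Context {R : realType}.
Implicit Types (f g V : R -> R) (x y : R).
Local Notation mu := (@lebesgue_measure R).

Lemma lebesgue_stieltjes_itvoc (G : cumulative R R) (s t : R) : s <= t ->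
  lebesgue_stieltjes_measure G `]s, t] = (G t - G s)%:E.
Proof.
move=> st; rewrite /lebesgue_stieltjes_measure /measure_extension/=.
by rewrite measurable_mu_extE/= ?wlength_itv_bnd//; exact: is_ocitv.
Qed.

(* Every point of the open set [U] lies, for all large [n], in a cell of the
   uniform grid with [n.+1] cells that is contained in [U]; the cells inside
   [U] form a sorted family, to which absolute continuity applies. *)
Lemma stieltjes_dominated x y (G : cumulative R R) (A : set (measurableTypeR R)) : x < y ->
  abs_cont_on x y G -> measurable A -> A `<=` `]x, y] -> mu A = 0 ->
  lebesgue_stieltjes_measure G A = 0.
Proof.
move=> xy acG mA Axy muA.
set nu := lebesgue_stieltjes_measure G.
apply/eqP; rewrite eq_le measure_ge0 andbT; apply/lee_addgt0Pr => e e0; rewrite add0e.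
have [d d0 Hd] := acG _ e0.
have [U [oU AU muU]] : exists U : set R, [/\ open U, A `<=` U & (mu U < d%:E)%E].
  have muAy : (mu A < +oo)%E by rewrite muA.
  have [U [oU AU h]] := lebesgue_regularity_outer mA muAy d0.
  exists U; split => //.
  have mUA : measurable ((U : set (measurableTypeR R)) `\` A).
    by apply: measurableD => //; exact: open_measurable.
  have := @measureU2 _ _ _ mu A _ mA mUA; rewrite setDUK// => /le_lt_trans; apply.
  by rewrite [X in (X + _)%E](_ : _ = 0%E) ?add0e.
pose h n := (y - x) / n.+1%:R.
have h0 n : 0 < h n by rewrite divr_gt0 ?subr_gt0.
pose s n j := x + j%:R * h n.
pose t n j := if `[< `]s n j, s n j.+1] `<=` U >] then s n j.+1 else s n j.
have sS n j : s n j.+1 = s n j + h n by rewrite /s -natr1 mulrDl mul1r addrA.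
have s_ge n j : x <= s n j by rewrite /s lerDl mulr_ge0// ltW.
have sy n : s n n.+1 = y by rewrite /s /h mulrC divfK ?pnatr_eq0//; lra.
have s_le n i j : (i <= j)%N -> s n i <= s n j.
  by move=> ij; rewrite lerD2l ler_wpM2r// ?ler_nat// ltW.
have st n j : s n j <= t n j.
  by rewrite /t; case: ifP => // _; rewrite sS lerDl ltW.
have tsS n j : t n j <= s n j.+1.
  by rewrite /t; case: ifP => // _; rewrite sS lerDl ltW.
have tyU n j : (j < n.+1)%N -> t n j <= y.
  by move=> jn; rewrite (le_trans (tsS _ _))// -(sy n) s_le.
pose F n j : set (measurableTypeR R) := `]s n j, t n j]%classic.
have FU n j : F n j `<=` U.
  rewrite /F /t; case: ifPn => [/asboolP//|_].
  by rewrite set_itvoc0.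
have tF n : trivIset setT (F n).
  apply: ltn_trivIset => i j ij; rewrite /F -subset0 => r [] /=; rewrite !in_itv/=.
  move=> /andP[a1 a2] /andP[b1 b2].
  by have := le_lt_trans (le_trans a2 (le_trans (tsS n j) (s_le n _ _ ij))) b1; rewrite ltxx.
pose C n := \big[setU/set0]_(j < n.+1) F n j.
have mF n j : measurable (F n j) by exact: measurable_itv.
have mC n : measurable (C n) by apply: bigsetU_measurable => j _; exact: mF.
have CU n : C n `<=` U.
  by rewrite /C -bigcup_mkord => r [j _]; exact: FU.
have nuC n : (nu (C n) <= e%:E)%E.
  have := Hd n.+1 (s n) (t n).
  have -> : (nu (C n) = (\sum_(i < n.+1) `|G (t n i) - G (s n i)|)%:E)%E.
    rewrite /nu /C measure_semi_additive_ord_I//.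
    - rewrite -sumEFin; apply: eq_bigr => i _.
      transitivity ((G (t n i) - G (s n i))%:E); first exact: lebesgue_stieltjes_itvoc.
      by rewrite ger0_norm// subr_ge0; exact: cumulative_is_nondecreasing.
    - exact: sub_trivIset (tF n).
    - exact: mC.
  move=> H; rewrite lee_fin ltW//; apply: H.
  - by move=> i hi; split => //; exact: tyU.
  - by move=> i j ij _; exact: le_trans (tsS _ _) (s_le _ _ _ ij).
  rewrite -lte_fin; apply: le_lt_trans muU.
  have -> : ((\sum_(i < n.+1) (t n i - s n i))%:E = mu (C n))%E.
    rewrite /C [RHS]measure_semi_additive_ord_I//.
    - rewrite -sumEFin; apply: eq_bigr => i _.
      by apply/esym; exact: (lebesgue_stieltjes_itvoc idfun).
    - exact: sub_trivIset (tF n).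
    - exact: mC.
  by apply: le_measure => //; rewrite inE//; exact: open_measurable.
(* The grids are not nested, so the [C n] need not increase. Their lower limit, the increasing union
   of the [D m], still covers [A], and continuity from below transfers the bound [e]. *)
pose D m := \bigcap_(n in [set n | (m <= n)%N]) C n.
have mD m : measurable (D m) by apply: bigcap_measurable => //; exists m => /=.
have AD : A `<=` \bigcup_m D m.
  move=> r Ar; have /AU Ur := Ar.
  have := Axy _ Ar; rewrite /= in_itv/= => /andP[xr ry].
  have [eta /= eta0 etaU] : exists2 eta, 0 < eta & forall z, `|r - z| < eta -> U z.
    move: oU; rewrite openE => /(_ _ Ur) [eta /= eta0 etaU].
    by exists eta.
  have [m Hm] : exists m, (y - x) / eta < m%:R.
    by exists (Num.bound ((y - x) / eta)); rewrite archi_boundP// divr_ge0 ?subr_ge0// ltW.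
  exists m => // n /= mn.
  have hn : h n < eta.
    rewrite ltr_pdivrMr// mulrC -ltr_pdivrMr//; apply: lt_le_trans Hm _.
    by rewrite ler_nat leqW.
  have exj : exists j, r <= s n j.+1.
    by exists n; rewrite sy.
  have := ex_minnP exj; case => j rj minj.
  have jn : (j < n.+1)%N by rewrite ltnS; apply: minj; rewrite sy.
  have sjr : s n j < r.
    case: j rj minj {jn} => [_ _|j _ minj]; first by rewrite /s mul0r addr0.
    by rewrite ltNge; apply/negP => /minj; rewrite ltnn.
  rewrite /C -bigcup_mkord; exists j => //=.
  rewrite /F /t /= asboolT/= ?in_itv/= ?sjr//.
  move=> z /=; rewrite in_itv/= => /andP[z1 z2]; apply: etaU.
  move: rj z2; rewrite sS => rj z2.
  by rewrite ltr_norml; apply/andP; split; lra.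
have mUD : measurable (\bigcup_m D m) by exact: bigcup_measurable.
apply: (@le_trans _ _ (nu (\bigcup_m D m))); first by apply: le_measure; rewrite ?inE.
have ndD : nondecreasing_seq D.
  move=> m n mn; apply/subsetPset => r Dr k /= nk; apply: Dr => /=.
  exact: leq_trans nk.
have cvD := nondecreasing_cvg_mu (mu := nu) mD mUD ndD.
apply: (@le_trans _ _ (lim ((nu \o D) @ \oo))); first by rewrite (cvg_lim _ cvD).
apply: lime_le; first by apply/cvg_ex; eexists; exact: cvD.
apply: nearW => m /=; apply: le_trans (nuC m).
by apply: le_measure; rewrite ?inE// => r; apply => /=.
Qed.

End Density.

Section Density2.
Context {R : realType}.
Implicit Types (f g V : R -> R) (x y : R).
Local Notation mu := (@lebesgue_measure R).

(** Clamping the argument to [x, y] extends [g] to a cumulative function on the line. Its Stieltjes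
    measure, restricted to []x, y]], is finite and dominated by Lebesgue measure, so the
    Radon-Nikodym derivative is the density. *)
Lemma nondecreasing_density x y g : x < y ->
  (forall s t, x <= s -> s <= t -> t <= y -> g s <= g t) ->
  abs_cont_on x y g ->
  exists2 d : R -> R, mu.-integrable setT (EFin \o d) &
    forall t, x <= t -> t <= y ->
      (g t - g x)%:E = (\int[mu]_(r in `]x, t]) (d r)%:E)%E.
Proof.
move=> xy ndg acg.
(* The clamp is nondecreasing and 1-Lipschitz, so [g \o c] inherits monotonicity and continuity. *)
pose c r := Num.max x (Num.min r y).
have cx r : x <= c r by rewrite le_max lexx.
have cy r : c r <= y by rewrite ge_max (ltW xy)/= ge_min lexx orbT.
have cE r : x <= r -> r <= y -> c r = r.
  by move=> xr ry; rewrite /c (min_idPl ry) (max_idPr xr).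
have cmono s t : s <= t -> c s <= c t.
  move=> st; rewrite /c ge_max le_max lexx/= le_max; apply/orP.
  have [h|h] := leP s y; [|have [k|k] := leP t y]; last 2 first.
  - by right; lra.
  - by right.
  by right; rewrite le_min st h.
have clip s t : s <= t -> c t - c s <= t - s.
  move=> st; rewrite /c /Num.min /Num.max.
  case: ifPn; case: ifPn; case: ifPn; case: ifPn; rewrite -?leNgt; lra.
pose G0 r := g (c r).
have G0nd : nondecreasing G0 by move=> s t st; exact: ndg (cx _) (cmono _ _ st) (cy _).
have G0rc : right_continuous G0.
  move=> r; apply/cvgrPdist_lt => e e0.
  have [d d0 Hd] := abs_cont_uniform acg e0.
  near=> s; rewrite distrC; apply: Hd => //.
    by apply: cmono; near: s; exact: nbhs_right_ge.
  apply: le_lt_trans (clip _ _ _) _; first by near: s; exact: nbhs_right_ge.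
  rewrite ltrBlDl; near: s; apply: nbhs_right_lt; lra.
pose G : cumulative R R := HB.pack G0 (isCumulative.Build R _ R G0 G0nd G0rc).
have GE r : x <= r -> r <= y -> G r = g r by move=> xr ry; rewrite /= /G0 cE.
have acG : abs_cont_on x y G.
  apply: (abs_cont_dom (f := g) (g := g) ltr01) => // s t xs st ty.
  rewrite !GE//; [|lra..]; rewrite mul1r; have := normr_ge0 (g t - g s); lra.
pose nu := lebesgue_stieltjes_measure G.
have mE : measurable (`]x, y]%classic : set (measurableTypeR R)) by exact: measurable_itv.
have nuE : nu `]x, y]%classic = (g y - g x)%:E.
  by rewrite /nu lebesgue_stieltjes_itvoc ?ltW// !GE// ltW.
have nuy : (nu `]x, y]%classic < +oo)%E by rewrite nuE ltry.
pose nu' := charge_of_finite_measure (mfrestr mE nuy).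
have dom : nu' `<< mu.
  apply/null_content_dominatesP => A mA muA.
  apply: (stieltjes_dominated xy acG) => //.
  - exact: measurableI.
  - by apply/eqP; rewrite eq_le measure_ge0 andbT -muA; apply: le_measure; rewrite ?inE//; exact: measurableI.
pose D := Radon_Nikodym nu' mu.
have Dfin r : D r \is a fin_num by exact: Radon_Nikodym_fin_num.
have DE : EFin \o (fine \o D) = D by apply/funext => r /=; rewrite fineK.
exists (fine \o D); first by rewrite DE; exact: Radon_Nikodym_integrable.
move=> t xt ty.
transitivity (nu' `]x, t]%classic).
  have eS : `]x, t]%classic `&` `]x, y]%classic = `]x, t]%classic :> set (measurableTypeR R).
    apply/seteqP; split=> [r []//|r] /=; rewrite !in_itv/= => /andP[r1 r2].
    by rewrite r1 r2/= (le_trans r2 ty).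
  transitivity (nu `]x, t]%classic); last exact: (congr1 nu (esym eS)).
  by rewrite /nu lebesgue_stieltjes_itvoc// !GE// ltW.
transitivity (\int[mu]_(r in `]x, t]) D r)%E.
  by apply: (Radon_Nikodym_integral dom); exact: measurable_itv.
by apply: eq_integral => r _; rewrite fineK.
Unshelve. all: by end_near. Qed.

(** Jordan decomposition: [V] and [V - f] are nondecreasing because increments of [f] are bounded by
    those of [V]. *)
Lemma abs_cont_density x y f : x < y -> abs_cont_on x y f ->
  exists2 d : R -> R, mu.-integrable setT (EFin \o d) &
    forall t, x <= t -> t <= y ->
      (f t - f x)%:E = (\int[mu]_(r in `]x, t]) (d r)%:E)%E.
Proof.
move=> xy acf; pose V t := fine (total_variation x t f).
have acV := abs_cont_variation acf.
have VP s t : x <= s -> s <= t -> t <= y -> `|f t - f s| <= V t - V s.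
  by move=> *; exact: abs_cont_le_variation acf _ _ _.
have ndV s t : x <= s -> s <= t -> t <= y -> V s <= V t.
  by move=> xs st ty; rewrite -subr_ge0; apply: le_trans (VP _ _ xs st ty).
pose W t := V t - f t.
have acW : abs_cont_on x y W.
  apply: (abs_cont_dom ltr01 acV acf) => s t xs st ty; rewrite mul1r.
  apply: le_trans (ler_normB _ _); rewrite /W le_eqVlt; apply/orP; left; apply/eqP; congr `|_|.
  by rewrite /V; ring.
have ndW s t : x <= s -> s <= t -> t <= y -> W s <= W t.
  by move=> xs st ty; have := le_trans (ler_norm _) (VP _ _ xs st ty); rewrite /W; lra.
have [d1 i1 h1] := nondecreasing_density xy ndV acV.
have [d2 i2 h2] := nondecreasing_density xy ndW acW.
exists (fun r => d1 r - d2 r).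
  have -> : EFin \o (fun r => d1 r - d2 r) = ((EFin \o d1) \- (EFin \o d2))%E.
    by apply/funext => r /=; rewrite EFinB.
  exact: integrableB.
move=> t xt ty.
transitivity ((\int[mu]_(r in `]x, t]) (d1 r)%:E) - (\int[mu]_(r in `]x, t]) (d2 r)%:E))%E.
  by rewrite -h1// -h2// /W -EFinB; congr EFin; ring.
by rewrite -integralB_EFin//; apply: (integrableS (E := setT)).
Qed.

End Density2.

(** * The fundamental theorem of calculus as an inequality *)

Section LowerBound.
Context {R : realType}.
Implicit Types (f g V : R -> R) (x y : R).
Local Notation mu := (@lebesgue_measure R).

(** Near each interior point [f] is, up to a constant, the indefinite integral of its density;
    Lebesgue differentiation identifies the derivative almost everywhere. *)
Lemma abs_cont_ae_derive x y f : x < y -> abs_cont_on x y f ->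
  exists2 d : R -> R, mu.-integrable setT (EFin \o d) &
    (f y - f x)%:E = (\int[mu]_(r in `]x, y[) (d r)%:E)%E /\
    {ae mu, forall r, x < r < y -> is_derive r 1 f (d r)}.
Proof.
move=> xy acf; have [d id hd] := abs_cont_density xy acf.
exists d => //; split.
  rewrite (hd _ (ltW xy) (lexx _)).
  have := @integral_itv_bndoo _ x y (EFin \o d) false false.
  apply.
  by apply: measurable_funTS; exact: measurable_int id.
have intd u : mu.-integrable [set` Interval (BRight x) (BRight u)] (EFin \o d).
  by apply: (integrableS measurableT _ _ id) => //; exact: measurable_itv.
have locd : locally_integrable [set: R] d by apply: open_integrable_locally => //; exact: openT.
have := FTC1 intd locd; apply: filterS; first exact: (ae_filter_ringOfSetsType mu).
move=> r /= H /andP[xr ry].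
have [] := H; first by rewrite lte_fin.
set F := (fun z => _) => dF F'.
have dFr : is_derive r 1 (cst (f x) + F) (d r).
  have h : is_derive r 1 F (d r) by apply: DeriveDef; [exact: dF|rewrite -derive1E].
  by rewrite -[d r]add0r; exact: is_deriveD.
apply: near_eq_is_derive dFr; near=> z.
have [xz zy] : x <= z /\ z <= y.
  by split; near: z; [exact: lt_le_nbhsr|exact: lt_le_nbhsl].
have -> : (cst (f x) + F) z = f x + F z by [].
suff -> : F z = f z - f x by ring.
by rewrite -[RHS]/(fine (f z - f x)%:E) (hd z xz zy).
Unshelve. all: by end_near. Qed.

(** Meant for energy densities of admissible functions, which contain [derive1] and come with no
    measurability: a supremum over simple functions below the integrand is monotone by
    construction. *)
Lemma ge0_le_integral_nonmeasurable (A B : set R) (f g : R -> \bar R) :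
  (forall r, 0 <= f r)%E -> (forall r, 0 <= g r)%E -> A `<=` B ->
  (forall r, A r -> f r <= g r)%E ->
  (\int[mu]_(r in A) f r <= \int[mu]_(r in B) g r)%E.
Proof.
move=> f0 g0 AB fg; rewrite !ge0_integralE//.
apply: le_ereal_sup => _ [h /= hf <-]; exists h => // r /=.
apply: le_trans (hf r) _; rewrite /patch.
case: ifPn => [|_]; first by rewrite inE => Ar; rewrite ifT ?fg// inE; exact: AB.
by case: ifPn.
Qed.

Lemma ge0_le_integral_nonmeasurable_in (A : set R) (f g : R -> \bar R) :
  (forall r, A r -> 0 <= f r)%E -> (forall r, A r -> f r <= g r)%E ->
  (\int[mu]_(r in A) f r <= \int[mu]_(r in A) g r)%E.
Proof.
move=> f0 fg; rewrite [leLHS]integral_mkcond [leRHS]integral_mkcond.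
apply: ge0_le_integral_nonmeasurable => //.
- by move=> r; rewrite /patch; case: ifPn => //; rewrite inE; exact: f0.
- move=> r; rewrite /patch; case: ifPn => //; rewrite inE => Ar.
  exact: le_trans (f0 _ Ar) (fg _ Ar).
- by move=> r _; rewrite /patch; case: ifPn => //; rewrite inE; exact: fg.
Qed.

(* [g] need not be measurable: the integral of a nonnegative function is the
   supremum of the integrals of the simple functions below it. *)
Lemma abs_cont_le_integral x y f g : x < y -> abs_cont_on x y f ->
  (forall r, 0 <= g r) ->
  {ae mu, forall r, x < r < y -> derivable f r 1 -> derive1 f r <= g r} ->
  ((f y - f x)%:E <= \int[mu]_(r in `]x, y[) (g r)%:E)%E.
Proof.
move=> xy acf g0 aefg.
have [d id [-> aed]] := abs_cont_ae_derive xy acf.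
have [N [mN N0 hN]] : {ae mu, forall r, x < r < y -> d r <= g r}.
  apply: filterS2 aefg aed; first exact: (ae_filter_ringOfSetsType mu).
  move=> r h1 h2 /[dup] /h1 {}h1 /h2 [df <-].
  by rewrite -derive1E; exact: h1.
have mxy : measurable (`]x, y[%classic : set (measurableTypeR R)) by exact: measurable_itv.
have id' : mu.-integrable `]x, y[ (EFin \o d) by apply: (integrableS measurableT _ _ id).
have md' : measurable_fun `]x, y[ (EFin \o d) by exact: measurable_int id'.
have mm : measurable_fun `]x, y[ (fun r => (Num.max (d r) 0)%:E).
  apply/measurable_EFinP; apply: measurable_maxr => //.
  exact/measurable_EFinP.
(* Passing to the positive part of [d] gives a nonnegative measurable integrand, from whose domain
   the null set [N] can be removed before comparing with [g]. *)
apply: (@le_trans _ _ (\int[mu]_(r in `]x, y[) (Num.max (d r) 0)%:E)%E).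
  apply: le_integral => //=.
    apply: (le_integrable mxy mm _ id') => r _ /=.
    rewrite lee_fin ger0_norm ?le_max ?lexx ?orbT// ge_max ler_norm/=.
    exact: normr_ge0.
  by move=> r _; rewrite lee_fin le_max lexx.
rewrite (ge0_negligible_integral mN)//; last first.
  by move=> r _; rewrite lee_fin le_max lexx orbT.
apply: ge0_le_integral_nonmeasurable => //.
- by move=> r; rewrite lee_fin le_max lexx orbT.
move=> r [/=]; rewrite in_itv/= => xry nN.
rewrite lee_fin ge_max g0 andbT; apply: contrapT => h; apply: nN; apply: hN => /=.
by move=> /(_ xry).
Qed.

End LowerBound.

(** * Calculus on the half-line *)

Section Calculus.
Context {R : realType}.
Implicit Types (f g : R -> R) (r x y a b : R).

(** The rules are phrased for explicit lambda terms so that [differentiate] can choose them by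
    syntax, leaving one equation between derivatives to [ring] or [field]. *)
Lemma is_derive_to f r a b : is_derive r 1 f a -> a = b -> is_derive r 1 f b.
Proof. by move=> df <-. Qed.
Lemma is_derive_cstf (c r : R) : is_derive r 1 (fun=> c) 0.
Proof. exact: is_derive_cst. Qed.
Lemma is_derive_idf r : is_derive r 1 (fun x : R => x) 1.
Proof. exact: is_derive_id. Qed.
Lemma is_derive_addf f g r a b : is_derive r 1 f a -> is_derive r 1 g b ->
  is_derive r 1 (fun x => f x + g x) (a + b).
Proof. by move=> *; exact: is_deriveD. Qed.
Lemma is_derive_oppf f r a : is_derive r 1 f a -> is_derive r 1 (fun x => - f x) (- a).
Proof. by move=> *; exact: is_deriveN. Qed.
Lemma is_derive_mulf f g r a b : is_derive r 1 f a -> is_derive r 1 g b ->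
  is_derive r 1 (fun x => f x * g x) (a * g r + f r * b).
Proof.
by move=> df dg; apply: (is_derive_eq (is_deriveM df dg)); rewrite /GRing.scale/=; ring.
Qed.
Lemma is_derive_expf f r a n : is_derive r 1 f a ->
  is_derive r 1 (fun x => f x ^+ n) (n%:R * f r ^+ n.-1 * a).
Proof.
move=> df; elim: n => [|n IH]; first by rewrite !mul0r; exact: is_derive_cstf.
have -> : (fun x => f x ^+ n.+1) = (fun x => f x * f x ^+ n).
  by apply/funext => x; rewrite exprS.
apply: (is_derive_eq (is_derive_mulf df IH)) => /=.
by case: n {IH} => [|n] /=; rewrite -?[in RHS]natr1 ?exprS; ring.
Qed.
Lemma is_derive_invf g r b : g r != 0 -> is_derive r 1 g b ->
  is_derive r 1 (fun x => (g x)^-1) (- b / g r ^+ 2).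
Proof.
move=> g0 dg; apply: (is_derive_eq (is_deriveV g0 dg)); rewrite /GRing.scale/=.
by rewrite -exprVn; ring.
Qed.
Lemma is_derive_compf f g r a b : is_derive r 1 g b -> is_derive (g r) 1 f a ->
  is_derive r 1 (fun x => f (g x)) (a * b).
Proof.
by move=> dg df; apply: (is_derive_eq (is_derive1_comp df dg)); rewrite /GRing.scale/=; ring.
Qed.
Lemma is_derive_expRf g r b : is_derive r 1 g b ->
  is_derive r 1 (fun x => expR (g x)) (expR (g r) * b).
Proof. by move=> dg; apply: is_derive_compf. Qed.
Lemma is_derive_lnf g r b : 0 < g r -> is_derive r 1 g b ->
  is_derive r 1 (fun x => ln (g x)) (b / g r).
Proof. by move=> g0 dg; rewrite mulrC; exact: (is_derive_compf dg (is_derive1_ln g0)). Qed.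

End Calculus.

(* [is_derive] is a type class: plain [apply] would start an instance search on
   each premise. *)
Ltac is_derive_rules := repeat (try eassumption; lazymatch goal with
  | |- is_derive _ _ (fun=> ?c) _ => notypeclasses refine (is_derive_cstf c _)
  | |- is_derive _ _ (fun x => x) _ => notypeclasses refine (is_derive_idf _)
  | |- is_derive _ _ (fun x => @?f x + @?g x) _ => notypeclasses refine (@is_derive_addf _ f g _ _ _ _ _)
  | |- is_derive _ _ (fun x => - @?f x) _ => notypeclasses refine (@is_derive_oppf _ f _ _ _)
  | |- is_derive _ _ (fun x => @?f x * @?g x) _ => notypeclasses refine (@is_derive_mulf _ f g _ _ _ _ _)
  | |- is_derive _ _ (fun x => @?f x ^+ ?n) _ => notypeclasses refine (@is_derive_expf _ f _ _ _ _)
  | |- is_derive _ _ (fun x => (@?f x)^-1) _ => notypeclasses refine (@is_derive_invf _ f _ _ _ _)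
  | |- is_derive _ _ (fun x => expR (@?f x)) _ => notypeclasses refine (@is_derive_expRf _ f _ _ _)
  | |- is_derive _ _ (fun x => ln (@?f x)) _ => notypeclasses refine (@is_derive_lnf _ f _ _ _ _)
  end).

Ltac differentiate := notypeclasses refine (is_derive_to _ _);
  [solve [is_derive_rules; rewrite ?gt_eqF ?exprn_gt0 //] | cbv beta].

(** * Mean values and maximum principles *)

Section Calculus2.
Context {R : realType}.
Implicit Types (f g df dz z ddz : R -> R) (r x y a b c : R).

Lemma is_derive_continuous f r a : is_derive r 1 f a -> {for r, continuous f}.
Proof. by move=> [df _]; apply/differentiable_continuous/derivable1_diffP. Qed.

Lemma is_derive_within x y f df : (forall r, x <= r -> r <= y -> is_derive r 1 f (df r)) ->
  {within `[x, y], continuous f}.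
Proof.
move=> H; apply: derivable_within_continuous => r; rewrite in_itv/= => /andP[xr ry].
by have [] := H r xr ry.
Qed.

Lemma MVT_cc x y f df : x < y ->
  (forall r, x <= r -> r <= y -> is_derive r 1 f (df r)) ->
  exists c, [/\ x < c, c < y & f y - f x = df c * (y - x)].
Proof.
move=> xy H.
have H' r : r \in `]x, y[ -> is_derive r 1 f (df r).
  by rewrite in_itv/= => /andP[xr ry]; apply: H; exact: ltW.
have [c] := MVT xy H' (is_derive_within H).
by rewrite in_itv/= => /andP[xc cy] e; exists c.
Qed.

Lemma ge0_derive_le x y f df : x <= y ->
  (forall r, x <= r -> r <= y -> is_derive r 1 f (df r)) ->
  (forall r, x < r -> r < y -> 0 <= df r) -> f x <= f y.
Proof.
rewrite le_eqVlt => /predU1P[->//|xy] H df0; have [c [xc cy e]] := MVT_cc xy H.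
by rewrite -subr_ge0 e mulr_ge0// ?df0// subr_ge0 ltW.
Qed.

Lemma gt0_derive_lt x y f df : x < y ->
  (forall r, x <= r -> r <= y -> is_derive r 1 f (df r)) ->
  (forall r, x < r -> r < y -> 0 < df r) -> f x < f y.
Proof.
move=> xy H df0; have [c [xc cy e]] := MVT_cc xy H.
by rewrite -subr_gt0 e mulr_gt0// ?df0// subr_gt0.
Qed.

Lemma derive_gt0_right f r a : is_derive r 1 f a -> 0 < a ->
  exists2 d, 0 < d & forall h, 0 < h -> h < d -> f r < f (r + h).
Proof.
move=> [df <-] a0.
have dq : h^-1 *: (f (h *: 1 + r) - f r) @[h --> 0^'] --> 'D_1 f r by exact: df.
have := cvgr_gt _ dq _ a0.
move=> [d /= d0 H]; exists d => // h h0 hd.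
have := H h; rewrite /= sub0r normrN ger0_norm ?ltW// => /(_ hd).
rewrite gt_eqF// => /(_ isT).
by rewrite /GRing.scale/= mulr1 [h + r]addrC pmulr_rgt0 ?invr_gt0// subr_gt0.
Qed.

Lemma local_max_second_derive x y m z dz a : x < m -> m < y ->
  (forall r, x < r -> r < y -> is_derive r 1 z (dz r)) ->
  is_derive m 1 dz a ->
  (forall r, x < r -> r < y -> z r <= z m) -> a <= 0.
Proof.
move=> xm my Hz Hdz zm; rewrite leNgt; apply/negP => a0.
have dm0 : dz m = 0.
  have := @derive1_at_max _ z x y m (ltW (lt_trans xm my)).
  have [_ <-] := Hz m xm my; move=> H; apply: derive_val; apply: H.
  - by move=> r; rewrite in_itv/= => /andP[xr ry]; have [] := Hz r xr ry.
  - by rewrite in_itv/= xm.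
  - by move=> r; rewrite in_itv/= => /andP[xr ry]; exact: zm.
have [d d0 Hd] := derive_gt0_right Hdz a0.
pose h := Num.min d (y - m) / 2.
have dy0 : 0 < Num.min d (y - m) by rewrite lt_min d0 subr_gt0.
have h0 : 0 < h by rewrite divr_gt0.
have [hd hy] : h < d /\ h < y - m.
  by apply/andP; rewrite -lt_min /h; lra.
have mmh : m < m + h by lra.
have [c [mc ch e]] : exists c, [/\ m < c, c < m + h & z (m + h) - z m = dz c * (m + h - m)].
  by apply: MVT_cc => // r mr rh; apply: Hz; lra.
have := zm (m + h); have : 0 < dz c * (m + h - m).
  apply: mulr_gt0; last lra.
  by have := Hd (c - m); rewrite dm0 [m + _]addrC subrK; apply; lra.
by rewrite -e; lra.
Qed.

Lemma local_min_second_derive x y m z dz a : x < m -> m < y ->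
  (forall r, x < r -> r < y -> is_derive r 1 z (dz r)) ->
  is_derive m 1 dz a ->
  (forall r, x < r -> r < y -> z m <= z r) -> 0 <= a.
Proof.
move=> xm my Hz Hdz zm; rewrite -oppr_le0.
apply: (@local_max_second_derive x y m (fun r => - z r) (fun r => - dz r)) => //.
- by move=> r xr ry; apply: is_derive_oppf; exact: Hz.
- by move=> r xr ry; rewrite lerN2; exact: zm.
Qed.

(** The sign of [ddz] is requested only where [z > c], the region in which the sign of the nonlinear
    term is known. *)
Lemma max_principle x y c z dz ddz : x <= y ->
  (forall r, x <= r -> r <= y -> is_derive r 1 z (dz r)) ->
  (forall r, x <= r -> r <= y -> is_derive r 1 dz (ddz r)) ->
  z x <= c -> z y <= c ->
  (forall r, x < r -> r < y -> c < z r -> 0 < ddz r) ->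
  forall r, x <= r -> r <= y -> z r <= c.
Proof.
move=> xy Hz Hdz zx zy pos.
have [m] := EVT_max xy (is_derive_within Hz); rewrite in_itv/= => /andP[xm my] zm r xr ry.
apply: (@le_trans _ _ (z m)); first by apply: zm; rewrite in_itv/= xr.
rewrite leNgt; apply/negP => cm.
have xm' : x < m by rewrite lt_neqAle xm andbT; apply/eqP => e; move: cm zx; rewrite -e; lra.
have my' : m < y by rewrite lt_neqAle my andbT; apply/eqP => e; move: cm zy; rewrite -e; lra.
have := pos m xm' my' cm; rewrite ltNge => /negP; apply.
apply: (local_max_second_derive xm' my' (z := z) (dz := dz)).
- by move=> s xs sy; apply: Hz; exact: ltW.
- exact: Hdz.
- by move=> s xs sy; apply: zm; rewrite in_itv/= !ltW.
Qed.

Lemma cvg_right0_lt f (l e : R) : f r @[r --> 0^'+] --> l -> 0 < e ->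
  exists2 d, 0 < d & forall r, 0 < r -> r < d -> `|f r - l| < e.
Proof.
move=> /cvgrPdist_lt/(_ e) H /H [d /= d0 Hd].
exists d => // r r0 rd; rewrite distrC; apply: Hd => //=.
by rewrite sub0r normrN gtr0_norm.
Qed.

Lemma cvg_right0_ex f (l : R) :
  (forall e, 0 < e -> exists2 d, 0 < d & forall r, 0 < r -> r < d -> `|f r - l| < e) ->
  f r @[r --> 0^'+] --> l.
Proof.
move=> H; apply/cvgrPdist_lt => e /H[d d0 Hd].
exists d => // r /=; rewrite sub0r normrN => rd r0; rewrite distrC; apply: Hd => //.
exact: le_lt_trans (ler_norm _) rd.
Qed.

Lemma cvg_pinfty_lt f (l e : R) : f r @[r --> +oo] --> l -> 0 < e ->
  exists2 M, 0 < M & forall r, M < r -> `|f r - l| < e.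
Proof.
move=> /cvgrPdist_lt/(_ e) H /H [M [_ HM]].
exists (Num.max 1 M); first by rewrite lt_max ltr01.
by move=> r; rewrite gt_max => /andP[_ Mr]; rewrite distrC; exact: HM.
Qed.

Lemma cvg_pinfty_ex f (l : R) :
  (forall e, 0 < e -> exists M, forall r, M < r -> `|f r - l| < e) ->
  f r @[r --> +oo] --> l.
Proof.
move=> H; apply/cvgrPdist_lt => e /H[M HM]; exists M; split; first exact: num_real.
by move=> r Mr; rewrite distrC; exact: HM.
Qed.

Lemma max_principle_right0 y z dz ddz : 0 < y ->
  (forall r, 0 < r -> r <= y -> is_derive r 1 z (dz r)) ->
  (forall r, 0 < r -> r <= y -> is_derive r 1 dz (ddz r)) ->
  z r @[r --> 0^'+] --> 0 -> z y <= 0 ->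
  (forall r, 0 < r -> r < y -> 0 < z r -> 0 < ddz r) ->
  forall r, 0 < r -> r <= y -> z r <= 0.
Proof.
move=> y0 Hz Hdz z0 zy pos r r0 ry; apply/ler_addgt0Pr => e e0; rewrite add0r.
have [d d0 Hd] := cvg_right0_lt z0 e0.
pose x := Num.min r d / 2.
have m0 : 0 < Num.min r d by rewrite lt_min r0.
have [xr xd] : x < r /\ x < d by apply/andP; rewrite -lt_min /x; lra.
have x0 : 0 < x by rewrite /x; lra.
apply: (@max_principle x y e z dz ddz); first lra.
- by move=> s xs sy; apply: Hz; lra.
- by move=> s xs sy; apply: Hdz; lra.
- by have := Hd x x0 xd; rewrite subr0 => /(le_lt_trans (ler_norm _)) /ltW.
- lra.
- by move=> s xs sy es; apply: pos; lra.
- exact: ltW.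
- by [].
Qed.

Lemma max_principle_pinfty x z dz ddz :
  (forall r, x <= r -> is_derive r 1 z (dz r)) ->
  (forall r, x <= r -> is_derive r 1 dz (ddz r)) ->
  z r @[r --> +oo] --> 0 -> z x <= 0 ->
  (forall r, x < r -> 0 < z r -> 0 < ddz r) ->
  forall r, x <= r -> z r <= 0.
Proof.
move=> Hz Hdz z0 zy pos r xr; apply/ler_addgt0Pr => e e0; rewrite add0r.
have [M M0 HM] := cvg_pinfty_lt z0 e0.
pose y := Num.max r M + 1.
have [ry My] : r < y /\ M < y by apply/andP; rewrite -gt_max /y; lra.
apply: (@max_principle x y e z dz ddz); first lra.
- by move=> s xs sy; exact: Hz.
- by move=> s xs sy; exact: Hdz.
- lra.
- by have := HM y My; rewrite subr0 => /(le_lt_trans (ler_norm _)) /ltW.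
- by move=> s xs sy es; apply: pos; lra.
- by [].
- exact: ltW.
Qed.

End Calculus2.

(** * Solutions of the differential equation *)

Section Ode.
Context {R : realType}.
Implicit Types (u v : R -> R) (r x y k l : R).

Definition ode k u v := forall r, 0 < r ->
  is_derive r 1 u (v r) /\
  is_derive r 1 v (k ^+ 2 * u r + (u r ^+ 2 - 1) * u r / r ^+ 2).

Lemma sqrt_expR r : 0 < r -> expR (2^-1 * ln r) = Num.sqrt r.
Proof.
move=> r0; apply/eqP; rewrite -(@eqrXn2 _ 2)// ?expR_ge0//.
by rewrite sqr_sqrtr ?ltW// -expRM_natl mulrA mulfV// mul1r lnK.
Qed.

Lemma cvg_expRN l : 0 < l -> expR (- (l * r)) @[r --> +oo] --> (0 : R).
Proof.
move=> l0; apply: cvg_pinfty_ex => e e0; exists (Num.max 0 ((e * l)^-1)) => r.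
rewrite gt_max => /andP[r0 rel]; rewrite subr0 ger0_norm ?expR_ge0// expRN.
rewrite -[ltRHS]invrK ltf_pV2 ?posrE ?expR_gt0 ?invr_gt0//.
apply: lt_le_trans (expR_ge1Dx _).
have : e^-1 < l * r; last lra.
by rewrite mulrC -ltr_pdivrMr// -invfM.
Qed.

Let N1 : (-1 : R) ^+ 2 = 1. Proof. by rewrite sqrrN expr1n. Qed.

Section Solution.
Variables (k : R) (u v : R -> R).
Hypotheses (k0 : 0 < k) (Hode : ode k u v) (Hbc : bc u).

Let du r : 0 < r -> is_derive r 1 u (v r).
Proof. by move=> /Hode[]. Qed.
Let dv r : 0 < r -> is_derive r 1 v (k ^+ 2 * u r + (u r ^+ 2 - 1) * u r / r ^+ 2).
Proof. by move=> /Hode[]. Qed.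

(* The function r^(3/2) is a supersolution of w'' = (7/4) w / r^2 - c near 0,
   because (3/2)(1/2) < 7/4; and |1 - u| is a subsolution where u is near 1. *)
Lemma sol_near0 : exists A d, [/\ 0 < A, 0 < d &
  forall r, 0 < r -> r < d -> `|1 - u r| <= A * (r * Num.sqrt r) /\ `|1 - u r| < 20^-1].
Proof.
(* If [u] is within 1/20 of 1, then [(1 + u) u >= 7/4]. Subtracting the 3/4 from the second
   derivative of [r^(3/2)] leaves one full [A * th r / r^2] to beat [k^2 u < 2 k^2]. *)
have [u1 _] := Hbc; have [d d0 Hd] := cvg_right0_lt u1 (e := 20^-1) ltac:(lra).
pose y := d / 2; have y0 : 0 < y by rewrite /y; lra.
have yd : y < d by rewrite /y; lra.
pose th r : R := expR (3 / 2 * ln r).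
have thE r : 0 < r -> th r = r * Num.sqrt r.
  move=> r0; rewrite -sqrt_expR// -[X in X * _]lnK ?posrE// -expRD /th; congr expR.
  by field.
have th0 r : 0 < th r by exact: expR_gt0.
(* The first summand gives [A * th y >= 1], which dominates the boundary value at [y]; the other two
   give [A / sqrt r > 2 k^2] on []0, y]]. *)
pose A := (th y)^-1 + 2 * k ^+ 2 * Num.sqrt y + 1.
have k20 : 0 < k ^+ 2 by rewrite exprn_gt0.
have A0 : 0 < A.
  have := sqrtr_ge0 y; have : 0 < (th y)^-1 by rewrite invr_gt0.
  rewrite /A; nra.
have Ath r : 0 < r -> r <= y -> 2 * k ^+ 2 < A * (th r / r ^+ 2).
  move=> r0 ry; have s0 : 0 < Num.sqrt r by rewrite sqrtr_gt0.
  have -> : th r / r ^+ 2 = (Num.sqrt r)^-1.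
    rewrite thE// -[in r ^+ 2](sqr_sqrtr (ltW r0)) -[X in X * _ / _](sqr_sqrtr (ltW r0)).
    by field; rewrite gt_eqF.
  rewrite ltr_pdivlMr// /A.
  have sy : Num.sqrt r <= Num.sqrt y by rewrite ler_sqrt// ltW.
  have : 0 < (th y)^-1 by rewrite invr_gt0.
  nra.
(* The sign [e] treats [1 - u] and [u - 1] at once. *)
have key (e : R) : e ^+ 2 = 1 -> forall r, 0 < r -> r <= y -> e * (1 - u r) - A * th r <= 0.
  move=> e1; have eE : e = 1 \/ e = -1.
    by move/eqP: e1; rewrite sqrf_eq1 => /orP[] /eqP; [left|right].
  apply: (@max_principle_right0 _ y (fun r => e * (1 - u r) - A * th r)
    (fun r => - (e * v r) - A * (3 / 2 * (th r / r)))
    (fun r => - (e * (k ^+ 2 * u r + (u r ^+ 2 - 1) * u r / r ^+ 2)) - A * (3 / 4 * (th r / r ^+ 2)))); first exact: y0.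
  - move=> r r0 ry; have dur := du r0; rewrite /th; differentiate.
    by rewrite /th; field; rewrite gt_eqF.
  - move=> r r0 ry; have dvr := dv r0; rewrite /th; differentiate.
    by rewrite /th; field; rewrite gt_eqF.
  - apply: cvg_right0_ex => s s0.
    have [d1 d10 Hd1] := cvg_right0_lt u1 (e := s / 2) ltac:(lra).
    have A2 : 0 < s / (2 * A) by rewrite divr_gt0// mulr_gt0.
    exists (Num.min d1 (Num.min 1 (s / (2 * A)))); first by rewrite !lt_min d10 ltr01.
    move=> r r0; rewrite !lt_min => /and3P[rd r1 rA]; rewrite subr0.
    have := Hd1 r r0 rd; rewrite distrC.
    have thr : th r <= r.
      rewrite thE// ger_pMr// -[leRHS]sqrtr1 ler_sqrt//; exact: ltW.
    have : A * th r < s / 2.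
      have : A * r < s / 2 by move: rA; rewrite ltr_pdivlMr ?mulr_gt0//; lra.
      nra.
    have := mulr_gt0 A0 (th0 r).
    move=> h1 h2 h3; have := ler_normB (e * (1 - u r)) (A * th r).
    rewrite normrM [`|A * _|]gtr0_norm//.
    have -> : `|e| = 1 by case: eE => ->; rewrite ?normrN normr1.
    lra.
  - have := Hd y y0 yd; rewrite distrC => h.
    have : A * th y >= 1.
      rewrite -[leLHS](mulVf (x := th y)) ?gt_eqF// ler_wpM2r ?ltW//.
      have := sqrtr_ge0 y; rewrite /A; nra.
    have := ler_norm (e * (1 - u y)); rewrite normrM.
    have -> : `|e| = 1 by case: eE => ->; rewrite ?normrN normr1.
    lra.
  - move=> r r0 ry zr.
    have hr := Ath r r0 (ltW ry).
    have := Hd r r0 (lt_trans ry yd); rewrite ltr_norml => /andP[ur1 ur2].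
    have i0 : 0 < (r ^+ 2)^-1 by rewrite invr_gt0 exprn_gt0.
    have h1 : e * (1 - u r) / r ^+ 2 > A * (th r / r ^+ 2).
      by rewrite mulrA ltr_pM2r//; lra.
    set W := e * (1 - u r) / r ^+ 2 in h1.
    have -> : - (e * (k ^+ 2 * u r + (u r ^+ 2 - 1) * u r / r ^+ 2)) =
      - (e * (k ^+ 2 * u r)) + W * ((1 + u r) * u r) by rewrite /W; ring.
    have h2 : W * ((1 + u r) * u r) >= W * (7 / 4).
      by rewrite ler_wpM2l//; [lra|nra].
    have h3 : - (e * (k ^+ 2 * u r)) >= - (2 * k ^+ 2).
      by case: eE => ->; nra.
    lra.
exists A, y; split => // r r0 ry.
have := key 1 (expr1n _ _) r r0 (ltW ry); have := key (-1) N1 r r0 (ltW ry).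
rewrite thE// => h1 h2; split; first by rewrite ler_norml; apply/andP; split; lra.
by rewrite distrC Hd// (lt_trans ry).
Qed.

(** Since [1 - u = O(r^(3/2))], the mean value of [v] on [r, 2 r] is [O(sqrt r)], attained at some
    [c]. On [r, c] the equation gives [v' = O(1 / sqrt r)], so [v r] differs from [v c] by
    [O(sqrt r)] only. *)
Lemma sol_derive0 : v r @[r --> 0^'+] --> (0 : R).
Proof.
have [A [d [A0 d0 Hd]]] := sol_near0.
have k20 : 0 < k ^+ 2 by rewrite exprn_gt0.
(* 17 = 5 + 12: [5 A] bounds the mean value of [v], while [12 A] and [2 k^2] come from the two terms
   of [v']. *)
pose B := 17 * A + 2 * k ^+ 2.
have B0 : 0 < B by rewrite /B; lra.
have key r : 0 < r -> r < d / 2 -> r < 1 -> `|v r| <= B * Num.sqrt r.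
  move=> r0 rd r1; set s := Num.sqrt r.
  have s0 : 0 < s by rewrite sqrtr_gt0.
  have sr : s ^+ 2 = r by rewrite sqr_sqrtr ?ltW.
  have s1 : s < 1 by rewrite -sqrtr1 ltr_sqrt.
  have sq2 c : r <= c -> c <= 2 * r -> Num.sqrt c <= 2 * s.
    move=> rc c2; have c0 : 0 <= c by lra.
    have := sqr_sqrtr c0; have := sqrtr_ge0 c; nra.
  have [c [rc c2 ec]] : exists c, [/\ r < c, c < 2 * r & u (2 * r) - u r = v c * (2 * r - r)].
    by apply: MVT_cc; [lra|move=> s' *; apply: du; lra].
  have vc : `|v c| <= 5 * A * s.
    have [h1 _] := Hd r r0 ltac:(lra); have [h2 _] := Hd (2 * r) ltac:(lra) ltac:(lra).
    have h3 := sq2 (2 * r) ltac:(lra) (lexx _).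
    have : `|v c| * r <= 5 * A * s * r.
      rewrite -[X in `|_| * X](gtr0_norm r0) -normrM.
      have -> : v c * r = (1 - u r) - (1 - u (2 * r)) by rewrite -[v c * r]/(v c * r); lra.
      apply: le_trans (ler_normB _ _) _; apply: le_trans (lerD h1 h2) _.
      by rewrite -/s; have : A * (2 * r * Num.sqrt (2 * r)) <= A * (2 * r * (2 * s));
        [rewrite !ler_pM2l//; lra|lra].
    by rewrite ler_pM2r.
  have [b [rb bc' eb]] : exists b, [/\ r < b, b < c &
      v c - v r = (k ^+ 2 * u b + (u b ^+ 2 - 1) * u b / b ^+ 2) * (c - r)].
    apply: (@MVT_cc _ r c v (fun b => k ^+ 2 * u b + (u b ^+ 2 - 1) * u b / b ^+ 2)) => //.
    by move=> s' *; apply: dv; lra.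
  have b0 : 0 < b by lra.
  have [h1 h2] := Hd b b0 ltac:(lra).
  have h3 := sq2 b (ltW rb) ltac:(lra).
  move: h2; rewrite ltr_norml => /andP[ub1 ub2].
  have ib0 : 0 < (b ^+ 2)^-1 by rewrite invr_gt0 exprn_gt0.
  have hW : `|(u b ^+ 2 - 1) * u b / b ^+ 2| * r <= 12 * A * s.
    have -> : (u b ^+ 2 - 1) * u b / b ^+ 2 = - ((1 - u b) * ((1 + u b) * u b) / b ^+ 2) by ring.
    rewrite normrN normrM normrM [`|_^-1|]gtr0_norm//.
    rewrite [`|(1 + _) * _|]ger0_norm; last nra.
    apply: (@le_trans _ _ (A * (b * (2 * s)) * 6 / b ^+ 2 * r)).
      rewrite ler_wpM2r ?(ltW r0)// ler_wpM2r ?(ltW ib0)//.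
      apply: ler_pM => //; [nra| |nra].
      apply: le_trans h1 _; rewrite ler_pM2l// ler_pM2l//.
    have -> : A * (b * (2 * s)) * 6 / b ^+ 2 * r = 12 * A * s * (r / b).
      by field; rewrite gt_eqF.
    rewrite ger_pMr; last by rewrite !mulr_gt0.
    by rewrite ler_pdivrMr// mul1r ltW.
  have hk : `|k ^+ 2 * u b| <= 2 * k ^+ 2 by rewrite ler_norml; apply/andP; split; nra.
  have : `|(k ^+ 2 * u b + (u b ^+ 2 - 1) * u b / b ^+ 2) * (c - r)| <= 2 * k ^+ 2 * r + 12 * A * s.
    rewrite normrM [`|c - r|]gtr0_norm ?subr_gt0//.
    set X := `|_ + _|; have : X * (c - r) <= X * r by rewrite ler_wpM2l// ?normr_ge0//; lra.
    move/le_trans; apply; have := ler_normD (k ^+ 2 * u b) ((u b ^+ 2 - 1) * u b / b ^+ 2).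
    rewrite -/X => hX; apply: (@le_trans _ _ (2 * k ^+ 2 * r + `|(u b ^+ 2 - 1) * u b / b ^+ 2| * r)).
      by rewrite -mulrDl ler_wpM2r ?(ltW r0)//; lra.
    lra.
  rewrite -eb => h4; have -> : v r = v c - (v c - v r) by ring.
  have rs : r <= s by nra.
  have krs := ler_wpM2l (ltW k20) rs.
  apply: le_trans (ler_normB _ _) _; rewrite /B; lra.
apply: cvg_right0_ex => e e0.
exists (Num.min (d / 2) (Num.min 1 ((e / B) ^+ 2))).
  by rewrite !lt_min ltr01 exprn_gt0 ?divr_gt0//; lra.
move=> r r0; rewrite !lt_min => /and3P[rd r1 re]; rewrite subr0.
apply: le_lt_trans (key r r0 rd r1) _.
rewrite mulrC -ltr_pdivlMr//.
have : Num.sqrt r < Num.sqrt ((e / B) ^+ 2) by rewrite ltr_sqrt// exprn_gt0// divr_gt0.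
by rewrite sqrtr_sqr gtr0_norm// divr_gt0.
Qed.

(** Beyond [M] the equation reads [u'' = q u] with [l^2 < q <= k^2], so [C exp (- l r)] is a
    supersolution for both [u] and [- u]. The bound passes to [v] on [r, r + 1], where the mean
    value of [v] and [v' = q u] are both of this order. *)
Lemma sol_decay l : 0 < l -> l < k -> exists C M, [/\ 0 <= C, 0 < M &
  forall r, M < r -> `|u r| <= C * expR (- (l * r)) /\ `|v r| <= C * expR (- (l * r))].
Proof.
move=> l0 lk; have [_ u0] := Hbc.
have [M0 M00 HM0] := cvg_pinfty_lt u0 ltr01.
have kl : 0 < k ^+ 2 - l ^+ 2 by nra.
(* For [r >= M] one has [|u r| < 1] and [1 / r^2 <= 1 / r <= (k^2 - l^2) / 2], hence [q r > l^2]. *)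
pose M := Num.max (M0 + 1) (Num.max 1 (2 / (k ^+ 2 - l ^+ 2))).
have [MM0 M1 Mkl] : [/\ M0 + 1 <= M, 1 <= M & 2 / (k ^+ 2 - l ^+ 2) <= M].
  by rewrite /M !le_max !lexx !orbT.
have u1 r : M <= r -> `|u r| < 1 by move=> Mr; have := HM0 r ltac:(lra); rewrite subr0.
pose q r := k ^+ 2 + (u r ^+ 2 - 1) / r ^+ 2.
have qE r : k ^+ 2 * u r + (u r ^+ 2 - 1) * u r / r ^+ 2 = q r * u r by rewrite /q; ring.
have qb r : M <= r -> l ^+ 2 < q r /\ q r <= k ^+ 2.
  move=> Mr; have := u1 r Mr; rewrite ltr_norml => /andP[a1 a2].
  have i0 : 0 < (r ^+ 2)^-1 by rewrite invr_gt0 exprn_gt0//; lra.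
  have : (r ^+ 2)^-1 <= (k ^+ 2 - l ^+ 2) / 2.
    rewrite -[leRHS]invrK lef_pV2 ?posrE ?invr_gt0 ?exprn_gt0 ?divr_gt0//; last lra.
    by rewrite invf_div; nra.
  have u20 : 0 <= u r ^+ 2 by rewrite sqr_ge0.
  have u21 : u r ^+ 2 <= 1 by nra.
  have : - (r ^+ 2)^-1 <= (u r ^+ 2 - 1) / r ^+ 2 by move: i0; set X := (r ^+ 2)^-1 => i0; nra.
  have : (u r ^+ 2 - 1) / r ^+ 2 <= 0 by rewrite mulr_le0_ge0 ?(ltW i0)//; lra.
  rewrite /q; split; lra.
pose E r : R := expR (- (l * r)).
have E0 r : 0 < E r by exact: expR_gt0.
pose C := `|u M| / E M.
have C0 : 0 <= C by rewrite divr_ge0// ltW.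
have key (e : R) : e ^+ 2 = 1 -> forall r, M <= r -> e * u r - C * E r <= 0.
  move=> e1; have eE : e = 1 \/ e = -1.
    by move/eqP: e1; rewrite sqrf_eq1 => /orP[] /eqP; [left|right].
  have ne : `|e| = 1 by case: eE => ->; rewrite ?normrN normr1.
  apply: (@max_principle_pinfty _ M (fun r => e * u r - C * E r)
     (fun r => e * v r + C * (l * E r))
    (fun r => e * (q r * u r) - C * (l ^+ 2 * E r))).
  - move=> r Mr; have dur := du (r := r) ltac:(lra); rewrite /E; differentiate.
    by rewrite /E; ring.
  - move=> r Mr; have dvr := dv (r := r) ltac:(lra); rewrite /E; differentiate.
    by rewrite qE /E; ring.
  - rewrite (_ : 0 = e * 0 - C * 0); last by ring.
    apply: cvgB; apply: cvgMr => //; exact: cvg_expRN.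
  - rewrite /C divfK ?gt_eqF// subr_le0; apply: le_trans (ler_norm _) _.
    by rewrite normrM ne mul1r.
  - move=> r Mr zr; have [q1 q2] := qb r (ltW Mr).
    have := E0 r; have : 0 <= C * E r by rewrite mulr_ge0// ltW.
    have -> : e * (q r * u r) = q r * (e * u r) by ring.
    nra.
have uE r : M <= r -> `|u r| <= C * E r.
  move=> Mr; have := key 1 (expr1n _ _) r Mr; have := key (-1) N1 r Mr.
  by rewrite ler_norml => h1 h2; apply/andP; split; lra.
have k20 : 0 < k ^+ 2 by rewrite exprn_gt0.
have Emono r s : r <= s -> E s <= E r.
  by move=> rs; rewrite /E ler_expR lerN2 ler_pM2l.
exists ((3 + k ^+ 2) * C), M; split; [nra|lra|] => r Mr; rewrite -/(E r).
have CE := mulr_ge0 C0 (ltW (E0 r)).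
split; first by have := uE r (ltW Mr); nra.
have [c [rc c1 ec]] : exists c, [/\ r < c, c < r + 1 & u (r + 1) - u r = v c * (r + 1 - r)].
  by apply: MVT_cc; [lra|move=> s *; apply: du; lra].
have [b [rb bc' eb]] : exists b, [/\ r < b, b < c & v c - v r = (q b * u b) * (c - r)].
  apply: (@MVT_cc _ r c v (fun b => q b * u b)) => //.
  by move=> s *; rewrite -qE; apply: dv; lra.
have h1 := uE r (ltW Mr); have h2 := uE (r + 1) ltac:(lra); have h3 := uE b ltac:(lra).
have [q1 q2] := qb b ltac:(lra).
have {}h2 : `|u (r + 1)| <= C * E r by apply: le_trans h2 _; rewrite ler_wpM2l// Emono; lra.
have {}h3 : `|u b| <= C * E r by apply: le_trans h3 _; rewrite ler_wpM2l// Emono; lra.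
have vc : `|v c| <= 2 * (C * E r).
  have -> : v c = u (r + 1) - u r by rewrite ec; ring.
  by apply: le_trans (ler_normB _ _) _; lra.
have : `|q b * u b * (c - r)| <= k ^+ 2 * (C * E r).
  rewrite !normrM [`|c - r|]gtr0_norm ?subr_gt0// [`|q b|]gtr0_norm; last by nra.
  apply: (@le_trans _ _ (q b * `|u b| * 1)).
    by rewrite ler_wpM2l; [| |lra] => //; rewrite mulr_ge0//; nra.
  rewrite mulr1; apply: ler_pM => //; nra.
rewrite -eb => h4; have -> : v r = v c - (v c - v r) by ring.
by apply: le_trans (ler_normB _ _) _; nra.
Qed.

End Solution.
End Ode.

(** * Nonnegative solutions: bounds and monotonicity *)

Section Nonneg.
Context {R : realType}.
Variables (k : R) (u v : R -> R).
Hypotheses (k0 : 0 < k) (Hode : ode k u v) (Hbc : bc u).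
Hypothesis u_ge0 : forall r : R, 0 < r -> 0 <= u r.

Let du (r : R) : 0 < r -> is_derive r 1 u (v r).
Proof. by move=> /Hode[]. Qed.
Let dv (r : R) : 0 < r -> is_derive r 1 v (k ^+ 2 * u r + (u r ^+ 2 - 1) * u r / r ^+ 2).
Proof. by move=> /Hode[]. Qed.

Let k20 : 0 < k ^+ 2. Proof. by rewrite exprn_gt0. Qed.

(** Where [u > 1] the equation gives [u'' > 0], so the maximum principle at a level [c > 1] excludes
    larger values. A point with [u = 1] would then be a maximum at which [u'' = k^2 > 0]. *)
Lemma nonneg_sol_lt1 (r : R) : 0 < r -> u r < 1.
Proof.
have le1 (x : R) : 0 < x -> u x <= 1.
  move=> x0; rewrite leNgt; apply/negP => ux.
  have [u1 uy] := Hbc.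
  pose c := (1 + u x) / 2; have c1 : 1 < c by rewrite /c; lra.
  have [d d0 Hd] := cvg_right0_lt u1 (e := c - 1) ltac:(lra).
  have [M M0 HM] := cvg_pinfty_lt uy ltr01.
  pose a := Num.min x d / 2; pose b := Num.max x M + 1.
  have m0 : 0 < Num.min x d by rewrite lt_min x0.
  have [ax ad] : a < x /\ a < d by apply/andP; rewrite -lt_min /a; lra.
  have [xb Mb] : x < b /\ M < b by apply/andP; rewrite -gt_max /b; lra.
  have a0 : 0 < a by rewrite /a; lra.
  have : u x <= c; last by rewrite /c; lra.
  apply: (@max_principle _ a b c u v
    (fun r => k ^+ 2 * u r + (u r ^+ 2 - 1) * u r / r ^+ 2)); [lra|..|exact: ltW|exact: ltW].
  - by move=> s *; apply: du; lra.
  - by move=> s *; apply: dv; lra.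
  - by have := Hd a a0 ad; rewrite ltr_norml => /andP[]; lra.
  - by have := HM b Mb; rewrite ltr_norml => /andP[]; lra.
  - move=> s as_ sb us; have i0 : 0 < (s ^+ 2)^-1 by rewrite invr_gt0 exprn_gt0; lra.
    have : 0 <= (u s ^+ 2 - 1) * u s / s ^+ 2.
      by rewrite mulr_ge0 ?(ltW i0)// mulr_ge0; nra.
    have : 0 < k ^+ 2 * u s by rewrite mulr_gt0 ?exprn_gt0//; lra.
    lra.
move=> r0; rewrite lt_neqAle le1// andbT; apply/eqP => ur.
have : k ^+ 2 * u r + (u r ^+ 2 - 1) * u r / r ^+ 2 <= 0.
  apply: (local_max_second_derive (y := r + 1) r0 _ (fun s s0 _ => du s0) (dv r0)); first lra.
  by move=> s s0 _; rewrite ur le1.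
by rewrite ur expr1n subrr !mul0r; have := k20; lra.
Qed.

(* Since u'' <= k^2 u, this function is nonincreasing; as it tends to 0 at infinity,
   it is nonnegative. *)
Let w r : R := (v r + k * u r) * expR (- (k * r)).
Let dw (r : R) : 0 < r -> is_derive r 1 w ((u r ^+ 2 - 1) * u r / r ^+ 2 * expR (- (k * r))).
Proof.
move=> r0; have := du r0; have := dv r0 => h1 h2.
rewrite /w; differentiate.
by ring.
Qed.

Let w_incr (x y : R) : 0 < x -> x <= y -> w y <= w x.
Proof.
move=> x0 xy; rewrite -lerN2.
apply: (@ge0_derive_le _ x y (fun r => - w r)
  (fun r => - ((u r ^+ 2 - 1) * u r / r ^+ 2 * expR (- (k * r))))) => //.
  by move=> r *; apply: is_derive_oppf; apply: dw; lra.
move=> r xr ry; have r0 : 0 < r by lra.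
rewrite -!mulNr mulr_ge0 ?expR_ge0// mulr_ge0 ?invr_ge0 ?exprn_ge0 ?(ltW r0)//.
by have := u_ge0 r0; have := nonneg_sol_lt1 r0; nra.
Qed.

Let w_ge0 (r : R) : 0 < r -> 0 <= w r.
Proof.
move=> r0; rewrite leNgt; apply/negP => wr.
have k1 := k0; have k2 : 0 < k / 2 by lra.
have [C [M [C0 M0 HM]]] := sol_decay k0 Hode Hbc (l := k / 2) k2 ltac:(lra).
have [] := cvg_pinfty_lt (e := - w r / (C + k * C + 1)) (cvg_expRN k2).
  by rewrite divr_gt0//; [lra|nra].
move=> N N0 HN; pose s := Num.max r (Num.max M N) + 1.
have : Num.max r (Num.max M N) < s by rewrite /s; lra.
rewrite !gt_max => /and3P[rs Ms Ns].
have [us vs] := HM s Ms; have := HN s Ns; rewrite subr0.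
set E := expR (- (k / 2 * s)); rewrite -/E in us vs; have E0 : 0 < E by exact: expR_gt0.
rewrite gtr0_norm// ltr_pdivlMr; last by nra.
have := w_incr r0 (ltW rs); rewrite /w.
set F := expR (- (k * s)); have F0 : 0 < F by exact: expR_gt0.
have F1 : F <= 1 by rewrite /F expR_le1; nra.
move: us vs; rewrite !ler_norml => /andP[u1 u2] /andP[v1 v2].
rewrite -/(w r) => ws he.
have : - (C + k * C) * E <= v s + k * u s by nra.
have CE : 0 <= (C + k * C) * E by rewrite mulr_ge0 ?(ltW E0)//; nra.
nra.
Qed.

Let e r : R := u r * expR (k * r).
Let de (r : R) : 0 < r -> is_derive r 1 e ((v r + k * u r) * expR (k * r)).
Proof.
move=> r0; have h := du r0; rewrite /e; differentiate.
by ring.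
Qed.

Lemma nonneg_sol_log_derive (r : R) : 0 < r -> 0 <= v r + k * u r.
Proof. by move=> /w_ge0; rewrite pmulr_lge0// expR_gt0. Qed.

Let e_incr (x y : R) : 0 < x -> x <= y -> e x <= e y.
Proof.
move=> x0 xy; apply: (@ge0_derive_le _ x y e (fun r => (v r + k * u r) * expR (k * r))) => //.
  by move=> r *; apply: de; lra.
by move=> r xr ry; rewrite mulr_ge0 ?expR_ge0// nonneg_sol_log_derive//; lra.
Qed.

Let e_ge1 (r : R) : 0 < r -> 1 <= e r.
Proof.
move=> r0; apply/ler_addgt0Pr => s s0; have [u1 _] := Hbc.
have [d d0 Hd] := cvg_right0_lt u1 s0.
pose x := Num.min r d / 2; have m0 : 0 < Num.min r d by rewrite lt_min r0.
have [xr xd] : x < r /\ x < d by apply/andP; rewrite -lt_min /x; lra.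
have x0 : 0 < x by rewrite /x; lra.
have := e_incr x0 (ltW xr); have := Hd x x0 xd; rewrite ltr_norml => /andP[h1 h2].
have : 1 <= expR (k * x) by rewrite -expR0 ler_expR mulr_ge0 ?ltW.
have := u_ge0 x0; rewrite {1}/e; nra.
Qed.

Let u_gt0 (r : R) : 0 < r -> 0 < u r.
Proof.
move=> r0; have : 0 < e r by apply: lt_le_trans (e_ge1 r0); lra.
by rewrite pmulr_lgt0// expR_gt0.
Qed.

Let w_decr (x y : R) : 0 < x -> x < y -> w y < w x.
Proof.
move=> x0 xy; rewrite -ltrN2.
apply: (@gt0_derive_lt _ x y (fun r => - w r)
  (fun r => - ((u r ^+ 2 - 1) * u r / r ^+ 2 * expR (- (k * r))))) => //.
  by move=> r *; apply: is_derive_oppf; apply: dw; lra.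
move=> r xr ry; have r0 : 0 < r by lra.
rewrite -!mulNr mulr_gt0 ?expR_gt0// mulr_gt0 ?invr_gt0 ?exprn_gt0//.
by have := u_gt0 r0; have := nonneg_sol_lt1 r0; nra.
Qed.

(** A bootstrap: the weak bound [e >= 1] gives [u > 0], this makes [w] strictly decreasing and thus
    positive, and then [e] is strictly increasing. *)
Lemma nonneg_sol_gt (r : R) : 0 < r -> expR (- (k * r)) < u r.
Proof.
move=> r0; have : 1 < e r.
  apply: le_lt_trans (e_ge1 (r := r / 2) ltac:(lra)) _.
  apply: (@gt0_derive_lt _ (r / 2) r e (fun r => (v r + k * u r) * expR (k * r))); first lra.
    by move=> s *; apply: de; lra.
  move=> s rs sr; rewrite mulr_gt0 ?expR_gt0//.
  have s0 : 0 < s by lra.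
  have : 0 < w s by apply: le_lt_trans (w_ge0 r0) (w_decr s0 sr).
  by rewrite pmulr_lgt0// expR_gt0.
by rewrite /e -ltr_pdivrMr ?expR_gt0// mul1r expRN.
Qed.

Lemma nonneg_sol_gt0 (r : R) : 0 < r -> 0 < u r.
Proof. exact: u_gt0. Qed.

Let u_within (x y : R) : 0 < x -> {within `[x, y], continuous u}.
Proof. by move=> x0; apply: (is_derive_within (df := v)) => r *; apply: du; lra. Qed.

(* At a local minimum r1 and at a local maximum r2 > r1 with u r1 <= u r2, the
   signs of u'' give k^2 r1^2 >= 1 - (u r1)^2 >= 1 - (u r2)^2 >= k^2 r2^2. *)
Lemma nonneg_sol_decr (r s : R) : 0 < r -> r < s -> u s < u r.
Proof.
move=> r0 rs; rewrite ltNge; apply/negP => urs.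
have [u1 uy] := Hbc.
have s0 : 0 < s by lra.
have us0 := u_gt0 s0.
have [M M0 HM] := cvg_pinfty_lt uy us0.
pose b := Num.max s M + 1.
have [sb Mb] : s < b /\ M < b by apply/andP; rewrite -gt_max /b; lra.
have [m mrb mmax] := EVT_max (ltW (lt_trans rs sb)) (u_within (y := b) r0).
have [r2 [rr2 ur2 max2]] : exists r2, [/\ r < r2, u r <= u r2 & forall z, r < z -> u z <= u r2].
  have smax z : M < z -> u z < u s.
    by move=> /HM; rewrite subr0 => /(le_lt_trans (ler_norm _)).
  have max z : r < z -> u z <= u m.
    move=> rz; have [zb|bz] := leP z b; first by apply: mmax; rewrite in_itv/= zb ltW.
    apply: (@le_trans _ _ (u s)); first by apply/ltW/smax; lra.
    by apply: mmax; rewrite in_itv/= (ltW rs) ltW.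
  (* If the maximum sits at the left end [r], then [s], where [u s >= u r], is an interior maximum
     as well. *)
  move: mrb; rewrite in_itv/= => /andP[]; rewrite le_eqVlt => /predU1P[rm|rm] mb.
    exists s; split => // z rz; apply: le_trans (max z rz) _.
    by rewrite -rm.
  exists m; split => //; apply: mmax.
  by rewrite in_itv/= lexx ltW// (lt_trans rs).
have r20 : 0 < r2 by lra.
have ur21 := nonneg_sol_lt1 r20.
have h2 : k ^+ 2 * u r2 + (u r2 ^+ 2 - 1) * u r2 / r2 ^+ 2 <= 0.
  have du' z : r < z -> z < r2 + 1 -> is_derive z 1 u (v z) by move=> *; apply: du; lra.
  apply: (local_max_second_derive rr2 _ du' (dv r20)); first lra.
  by move=> z rz _; exact: max2.
have [d d0 Hd] := cvg_right0_lt u1 (e := 1 - u r2) ltac:(lra).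
pose a := Num.min r d / 2; have m0 : 0 < Num.min r d by rewrite lt_min r0.
have [ar ad] : a < r /\ a < d by apply/andP; rewrite -lt_min /a; lra.
have a0 : 0 < a by rewrite /a; lra.
have [n nar nmin] := EVT_min (ltW (lt_trans ar rr2)) (u_within (y := r2) a0).
have [r1 [r10 r12 ur1 min1]] : exists r1, [/\ 0 < r1, r1 < r2, u r1 <= u r2 &
    forall z, 0 < z -> z < r2 -> u r1 <= u z].
  have min z : 0 < z -> z < r2 -> u n <= u z.
    move=> z0 zr; have [za|az] := leP a z; first by apply: nmin; rewrite in_itv/= za ltW.
    apply: (@le_trans _ _ (u r2)); first by apply: nmin; rewrite in_itv/= lexx andbT ltW// (lt_trans ar).
    by have := Hd z z0 ltac:(lra); rewrite ltr_norml => /andP[]; lra.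
  have nr2 : u n <= u r2 by apply: nmin; rewrite in_itv/= lexx andbT ltW// (lt_trans ar).
  (* Symmetrically, if the minimum sits at the right end [r2], then [r], where [u r <= u r2], is an
     interior minimum. *)
  move: nar; rewrite in_itv/= => /andP[an]; rewrite le_eqVlt => /predU1P[nE|nr].
    exists r; split => // z z0 zr; apply: le_trans (min z z0 zr); rewrite nE; exact: ur2.
  by exists n; split => //; lra.
have h1 : 0 <= k ^+ 2 * u r1 + (u r1 ^+ 2 - 1) * u r1 / r1 ^+ 2.
  by apply: (local_min_second_derive r10 r12 (fun s s0 _ => du s0) (dv r10)).
have {}h1 : 1 - u r1 ^+ 2 <= k ^+ 2 * r1 ^+ 2.
  rewrite -ler_pdivrMr ?exprn_gt0// -subr_ge0 -(pmulr_lge0 _ (u_gt0 r10)).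
  by have -> : (k ^+ 2 - (1 - u r1 ^+ 2) / r1 ^+ 2) * u r1 =
    k ^+ 2 * u r1 + (u r1 ^+ 2 - 1) * u r1 / r1 ^+ 2 by ring.
have {}h2 : k ^+ 2 * r2 ^+ 2 <= 1 - u r2 ^+ 2.
  rewrite -ler_pdivlMr ?exprn_gt0// -subr_le0 -(pmulr_lle0 _ (u_gt0 r20)).
  by have -> : (k ^+ 2 - (1 - u r2 ^+ 2) / r2 ^+ 2) * u r2 =
    k ^+ 2 * u r2 + (u r2 ^+ 2 - 1) * u r2 / r2 ^+ 2 by ring.
have : u r1 ^+ 2 <= u r2 ^+ 2 by have := u_gt0 r10; nra.
have : k ^+ 2 * r1 ^+ 2 < k ^+ 2 * r2 ^+ 2 by rewrite ltr_pM2l ?exprn_gt0//; nra.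
lra.
Qed.

End Nonneg.

(** * Integrals on the half-line *)

Section Continuity.
Context {R : realType}.
Implicit Types (f g : R -> R) (r x y : R).

Lemma contC (c r : R) : {for r, continuous (fun=> c : R)}.
Proof. exact: cvg_cst. Qed.
Lemma contI r : {for r, continuous (fun x : R => x)}.
Proof. exact: cvg_id. Qed.
Lemma contD f g r : {for r, continuous f} -> {for r, continuous g} ->
  {for r, continuous (fun x => f x + g x)}.
Proof. by move=> *; apply: cvgD. Qed.
Lemma contN f r : {for r, continuous f} -> {for r, continuous (fun x => - f x)}.
Proof. by move=> *; apply: cvgN. Qed.
Lemma contM f g r : {for r, continuous f} -> {for r, continuous g} ->
  {for r, continuous (fun x => f x * g x)}.
Proof. by move=> *; apply: cvgM. Qed.
Lemma contX f n r : {for r, continuous f} -> {for r, continuous (fun x => f x ^+ n)}.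
Proof.
move=> cf; elim: n => [|n IH]; first exact: contC.
have -> : (fun x => f x ^+ n.+1) = (fun x => f x * f x ^+ n).
  by apply/funext => x; rewrite exprS.
exact: contM.
Qed.
Lemma contV f r : f r != 0 -> {for r, continuous f} -> {for r, continuous (fun x => (f x)^-1)}.
Proof. by move=> *; apply: cvgV. Qed.
End Continuity.

Ltac cont := repeat (try eassumption; lazymatch goal with
  | |- {for _, continuous (fun=> ?c)} => simple refine (@contC _ c _)
  | |- {for _, continuous (fun x => x)} => simple refine (@contI _ _)
  | |- {for _, continuous (fun x => @?f x + @?g x)} => simple refine (@contD _ f g _ _ _)
  | |- {for _, continuous (fun x => - @?f x)} => simple refine (@contN _ f _ _)
  | |- {for _, continuous (fun x => @?f x * @?g x)} => simple refine (@contM _ f g _ _ _)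
  | |- {for _, continuous (fun x => @?f x ^+ ?n)} => simple refine (@contX _ f n _ _)
  | |- {for _, continuous (fun x => (@?f x)^-1)} => simple refine (@contV _ f _ _ _)
  end).

Section Integration.
Context {R : realType}.
Implicit Types (f g F G df : R -> R) (r x y : R).
Local Notation mu := (@lebesgue_measure R).

Lemma continuous_pos_measurable G : (forall r, 0 < r -> {for r, continuous G}) ->
  measurable_fun `](0:R)%R, +oo[ G.
Proof.
move=> cG; apply: open_continuous_measurable_fun; first exact: interval_open.
by move=> r; rewrite inE/= in_itv/= andbT; exact: cG.
Qed.

(** Monotone convergence along [](n+1)^-1, n+1[]; the slack [e] leaves room for boundary terms that
    vanish only in the limit. *)
Lemma integral_pos_le G (M : R) : (forall r, 0 < r -> {for r, continuous G}) ->
  (forall r, 0 < r -> 0 <= G r) ->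
  (forall e, 0 < e -> exists d K, 0 < d /\ forall x y, 0 < x -> x < d -> K < y -> x < y ->
     (\int[mu]_(r in `]x, y[) (G r)%:E <= (M + e)%:E)%E) ->
  (\int[mu]_(r in `](0:R)%R, +oo[) (G r)%:E <= M%:E)%E.
Proof.
move=> cG G0 H; apply/lee_addgt0Pr => e e0.
have [d [K [d0 {}H]]] := H e e0.
pose F n : set (measurableTypeR R) := `](n.+1%:R)^-1, n.+1%:R[%classic.
have FE : `](0:R)%R, +oo[%classic = \bigcup_n F n.
  apply/seteqP; split => r /=; rewrite in_itv/= ?andbT.
    move=> r0; have [n rn] : exists n, Num.max r r^-1 < n%:R.
      by exists (Num.bound (Num.max r r^-1)); rewrite archi_boundP// le_max ltW.
    exists n => //; rewrite /F/= in_itv/=; move: rn; rewrite gt_max => /andP[rn rn'].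
    have nn : n%:R < n.+1%:R :> R by rewrite ltr_nat.
    rewrite (lt_trans rn nn) andbT -[ltRHS]invrK ltf_pV2 ?posrE ?invr_gt0//.
    exact: lt_trans nn.
  by move=> [n _]; rewrite /F/= in_itv/= => /andP[nr _]; apply: lt_trans nr.
have mG : measurable_fun `](0:R)%R, +oo[ (fun r => (G r)%:E).
  by apply/measurable_EFinP; exact: (continuous_pos_measurable cG).
have Fpos n : F n `<=` `](0:R)%R, +oo[.
  by rewrite FE => r Fr; exists n.
have cvgF : (\int[mu]_(r in F i) (G r)%:E)%E @[i --> \oo] -->
    (\int[mu]_(r in \bigcup_i F i) (G r)%:E)%E.
  apply: ge0_nondecreasing_set_cvg_integral => //.
  - apply/nondecreasing_seqP => n; apply/subsetPset => r; rewrite /F/= !in_itv/= => /andP[h1 h2].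
    rewrite (le_lt_trans _ h1)/= ?(lt_trans h2) ?ltr_nat// lef_pV2 ?posrE// ler_nat//.
  - by move=> n; exact: measurable_itv.
  - by move=> n; exact: measurable_funS (Fpos n) mG.
  - by move=> n r /Fpos; rewrite /= in_itv/= andbT lee_fin => /G0.
rewrite FE -(cvg_lim _ cvgF)//; apply: lime_le; first by apply/cvg_ex; eexists; exact: cvgF.
have [N HN] : exists N : nat, Num.max 1 (Num.max d^-1 K) < N%:R.
  by exists (Num.bound (Num.max 1 (Num.max d^-1 K))); rewrite archi_boundP// le_max ler01.
near=> n; have Nn : (N <= n)%N by near: n; exact: nbhs_infty_ge.
have : Num.max 1 (Num.max d^-1 K) < n.+1%:R :> R.
  by apply: lt_trans HN _; rewrite ltr_nat ltnS.
rewrite !gt_max => /and3P[n1 nd nK]; rewrite -EFinD; apply: H => //.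
- by rewrite invf_plt// posrE.
- by apply: (lt_trans _ n1); rewrite invf_lt1.
Unshelve. all: by end_near. Qed.

(** [G] is integrated from [x / 2] and up to [y + 1], so that [F] has a two-sided derivative at [x]
    and [y] too. *)
Lemma antiderivative_itv G x y : (forall r, 0 < r -> {for r, continuous G}) ->
  0 < x -> x < y -> exists2 F, (forall r, x <= r -> r <= y -> is_derive r 1 F (G r)) &
    forall s t, x <= s -> s <= t -> t <= y ->
      (\int[mu]_(r in `]s, t[) (G r)%:E = (F t - F s)%:E)%E.
Proof.
move=> cG x0 xy; pose a := x / 2; have [a0 ax] : 0 < a /\ a < x by rewrite /a; lra.
have iG : mu.-integrable `[a, y + 1] (EFin \o G).
  apply: continuous_compact_integrable; first exact: segment_compact.
  apply: continuous_in_subspaceT => r; rewrite inE/= in_itv/= => /andP[ar _].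
  by apply: cG; lra.
pose F t := (\int[mu]_(r in `[a, t]) G r)%R.
exists F.
  move=> r xr ry; have [] := @continuous_FTC1_closed R G a r (y + 1) _ iG _ (cG r _); try lra.
  by move=> dF eF; apply: DeriveDef; [exact: dF|rewrite -derive1E; exact: eF].
move=> s t xs st ty.
have iG' : mu.-integrable `[a, t] (EFin \o G).
  apply: (integrableS _ _ _ iG) => //.
  by apply: subset_itvl; rewrite bnd_simp; lra.
have iG'' : mu.-integrable `]s, t] (EFin \o G).
  apply: (integrableS _ _ _ iG') => //.
  by apply: subset_itv; rewrite bnd_simp; lra.
have := @Rintegral_itvB R G (BLeft a) (BRight t) s iG'.
rewrite !bnd_simp => /(_ ltac:(lra) st); rewrite -/(F t) -/(F s) => ->.
rewrite /Rintegral fineK.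
  apply/esym; apply: (@integral_itv_bndoo _ s t (EFin \o G) false false).
  by apply: measurable_funS (measurable_int _ iG'') => //; apply: subset_itvl; rewrite bnd_simp.
by apply: integrable_fin_num.
Qed.

Lemma antiderivative G x y : (forall r, 0 < r -> {for r, continuous G}) ->
  0 < x -> x < y -> exists2 F, (forall r, x <= r -> r <= y -> is_derive r 1 F (G r)) &
    (\int[mu]_(r in `]x, y[) (G r)%:E = (F y - F x)%:E)%E.
Proof.
move=> cG x0 xy; have [F dF eF] := antiderivative_itv cG x0 xy; exists F => //.
by apply: eF => //; exact: ltW.
Qed.

Lemma abs_contD x y f g : abs_cont_on x y f -> abs_cont_on x y g ->
  abs_cont_on x y (fun r => f r + g r).
Proof.
move=> cf cg; apply: (abs_cont_dom ltr01 cf cg) => s t xs st ty; rewrite mul1r.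
by apply: le_trans (ler_normD _ _); rewrite le_eqVlt; apply/orP; left; apply/eqP; congr `|_|; ring.
Qed.

Lemma abs_cont_bounded x y f : x <= y -> abs_cont_on x y f ->
  exists2 M, 0 < M & forall r, x <= r -> r <= y -> `|f r| <= M.
Proof.
move=> xy cf; pose V t := fine (total_variation x t f).
have V0 t : x <= t -> t <= y -> V t <= V y.
  move=> xt ty; rewrite -subr_ge0.
  by apply: le_trans (abs_cont_le_variation cf xt ty (lexx _)).
exists (`|f x| + `|V y - V x| + 1); first by have := normr_ge0 (f x); have := normr_ge0 (V y - V x); lra.
move=> r xr ry; have := abs_cont_le_variation cf (lexx _) xr ry.
rewrite -/(V r) -/(V x) => h; have := V0 r xr ry; have := ler_norm (V y - V x).
have := ler_normD (f r - f x) (f x); rewrite subrK; lra.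
Qed.

Lemma abs_contM x y f g : abs_cont_on x y f -> abs_cont_on x y g ->
  abs_cont_on x y (fun r => f r * g r).
Proof.
move=> cf cg; have [xy|yx] := leP x y; last first.
  move=> e e0; exists 1 => // n s t h _ _.
  have [n0|n0] := posnP n; first by rewrite n0 big_ord0.
  by have [a1 a2 a3] := h _ n0; lra.
have [M M0 HM] := abs_cont_bounded xy cf; have [N N0 HN] := abs_cont_bounded xy cg.
have MN0 : 0 < M + N by lra.
apply: (abs_cont_dom MN0 cf cg) => s t xs st ty.
have -> : f t * g t - f s * g s = (f t - f s) * g t + f s * (g t - g s) by ring.
apply: le_trans (ler_normD _ _) _; rewrite !normrM.
have h1 := HM s xs ltac:(lra); have h2 := HN t ltac:(lra) ty.
have := normr_ge0 (f t - f s); have := normr_ge0 (g t - g s).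
nra.
Qed.

Lemma abs_cont_C1 x y f df : (forall r, x <= r -> r <= y -> is_derive r 1 f (df r)) ->
  (forall r, x <= r -> r <= y -> {for r, continuous df}) -> abs_cont_on x y f.
Proof.
move=> Hf cdf; have [xy|yx] := leP x y; last first.
  move=> e e0; exists 1 => // n s t h _ _.
  have [n0|n0] := posnP n; first by rewrite n0 big_ord0.
  by have [a1 a2 a3] := h _ n0; lra.
have cd : {within `[x, y], continuous (fun r => `|df r|)}.
  apply: continuous_in_subspaceT => r; rewrite inE/= in_itv/= => /andP[xr ry].
  by apply: (continuous_comp (cdf r xr ry)); exact: norm_continuous.
have [m _ mmax] := EVT_max xy cd.
have K0 : 0 < `|df m| + 1 by have := normr_ge0 (df m); lra.
apply: (abs_cont_dom (g := id) K0 (abs_cont_id x y) (abs_cont_id x y)) => s t xs st ty.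
rewrite /= [`|t - s|]ger0_norm ?subr_ge0//.
move: st; rewrite le_eqVlt => /predU1P[->|st]; first by rewrite !subrr normr0; nra.
have [c [sc ct ->]] : exists c, [/\ s < c, c < t & f t - f s = df c * (t - s)].
  by apply: MVT_cc => // r sr rt; apply: Hf; lra.
rewrite normrM [`|t - s|]gtr0_norm ?subr_gt0//.
have : `|df c| <= `|df m| by apply: mmax; rewrite in_itv/=; lra.
have := normr_ge0 (df c); nra.
Qed.

Lemma loc_abs_cont_continuous f r : loc_abs_cont_pos f -> 0 < r -> {for r, continuous f}.
Proof.
move=> acf r0; have r2 : 0 < r / 2 by lra.
have ac := acf (r / 2) (r + 1) r2 ltac:(lra).
apply/cvgrPdist_lt => e e0; have [d d0 Hd] := abs_cont_uniform ac e0.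
near=> s.
have [s1 s2 s3 s4] : [/\ r / 2 <= s, s <= r + 1, s < r + d & r - d < s].
  split; near: s.
  - by apply: lt_le_nbhsr; lra.
  - by apply: lt_le_nbhsl; lra.
  - by apply: lt_nbhsl; lra.
  - by apply: lt_nbhsr; lra.
have [rs|sr] := leP r s; first by rewrite distrC; apply: Hd; lra.
by apply: Hd; [| exact: ltW| |]; lra.
Unshelve. all: by end_near. Qed.

End Integration.

(** * Picone's identity *)

Section Picone.
Context {R : realType}.
Local Notation mu := (@lebesgue_measure R).

Definition energy_density (k : R) (f : R -> R) (r : R) : R :=
  2 * (derive1 f r) ^+ 2 + (1 - f r ^+ 2) ^+ 2 / r ^+ 2 + 2 * k ^+ 2 * f r ^+ 2.

Lemma energy_density_ge0 k f r : 0 <= energy_density k f r.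
Proof.
have h1 := sqr_ge0 (derive1 f r).
have h2 : 0 <= (1 - f r ^+ 2) ^+ 2 / r ^+ 2 by rewrite divr_ge0 ?sqr_ge0.
have h3 : 0 <= k ^+ 2 * f r ^+ 2 by rewrite mulr_ge0 ?sqr_ge0.
by rewrite /energy_density; lra.
Qed.

Lemma energyE (a b k : R) f : a * b = 2 * k ^+ 2 ->
  energy a b f = (\int[mu]_(r in `](0:R)%R, +oo[) (energy_density k f r)%:E)%E.
Proof. by move=> ab; rewrite /energy /energy_density ab. Qed.

Lemma energy_density_sub_le k f (x y : R) : 0 <= x ->
  (\int[mu]_(r in `]x, y[) (energy_density k f r)%:E <=
   \int[mu]_(r in `](0:R)%R, +oo[) (energy_density k f r)%:E)%E.
Proof.
move=> x0; apply: ge0_le_integral_nonmeasurable => //.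
- by move=> r; rewrite lee_fin energy_density_ge0.
- by move=> r; rewrite lee_fin energy_density_ge0.
- by move=> r /=; rewrite !in_itv/= andbT => /andP[xr _]; apply: le_lt_trans xr.
Qed.

Lemma ode_derive1 (k : R) (u v : R -> R) r : ode k u v -> 0 < r -> derive1 u r = v r.
Proof. by move=> H /H[[_ <-] _]; rewrite derive1E. Qed.

Section Gap.
Variables (k : R) (u v f : R -> R).
Hypotheses (k0 : 0 < k) (Hode : ode k u v) (Hbc : bc u).
Hypothesis u_ge0 : forall r : R, 0 < r -> 0 <= u r.
Hypotheses (acf : loc_abs_cont_pos f) (bcf : bc f).

(** With [v] in place of [derive1 u] the density is visibly continuous for [r > 0], hence measurable
    and endowed with an antiderivative. *)
Definition sol_density r := 2 * v r ^+ 2 + (1 - u r ^+ 2) ^+ 2 / r ^+ 2 + 2 * k ^+ 2 * u r ^+ 2.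
Definition gap r := (f r ^+ 2 - u r ^+ 2) ^+ 2 / r ^+ 2.
Definition bdry r := 2 * (v r / u r) * (f r ^+ 2 - u r ^+ 2).

Let du (r : R) : 0 < r -> is_derive r 1 u (v r).
Proof. by move=> /Hode[]. Qed.
Let dv (r : R) : 0 < r ->
  is_derive r 1 v (k ^+ 2 * u r + (u r ^+ 2 - 1) * u r / r ^+ 2).
Proof. by move=> /Hode[]. Qed.
Let cu (r : R) : 0 < r -> {for r, continuous u}.
Proof. by move=> /du; exact: is_derive_continuous. Qed.
Let cv (r : R) : 0 < r -> {for r, continuous v}.
Proof. by move=> /dv; exact: is_derive_continuous. Qed.
Let cf (r : R) : 0 < r -> {for r, continuous f}.
Proof. exact: loc_abs_cont_continuous. Qed.
Let u0 (r : R) : 0 < r -> 0 < u r.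
Proof. exact: (nonneg_sol_gt0 k0 Hode Hbc u_ge0). Qed.

Lemma sol_density_continuous (r : R) : 0 < r -> {for r, continuous sol_density}.
Proof.
move=> r0; have h1 := cu r0; have h2 := cv r0; rewrite /sol_density; cont.
by rewrite gt_eqF// exprn_gt0.
Qed.

Lemma gap_continuous (r : R) : 0 < r -> {for r, continuous gap}.
Proof.
move=> r0; have h1 := cu r0; have h2 := cf r0; rewrite /gap; cont.
by rewrite gt_eqF// exprn_gt0.
Qed.

Lemma sol_density_ge0 (r : R) : 0 <= sol_density r.
Proof.
have h1 := sqr_ge0 (v r).
have h2 : 0 <= (1 - u r ^+ 2) ^+ 2 / r ^+ 2 by rewrite divr_ge0 ?sqr_ge0.
have h3 : 0 <= k ^+ 2 * u r ^+ 2 by rewrite mulr_ge0 ?sqr_ge0.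
by rewrite /sol_density; lra.
Qed.

Lemma gap_ge0 (r : R) : 0 <= gap r.
Proof. by rewrite divr_ge0 ?sqr_ge0. Qed.

(* Picone's identity:
   energy_density f = sol_density + gap + bdry' + 2 (f' - (v / u) f)^2. *)
Lemma picone (x y : R) : 0 < x -> x < y ->
  (\int[mu]_(r in `]x, y[) (sol_density r + gap r)%:E + (bdry y - bdry x)%:E
   <= \int[mu]_(r in `]x, y[) (energy_density k f r)%:E)%E.
Proof.
move=> x0 xy.
have cG (r : R) : 0 < r -> {for r, continuous (fun r => sol_density r + gap r)}.
  by move=> r0; apply: contD; [exact: sol_density_continuous|exact: gap_continuous].
have [F dF ->] := antiderivative cG x0 xy.
pose q (r : R) := k ^+ 2 + (u r ^+ 2 - 1) / r ^+ 2.
pose p (r : R) := v r / u r.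
have dp (r : R) : 0 < r -> is_derive r 1 p (q r - p r ^+ 2).
  move=> r0; have h1 := du r0; have h2 := dv r0; have h3 := u0 r0.
  rewrite /p; differentiate; rewrite /q; field; rewrite !gt_eqF//.
have cp (r : R) : 0 < r -> {for r, continuous (fun r => q r - p r ^+ 2)}.
  move=> r0; have h1 := cu r0; have h2 := cv r0; have h3 := u0 r0.
  by rewrite /q /p; cont; rewrite gt_eqF// exprn_gt0.
have acp : abs_cont_on x y p.
  exact: (abs_cont_C1 (fun r xr _ => dp r (lt_le_trans x0 xr)) (fun r xr _ => cp r (lt_le_trans x0 xr))).
have acu : abs_cont_on x y u.
  exact: (abs_cont_C1 (fun r xr _ => du (lt_le_trans x0 xr)) (fun r xr _ => cv (lt_le_trans x0 xr))).
have acF : abs_cont_on x y F.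
  exact: (abs_cont_C1 dF (fun r xr _ => cG r (lt_le_trans x0 xr))).
have acf' := acf x0 (ltW xy).
(* This is [F + bdry], spelled with sums and products so that [abs_contD] and [abs_contM] apply. *)
pose Phi (r : R) := F r + (p r + p r) * (f r * f r + (-1 * u r) * u r).
have acm : abs_cont_on x y (fun=> -1 : R).
  exact: (abs_cont_C1 (fun r _ _ => is_derive_cstf (-1) r) (fun r _ _ => @contC _ 0 r)).
have acPhi : abs_cont_on x y Phi.
  apply: abs_contD => //; apply: abs_contM; first exact: abs_contD.
  by apply: abs_contD; [exact: abs_contM|apply: abs_contM => //; exact: abs_contM].
have PhiE (r : R) : Phi r = F r + bdry r by rewrite /Phi /bdry -/(p r); ring.
have -> : ((F y - F x)%:E + (bdry y - bdry x)%:E)%E = (Phi y - Phi x)%:E.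
  by rewrite -EFinD !PhiE; congr EFin; ring.
apply: abs_cont_le_integral => //; first by move=> r; exact: energy_density_ge0.
have [d _ [_]] := abs_cont_ae_derive xy acf'.
apply: filterS; first exact: (ae_filter_ringOfSetsType mu).
move=> r /= H /[dup] /H {}H /andP[xr ry] _.
have r0 : 0 < r by lra.
have h1 := du r0; have h2 := dp r r0; have h3 := dF r (ltW xr) (ltW ry).
have h4 := u0 r0.
have df : is_derive r 1 f (derive1 f r) by have [df _] := H; apply: DeriveDef; [exact: df|rewrite derive1E].
have dPhi : is_derive r 1 Phi (energy_density k f r - 2 * (derive1 f r - p r * f r) ^+ 2).
  rewrite /Phi; differentiate; rewrite /energy_density /sol_density /gap /q /p; field; rewrite !gt_eqF//.
have -> : derive1 Phi r = energy_density k f r - 2 * (derive1 f r - p r * f r) ^+ 2.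
  by have [_ <-] := dPhi; rewrite derive1E.
by rewrite gerBl; have := sqr_ge0 (derive1 f r - p r * f r); lra.
Qed.

(** At 0 both [v / u] and [f^2 - u^2] tend to 0. At infinity [bdry = 2 (v / u) f^2 - 2 u v >= - 2 k
    f^2 - 2 u v], which tends to 0 however slowly [f] decays. *)
Lemma bdry_small (e : R) : 0 < e -> exists d K, 0 < d /\
  forall x y, 0 < x -> x < d -> K < y -> - e <= bdry y - bdry x.
Proof.
move=> e0; have [u1 uy] := Hbc; have [f1 fy] := bcf.
have v1 := sol_derive0 k0 Hode Hbc.
have e2 : 0 < e / 2 by lra.
have bd0 : bdry r @[r --> 0^'+] --> (2 * (0 / 1) * (1 * 1 - 1 * 1) : R).
  rewrite /bdry; apply: cvgM.
    by apply: cvgM; [exact: cvg_cst|apply: cvgM => //; apply: cvgV => //; exact: oner_neq0].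
  by apply: cvgB; exact: cvgM.
have [d d0 Hd] := cvg_right0_lt bd0 e2.
have k2 : 0 < k / 2 by have := k0; lra.
have k2k : k / 2 < k by have := k0; lra.
have [C [M [C0 M0 HM]]] := sol_decay k0 Hode Hbc k2 k2k.
have v2 : v r @[r --> +oo] --> (0 : R).
  have CE : C * expR (- (k / 2 * r)) @[r --> +oo] --> (C * 0 : R).
    by apply: cvgMr; exact: cvg_expRN.
  apply: cvg_pinfty_ex => s s0; have [K K0 HK] := cvg_pinfty_lt CE s0.
  exists (Num.max K M) => r; rewrite gt_max => /andP[Kr Mr].
  rewrite subr0; have [_ h] := HM r Mr; apply: le_lt_trans h _.
  by have := HK r Kr; rewrite mulr0 subr0 => /(le_lt_trans (ler_norm _)).
have low : 2 * k * (f r * f r) + 2 * (u r * v r) @[r --> +oo] --> (2 * k * (0 * 0) + 2 * (0 * 0) : R).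
  by apply: cvgD; (apply: cvgM; first exact: cvg_cst); exact: cvgM.
have [K K0 HK] := cvg_pinfty_lt low e2.
exists d, K; split => // x y x0 xd Ky.
have := Hd x x0 xd; rewrite ltr_norml => /andP[_ h1].
have := HK y Ky; rewrite ltr_norml => /andP[_ h2].
have y0 : 0 < y by lra.
have uy0 := u0 y0.
have pk : - k <= v y / u y.
  have := nonneg_sol_log_derive k0 Hode Hbc u_ge0 y0.
  by rewrite ler_pdivlMr// mulNr; lra.
have : - (2 * k * (f y * f y) + 2 * (u y * v y)) <= bdry y.
  have -> : bdry y = 2 * ((v y / u y) * (f y * f y)) - 2 * (u y * v y).
    by rewrite /bdry; field; rewrite gt_eqF.
  have : - k * (f y * f y) <= v y / u y * (f y * f y) by rewrite ler_wpM2r// -expr2 sqr_ge0.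
  lra.
by move: h1 h2; rewrite !mul0r !mulr0 !mulr1 !subrr !addr0 mulr0 !subr0; lra.
Qed.

Lemma gap_le_energy (M : R) :
  (\int[mu]_(r in `](0:R)%R, +oo[) (energy_density k f r)%:E <= M%:E)%E ->
  (\int[mu]_(r in `](0:R)%R, +oo[) (sol_density r + gap r)%:E <= M%:E)%E.
Proof.
move=> fM; apply: integral_pos_le.
- by move=> r r0; apply: contD; [exact: sol_density_continuous|exact: gap_continuous].
- by move=> r r0; rewrite addr_ge0 ?sol_density_ge0 ?gap_ge0.
move=> e e0; have [d [K [d0 H]]] := bdry_small e0; exists d, K; split => // x y x0 xd Ky xy.
have h1 := H x y x0 xd Ky.
have := le_trans (picone x0 xy) (le_trans (energy_density_sub_le _ _ _ (ltW x0)) fM).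
rewrite -leeBrDr// => /le_trans; apply; rewrite -EFinB lee_fin; lra.
Qed.

End Gap.

End Picone.

(** * Minimality, uniqueness and the lower energy bound *)

Section Minimality.
Context {R : realType}.
Local Notation mu := (@lebesgue_measure R).
Implicit Types (k M : R) (u v f : R -> R).

Lemma sol_loc_abs_cont k u v : ode k u v -> loc_abs_cont_pos u.
Proof.
move=> Hode x y x0 xy.
apply: (abs_cont_C1 (df := v)) => r xr ry; have [] := Hode r (lt_le_trans x0 xr) => // _.
exact: is_derive_continuous.
Qed.

Lemma sol_energyE k u v : ode k u v ->
  (\int[mu]_(r in `](0:R)%R, +oo[) (energy_density k u r)%:E =
   \int[mu]_(r in `](0:R)%R, +oo[) (sol_density k u v r)%:E)%E.
Proof.
move=> Hode; apply: eq_integral => r; rewrite inE/= in_itv/= andbT => r0.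
by rewrite /energy_density /sol_density (ode_derive1 Hode r0).
Qed.

Lemma nonneg_sol_energy_le k u v f M : 0 < k -> ode k u v -> bc u ->
  (forall r : R, 0 < r -> 0 <= u r) -> loc_abs_cont_pos f -> bc f ->
  (\int[mu]_(r in `](0:R)%R, +oo[) (energy_density k f r)%:E <= M%:E ->
   \int[mu]_(r in `](0:R)%R, +oo[) (energy_density k u r)%:E <= M%:E)%E.
Proof.
move=> k0 Hode Hbc u_ge0 acf bcf fM; rewrite (sol_energyE Hode).
apply: le_trans (gap_le_energy k0 Hode Hbc u_ge0 acf bcf fM).
apply: ge0_le_integral_nonmeasurable => //.
- by move=> r; rewrite lee_fin sol_density_ge0.
- by move=> r; rewrite lee_fin addr_ge0 ?sol_density_ge0 ?gap_ge0.
- by move=> r _; rewrite lee_fin lerDl gap_ge0.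
Qed.

(** Equal energies force the integral of [gap] to vanish, and [gap] is continuous, so
    [f^2 = u^2 > 0]. The sign is settled by continuity: [f] starts near 1 and has no zero. *)
Lemma nonneg_sol_unique_minimizer k u v f : 0 < k -> ode k u v -> bc u ->
  (forall r : R, 0 < r -> 0 <= u r) -> loc_abs_cont_pos f -> bc f ->
  (\int[mu]_(r in `](0:R)%R, +oo[) (energy_density k u r)%:E < +oo)%E ->
  (\int[mu]_(r in `](0:R)%R, +oo[) (energy_density k f r)%:E <=
   \int[mu]_(r in `](0:R)%R, +oo[) (energy_density k u r)%:E)%E ->
  forall r : R, 0 < r -> f r = u r.
Proof.
move=> k0 Hode Hbc u_ge0 acf bcf uy fu.
set I := (\int[mu]_(r in _) (energy_density k u r)%:E)%E in uy fu.
have I0 : (0 <= I)%E by apply: integral_ge0 => r _; rewrite lee_fin energy_density_ge0.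
have Ifin : I \is a fin_num by rewrite ge0_fin_numE.
have := @gap_le_energy R k u v f k0 Hode Hbc u_ge0 acf bcf (fine I).
rewrite fineK// => /(_ fu).
have mpos : measurable (`](0:R)%R, +oo[%classic : set (measurableTypeR R)) by exact: measurable_itv.
have cgap := gap_continuous Hode acf.
have csol := sol_density_continuous Hode.
have mgap : measurable_fun `](0:R)%R, +oo[ (EFin \o gap u f).
  by apply/measurable_EFinP; exact: (continuous_pos_measurable cgap).
have msol : measurable_fun `](0:R)%R, +oo[ (EFin \o sol_density k u v).
  by apply/measurable_EFinP; exact: (continuous_pos_measurable csol).
under eq_integral do rewrite EFinD.
rewrite ge0_integralD//; last 2 first.
- by move=> r _; rewrite lee_fin sol_density_ge0.
- by move=> r _; rewrite lee_fin gap_ge0.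
rewrite -(sol_energyE Hode) -/I => gapI.
have {gapI} gap0 : (\int[mu]_(r in `](0:R)%R, +oo[) (gap u f r)%:E <= 0)%E.
  move: gapI; set J := (\int[mu]_(r in _) (gap u f r)%:E)%E.
  by rewrite -[X in (_ <= X -> _)%E]adde0 leeD2lE.
have sqE (r : R) : 0 < r -> f r ^+ 2 = u r ^+ 2.
  move=> r0; apply/eqP; rewrite -subr_eq0; apply/negP => /negP fur.
  have gr : 0 < gap u f r by rewrite /gap divr_gt0//; [rewrite exprn_even_gt0|rewrite exprn_gt0].
  have r2 : 0 < r / 2 by lra.
  have [F dF eF] := antiderivative cgap r2 (y := r + 1) ltac:(lra).
  have : (\int[mu]_(s in `](r / 2)%R, (r + 1)%R[) (gap u f s)%:E <= 0)%E.
    apply: le_trans gap0; apply: ge0_le_integral_nonmeasurable => //.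
    + by move=> s; rewrite lee_fin gap_ge0.
    + by move=> s; rewrite lee_fin gap_ge0.
    + by move=> s /=; rewrite !in_itv/= andbT; lra.
  rewrite eF lee_fin; apply/negP; rewrite -ltNge subr_gt0.
  have [d d0 Hd] := derive_gt0_right (dF r ltac:(lra) ltac:(lra)) gr.
  pose h := Num.min d 1 / 2.
  have m0 : 0 < Num.min d 1 by rewrite lt_min d0 ltr01.
  have [hd h1] : h < d /\ h < 1 by apply/andP; rewrite -lt_min /h; lra.
  have h0 : 0 < h by rewrite /h; lra.
  have F1 : F (r / 2) <= F r.
    apply: (ge0_derive_le (df := gap u f)); first lra.
      by move=> s *; apply: dF; lra.
    by move=> s *; exact: gap_ge0.
  have F2 : F (r + h) <= F (r + 1).
    apply: (ge0_derive_le (df := gap u f)); first lra.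
      by move=> s *; apply: dF; lra.
    by move=> s *; exact: gap_ge0.
  by have := Hd h h0 hd; lra.
move=> r r0; have u0 (s : R) := nonneg_sol_gt0 k0 Hode Hbc u_ge0 (r := s).
have /eqP : f r ^+ 2 = u r ^+ 2 by exact: sqE.
rewrite eqf_sqr => /orP[/eqP//|/eqP fr].
have fr0 : f r < 0 by rewrite fr oppr_lt0 u0.
have [f1 _] := bcf; have [d d0 Hd] := cvg_right0_lt f1 ltr01.
pose x := Num.min r d / 2; have m0 : 0 < Num.min r d by rewrite lt_min r0.
have [xr xd] : x < r /\ x < d by apply/andP; rewrite -lt_min /x; lra.
have x0 : 0 < x by rewrite /x; lra.
have fx0 : 0 < f x by have := Hd x x0 xd; rewrite ltr_norml => /andP[]; lra.
have cf : {within `[x, r], continuous f}.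
  apply: continuous_in_subspaceT => s; rewrite inE/= in_itv/= => /andP[xs _].
  by apply: (loc_abs_cont_continuous acf); lra.
have [|s] := @IVT R f x r 0 (ltW xr) cf; first by rewrite ge_min le_max (ltW fr0) (ltW fx0) orbT.
rewrite in_itv/= => /andP[xs _] fs.
have s0 : 0 < s by lra.
by have := sqE s s0; have := u0 s s0; rewrite fs; nra.
Qed.

(** Completing the square writes [sol_density] as [W - 2 k (u^2)'] with [W >= 0]. The total
    derivative contributes [2 k]; strictness comes from the term [(1 - u^2)^2 / r^2] of [W] on
    [1, 2]. *)
Lemma nonneg_sol_energy_gt k u v : 0 < k -> ode k u v -> bc u ->
  (forall r : R, 0 < r -> 0 <= u r) ->
  ((2 * k)%:E < \int[mu]_(r in `](0:R)%R, +oo[) (energy_density k u r)%:E)%E.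
Proof.
move=> k0 Hode Hbc u_ge0.
have u0 (s : R) := nonneg_sol_gt0 k0 Hode Hbc u_ge0 (r := s).
have ult (s : R) := nonneg_sol_lt1 k0 Hode Hbc (r := s).
(* A lower bound for [W] on [1, 2]: [u] is decreasing and [r^2 <= 4]. *)
pose del := (1 - u 1 ^+ 2) ^+ 2 / 4.
have u1 := ult 1 ltr01; have u10 := u0 1 ltr01.
have del0 : 0 < del by rewrite divr_gt0// exprn_gt0//; nra.
have [uz uy] := Hbc.
(* With this tolerance on [u^2] each of the two boundary errors is below
   [2 k * del / (8 k) = del / 4]. *)
have k8 : 0 < del / (8 * k) by rewrite divr_gt0// mulr_gt0.
have uz2 : u r * u r @[r --> 0^'+] --> (1 * 1 : R) by exact: cvgM.
have uy2 : u r * u r @[r --> +oo] --> (0 * 0 : R) by exact: cvgM.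
have [d d0 Hd] := cvg_right0_lt uz2 k8; have [K K0 HK] := cvg_pinfty_lt uy2 k8.
pose x := Num.min 1 d / 2; have m0 : 0 < Num.min 1 d by rewrite lt_min d0 ltr01.
have [x1 xd] : x < 1 /\ x < d by apply/andP; rewrite -lt_min /x; lra.
have x0 : 0 < x by rewrite /x; lra.
pose y := Num.max 2 K + 1.
have [y2 yK] : 2 < y /\ K < y by apply/andP; rewrite -gt_max /y; lra.
have xy : x < y by lra.
have [F dF eF] := antiderivative (sol_density_continuous Hode) x0 xy.
apply: (@lt_le_trans _ _ (\int[mu]_(r in `]x, y[) (sol_density k u v r)%:E)%E); last first.
  rewrite (sol_energyE Hode); apply: ge0_le_integral_nonmeasurable => //.
  - by move=> r; rewrite lee_fin sol_density_ge0.
  - by move=> r; rewrite lee_fin sol_density_ge0.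
  - by move=> r /=; rewrite !in_itv/= andbT; lra.
rewrite eF lte_fin.
pose W r := 2 * (v r + k * u r) ^+ 2 + (1 - u r ^+ 2) ^+ 2 / r ^+ 2.
pose L r := F r + 2 * k * (u r * u r).
have dL r : x <= r -> r <= y -> is_derive r 1 L (W r).
  move=> xr ry; have [h1 _] := Hode r (lt_le_trans x0 xr); have h2 := dF r xr ry.
  by rewrite /L; differentiate; rewrite /W /sol_density; ring.
have W0 r : 0 <= W r.
  have h1 := sqr_ge0 (v r + k * u r).
  have h2 : 0 <= (1 - u r ^+ 2) ^+ 2 / r ^+ 2 by rewrite divr_ge0 ?sqr_ge0.
  by rewrite /W; lra.
have L1 : L x <= L 1.
  by apply: (ge0_derive_le (df := W)) => [|r *|r *]; [lra|apply: dL; lra|exact: W0].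
have L2 : L 2 <= L y.
  by apply: (ge0_derive_le (df := W)) => [|r *|r *]; [lra|apply: dL; lra|exact: W0].
have L12 : del <= L 2 - L 1.
  have [c [c1 c2 ->]] : exists c, [/\ 1 < c, c < 2 & L 2 - L 1 = W c * (2 - 1)].
    by apply: MVT_cc => [|r *]; [lra|apply: dL; lra].
  have uc := nonneg_sol_decr k0 Hode Hbc u_ge0 ltr01 c1.
  have uc0 := u0 c ltac:(lra).
  have -> : W c * (2 - 1) = W c by ring.
  apply: (@le_trans _ _ ((1 - u c ^+ 2) ^+ 2 / c ^+ 2)); last first.
    by rewrite /W lerDr mulr_ge0 ?sqr_ge0.
  have h1 : (1 - u 1 ^+ 2) ^+ 2 <= (1 - u c ^+ 2) ^+ 2 by rewrite ler_sqr ?nnegrE; nra.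
  have h2 : (4 : R)^-1 <= (c ^+ 2)^-1 by rewrite lef_pV2 ?posrE ?exprn_gt0//; nra.
  by rewrite /del; apply: ler_pM => //; [exact: sqr_ge0].
have := Hd x x0 xd; have := HK y yK; rewrite !ltr_norml => /andP[_ h1] /andP[h2 _].
have h3 : 2 * k * (u y * u y) < del / 4.
  have -> : del / 4 = 2 * k * (del / (8 * k)) by field; rewrite gt_eqF.
  by rewrite ltr_pM2l ?mulr_gt0//; lra.
have h4 : 2 * k * (1 - del / (8 * k)) < 2 * k * (u x * u x).
  by rewrite ltr_pM2l ?mulr_gt0//; lra.
have h5 : 2 * k * (1 - del / (8 * k)) = 2 * k - del / 4 by field; rewrite gt_eqF.
move: L1 L2 L12 h3 h4; rewrite h5 /L; lra.
Qed.

End Minimality.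

(** * The exponential test function *)

Section TestFunction.
Context {R : realType}.
Local Notation mu := (@lebesgue_measure R).
Implicit Types (k l r : R).

Definition exp_test (l r : R) : R := expR (- (l * r)).

Lemma exp_test_derive l r : is_derive r 1 (exp_test l) (- l * exp_test l r).
Proof. by rewrite /exp_test; differentiate; ring. Qed.

Lemma exp_test_derive1 l r : derive1 (exp_test l) r = - l * exp_test l r.
Proof. by have [_ <-] := exp_test_derive l r; rewrite derive1E. Qed.

Lemma exp_test_continuous l r : {for r, continuous (exp_test l)}.
Proof. exact: is_derive_continuous (exp_test_derive l r). Qed.

Lemma exp_test_loc_abs_cont l : loc_abs_cont_pos (exp_test l).
Proof.
move=> x y x0 xy; apply: (abs_cont_C1 (df := fun r => - l * exp_test l r)) => r xr ry.
  exact: exp_test_derive.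
by have h := @exp_test_continuous l r; cont.
Qed.

Lemma exp_test_bc l : 0 < l -> bc (exp_test l).
Proof.
move=> l0; split; last exact: cvg_expRN.
have : exp_test l 0 = 1 by rewrite /exp_test mulr0 oppr0 expR0.
by move=> <-; apply: cvg_at_right_filter; exact: exp_test_continuous.
Qed.

(** The terms in [E^2] integrate to [l + k^2 / l]. Integration by parts turns [(1 - E^2)^2 / r^2]
    into [4 l (E^2 - E^4) / r], a Frullani integral equal to [4 l ln 2]. *)
Lemma exp_test_energy_le k l : 0 < l ->
  (\int[mu]_(r in `](0:R)%R, +oo[) (energy_density k (exp_test l) r)%:E <=
    (l * (1 + 4 * ln 2) + k ^+ 2 / l)%:E)%E.
Proof.
move=> l0; pose E (r : R) : R := exp_test l r.
have dE (r : R) : is_derive r 1 E (- l * E r) := exp_test_derive l r.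
have cE (r : R) : {for r, continuous E} := @exp_test_continuous l r.
pose D (r : R) := 2 * (- l * E r) ^+ 2 + (1 - E r ^+ 2) ^+ 2 / r ^+ 2 + 2 * k ^+ 2 * E r ^+ 2.
have DE (r : R) : energy_density k (exp_test l) r = D r by rewrite /energy_density exp_test_derive1.
under eq_integral do rewrite DE.
have cD (r : R) : 0 < r -> {for r, continuous D}.
  by move=> r0; have h := cE r; rewrite /D; cont; rewrite gt_eqF// exprn_gt0.
apply: integral_pos_le => //; first by move=> r _; rewrite -DE energy_density_ge0.
(* The boundary term [(1 - E^2)^2 / x] is at most [4 l^2 x], since [1 - E^2 <= 2 l x]. *)
move=> e e0; exists (e / (4 * l ^+ 2)), 0; split; first by rewrite divr_gt0// mulr_gt0// exprn_gt0.
move=> x y x0 xd y0 xy; have [F dF ->] := antiderivative cD x0 xy; rewrite lee_fin.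
pose g (r : R) := E r ^+ 2 / r.
have cg (r : R) : 0 < r -> {for r, continuous g}.
  by move=> r0; have h := cE r; rewrite /g; cont; rewrite gt_eqF.
(* As [E (2 r) = E r ^ 2], the function [E^4 / r] is the derivative of [G (2 r)]; hence [G] is
   needed up to [2 * y]. *)
have [G dG _] := antiderivative cg x0 (y := 2 * y) ltac:(lra).
pose T (r : R) := - (l + k ^+ 2 / l) * E r ^+ 2 - (1 - E r ^+ 2) ^+ 2 / r + 4 * l * (G r - G (2 * r)).
have E2 (r : R) : E (2 * r) = E r ^+ 2.
  by rewrite /E /exp_test -expRM_natl; congr expR; ring.
have dT (r : R) : x <= r -> r <= y -> is_derive r 1 T (D r).
  move=> xr ry; have r0 : 0 < r by lra.
  have h1 := dE r; have h2 := dG r xr ltac:(lra).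
  have h3 : is_derive r 1 (fun r => G (2 * r)) (g (2 * r) * 2).
    apply: (is_derive_compf (g := fun r => 2 * r)); last by apply: dG; lra.
    by differentiate; ring.
  rewrite /T; differentiate; rewrite /D /g E2; field.
  by rewrite !gt_eqF.
have e1 : F y - F x = T y - T x.
  have h (r : R) : x <= r -> r <= y -> is_derive r 1 (fun r => F r - T r) 0.
    move=> xr ry; have h1 := dF r xr ry; have h2 := dT r xr ry; differentiate; exact: subrr.
  have h1 := ge0_derive_le (ltW xy) h (fun _ _ _ => lexx _).
  have h' (r : R) : x <= r -> r <= y -> is_derive r 1 (fun r => T r - F r) 0.
    move=> xr ry; have h2 := dF r xr ry; have h3 := dT r xr ry; differentiate; exact: subrr.
  have h2 := ge0_derive_le (ltW xy) h' (fun _ _ _ => lexx _).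
  lra.
rewrite e1.
have E0 (r : R) : 0 < E r by exact: expR_gt0.
have E1 (r : R) : 0 <= r -> E r <= 1 by move=> r0; rewrite /E /exp_test expR_le1 oppr_le0 mulr_ge0// ltW.
have G2 (r : R) : 0 < r -> x <= r -> r <= y -> G (2 * r) - G r >= 0.
  move=> r0 xr ry; rewrite subr_ge0; apply: (ge0_derive_le (df := g)); first lra.
    by move=> s *; apply: dG; lra.
  by move=> s *; rewrite divr_ge0 ?sqr_ge0//; lra.
(* Compares [g <= 1 / r] on [x, 2 x]. *)
have Gx : G (2 * x) - G x <= ln 2.
  have : ln x - G x <= ln (2 * x) - G (2 * x).
    apply: (@ge0_derive_le _ x (2 * x) (fun r => ln r - G r) (fun r => r^-1 - g r)); first lra.
      move=> s *; have s0 : 0 < s by lra.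
      have h2 : is_derive s 1 G (g s) by apply: dG; lra.
      differentiate; ring.
    move=> s *; have s0 : 0 < s by lra.
    have i0 : 0 < s^-1 by rewrite invr_gt0.
    have := E0 s; have := E1 s (ltW s0) => a1 a2.
    have : E s ^+ 2 <= 1 by nra.
    by rewrite /g; nra.
  by rewrite lnM ?posrE//; lra.
have Ex : (1 - E x ^+ 2) ^+ 2 / x < e.
  have : 1 - E x ^+ 2 <= 2 * l * x.
    have := expR_ge1Dx (- (l * (2 * x))); rewrite -/(exp_test l (2 * x)) -/(E _) E2; lra.
  have : 0 <= 1 - E x ^+ 2 by have := E0 x; have := E1 x (ltW x0); nra.
  move=> a1 a2; rewrite ltr_pdivrMr//.
  apply: (@le_lt_trans _ _ ((2 * l * x) ^+ 2)); first by rewrite ler_sqr ?nnegrE//; lra.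
  have -> : (2 * l * x) ^+ 2 = x * (4 * l ^+ 2) * x by ring.
  by rewrite ltr_pM2r// -ltr_pdivlMr// mulr_gt0// exprn_gt0.
have lk : 0 <= l + k ^+ 2 / l by rewrite addr_ge0 ?divr_ge0 ?sqr_ge0// ltW.
have Ex1 : (l + k ^+ 2 / l) * E x ^+ 2 <= l + k ^+ 2 / l.
  by rewrite -[leRHS]mulr1 ler_wpM2l//; have := E0 x; have := E1 x (ltW x0); nra.
have Ey1 : 0 <= (l + k ^+ 2 / l) * E y ^+ 2 by rewrite mulr_ge0 ?sqr_ge0.
have Ey2 : 0 <= (1 - E y ^+ 2) ^+ 2 / y by rewrite divr_ge0 ?sqr_ge0 ?ltW.
have := G2 y y0 (ltW xy) (lexx _) => Gy.
have h1 : 4 * l * (G (2 * x) - G x) <= 4 * l * ln 2 by rewrite ler_wpM2l//; lra.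
have h2 : 0 <= 4 * l * (G (2 * y) - G y) by rewrite mulr_ge0//; lra.
rewrite /T; lra.
Qed.

(** The rate minimizes [l c^2 + k^2 / l], where [c^2 = 1 + 4 ln 2]. *)
Lemma exp_test_energy_opt k : 0 < k ->
  (\int[mu]_(r in `](0:R)%R, +oo[) (energy_density k (exp_test (k / Num.sqrt (1 + 4 * ln 2))) r)%:E <=
    (2 * k * Num.sqrt (1 + 4 * ln 2))%:E)%E.
Proof.
move=> k0; have c0 : 0 < 1 + 4 * ln 2 :> R by have := ln_ge0 (ltW (ltr1n R 2)); lra.
set c := Num.sqrt _; have cs : 0 < c by rewrite sqrtr_gt0.
have c2 : c ^+ 2 = 1 + 4 * ln 2 by rewrite sqr_sqrtr ?ltW.
apply: le_trans (exp_test_energy_le _ _) _; first by rewrite divr_gt0.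
by rewrite lee_fin -c2 le_eqVlt; apply/orP; left; apply/eqP; field; rewrite !gt_eqF.
Qed.

(** Were the inequality not strict, the exponential would have no more energy than [u] and coincide
    with it by uniqueness; but its derivative tends to [- l], not to 0, at the origin. *)
Lemma nonneg_sol_energy_lt k (u v : R -> R) : 0 < k -> ode k u v -> bc u ->
  (forall r : R, 0 < r -> 0 <= u r) ->
  (\int[mu]_(r in `](0:R)%R, +oo[) (energy_density k u r)%:E < (2 * k * Num.sqrt (1 + 4 * ln 2))%:E)%E.
Proof.
move=> k0 Hode Hbc u_ge0.
have c0 : 0 < 1 + 4 * ln 2 :> R by have := ln_ge0 (ltW (ltr1n R 2)); lra.
have fE := exp_test_energy_opt k0; move: fE; set c := Num.sqrt _; set l := k / c => fE.
have cs : 0 < c by rewrite sqrtr_gt0.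
have l0 : 0 < l by rewrite divr_gt0.
have uE := nonneg_sol_energy_le k0 Hode Hbc u_ge0 (@exp_test_loc_abs_cont l) (exp_test_bc l0) fE.
rewrite ltNge; apply/negP => Eu.
have uy := le_lt_trans uE (ltry _).
have fu := nonneg_sol_unique_minimizer k0 Hode Hbc u_ge0 (@exp_test_loc_abs_cont l) (exp_test_bc l0)
  uy (le_trans fE Eu).
have vE (r : R) : 0 < r -> v r = - l * u r.
  move=> r0; rewrite -(fu r r0) -(ode_derive1 Hode r0) -exp_test_derive1 !derive1E.
  apply: near_eq_derive; near=> s; apply/esym/fu.
  by near: s; exact: lt_nbhsr.
have v0 := sol_derive0 k0 Hode Hbc; have [u1 _] := Hbc.
have [d d0 Hd] := cvg_right0_lt v0 (e := l / 2) ltac:(lra).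
have [d' d0' Hd'] := cvg_right0_lt u1 (e := 1 / 2) ltac:(lra).
pose x := Num.min d d' / 2; have m0 : 0 < Num.min d d' by rewrite lt_min d0.
have [xd xd'] : x < d /\ x < d' by apply/andP; rewrite -lt_min /x; lra.
have x0 : 0 < x by rewrite /x; lra.
have := Hd x x0 xd; have := Hd' x x0 xd'; rewrite vE// !ltr_norml => /andP[a1 a2] /andP[a3 a4].
nra.
Unshelve. all: by end_near. Qed.

End TestFunction.

(** * Green's function and existence of a solution *)

Section Improper.
Context {R : realType}.
Local Notation mu := (@lebesgue_measure R).
Implicit Types (G K : R -> R) (r x y l : R).

Lemma integral_derive G K x y : (forall r, 0 < r -> {for r, continuous G}) ->
  (forall r, 0 < r -> is_derive r 1 K (G r)) -> 0 < x -> x < y ->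
  (\int[mu]_(r in `]x, y[) (G r)%:E = (K y - K x)%:E)%E.
Proof.
move=> cG dK x0 xy; have [H dH ->] := antiderivative cG x0 xy; congr EFin.
have h (r : R) : x <= r -> r <= y -> is_derive r 1 (fun r => H r - K r) 0.
  move=> xr ry; have h1 := dH r xr ry; have h2 := dK r (lt_le_trans x0 xr).
  by differentiate; exact: subrr.
have h' (r : R) : x <= r -> r <= y -> is_derive r 1 (fun r => K r - H r) 0.
  move=> xr ry; have h1 := dH r xr ry; have h2 := dK r (lt_le_trans x0 xr).
  by differentiate; exact: subrr.
have h1 := ge0_derive_le (ltW xy) h (fun _ _ _ => lexx _).
have h2 := ge0_derive_le (ltW xy) h' (fun _ _ _ => lexx _).
lra.
Qed.

Lemma integral_exhaust G K (D : set R) (x_ y_ : nat -> R) (l : R) :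
  (forall r, 0 < r -> {for r, continuous G}) -> (forall r, 0 < r -> 0 <= G r) ->
  (forall r, 0 < r -> is_derive r 1 K (G r)) ->
  (forall n, 0 < x_ n /\ x_ n < y_ n) ->
  (forall n, x_ n.+1 <= x_ n) -> (forall n, y_ n <= y_ n.+1) ->
  D = \bigcup_n `](x_ n), (y_ n)[%classic ->
  K (y_ n) - K (x_ n) @[n --> \oo] --> l ->
  (\int[mu]_(r in D) (G r)%:E = l%:E)%E.
Proof.
move=> cG G0 dK xy ndx ndy -> Kl.
pose F n : set (measurableTypeR R) := `](x_ n), (y_ n)[%classic.
have Fpos n : F n `<=` `](0:R)%R, +oo[.
  by move=> r; rewrite /F/= !in_itv/= andbT => /andP[xr _]; have [x0 _] := xy n; exact: lt_trans xr.
have mG : measurable_fun `](0:R)%R, +oo[ (fun r => (G r)%:E).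
  by apply/measurable_EFinP; exact: (continuous_pos_measurable cG).
have cvgF : (\int[mu]_(r in F i) (G r)%:E)%E @[i --> \oo] -->
    (\int[mu]_(r in \bigcup_i F i) (G r)%:E)%E.
  apply: ge0_nondecreasing_set_cvg_integral => //.
  - apply/nondecreasing_seqP => n; apply/subsetPset => r; rewrite /F/= !in_itv/= => /andP[h1 h2].
    by rewrite (le_lt_trans (ndx n) h1)/= (lt_le_trans h2 (ndy n)).
  - by move=> n; exact: measurable_itv.
  - by move=> n; exact: measurable_funS (Fpos n) mG.
  - by move=> n r /Fpos; rewrite /= in_itv/= andbT lee_fin => /G0.
have FE n : (\int[mu]_(r in F n) (G r)%:E)%E = (K (y_ n) - K (x_ n))%:E.
  by have [x0 xyn] := xy n; exact: integral_derive.
apply: (cvg_unique _ cvgF) => //.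
rewrite (_ : (fun i => _) = EFin \o (fun n => K (y_ n) - K (x_ n))); last by apply/funext => n /=; exact: FE.
by apply/fine_cvgP; split; [exact: nearW|exact: Kl].
Qed.

Lemma integral_right0 G K r : 0 < r ->
  (forall r, 0 < r -> {for r, continuous G}) -> (forall r, 0 < r -> 0 <= G r) ->
  (forall r, 0 < r -> is_derive r 1 K (G r)) -> K s @[s --> 0^'+] --> (0 : R) ->
  (\int[mu]_(s in `]0%R, r[) (G s)%:E = (K r)%:E)%E.
Proof.
move=> r0 cG G0 dK K0.
apply: (integral_exhaust (K := K) (x_ := fun n => r / n.+2%:R) (y_ := fun=> r)) => //.
- move=> n; rewrite divr_gt0//; split => //; rewrite ltr_pdivrMr// ltr_pMr// ltr1n//.
- by move=> n; rewrite ler_pM2l// lef_pV2 ?posrE// ler_nat.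
- apply/seteqP; split => s /=; rewrite in_itv/=.
    move=> /andP[s0 sr]; exists (Num.bound (r / s)) => //=; rewrite in_itv/= sr andbT.
    rewrite ltr_pdivrMr// mulrC -ltr_pdivrMr//.
    have := archi_boundP (divr_ge0 (ltW r0) (ltW s0)); move/lt_le_trans; apply.
    by rewrite ler_nat -addn2 leq_addr.
  by move=> [n _] /=; rewrite in_itv/= => /andP[h ->]; rewrite andbT (lt_trans _ h)// divr_gt0.
- rewrite -[X in _ --> X]subr0; apply: cvgB; first exact: cvg_cst.
  apply/cvgrPdist_lt => e e0; have [d d0 Hd] := cvg_right0_lt K0 e0.
  exists (Num.bound (r / d)) => // n /= hn; rewrite distrC; apply: Hd; first by rewrite divr_gt0.
  rewrite ltr_pdivrMr// mulrC -ltr_pdivrMr//.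
  have := archi_boundP (divr_ge0 (ltW r0) (ltW d0)); move/lt_le_trans; apply.
  by rewrite ler_nat; apply: leq_trans hn _; rewrite -addn2 leq_addr.
Qed.

Lemma integral_pinfty G K r : 0 < r ->
  (forall r, 0 < r -> {for r, continuous G}) -> (forall r, 0 < r -> 0 <= G r) ->
  (forall r, 0 < r -> is_derive r 1 K (G r)) -> K s @[s --> +oo] --> (0 : R) ->
  (\int[mu]_(s in `]r, +oo[) (G s)%:E = (- K r)%:E)%E.
Proof.
move=> r0 cG G0 dK K0.
apply: (integral_exhaust (K := K) (x_ := fun=> r) (y_ := fun n => r + n.+1%:R)) => //.
- by move=> n; split => //; rewrite ltrDl.
- by move=> n; rewrite lerD2l ler_nat.
- apply/seteqP; split => s /=; rewrite in_itv/= ?andbT.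
    move=> rs; exists (Num.bound s) => //=; rewrite in_itv/= rs/=.
    have s0 : 0 <= s by lra.
    have := archi_boundP s0; have : (Num.bound s)%:R <= (Num.bound s).+1%:R :> R by rewrite ler_nat.
    lra.
  by move=> [n _] /=; rewrite in_itv/= => /andP[].
- rewrite -[X in _ --> X]add0r; apply: cvgB; last exact: cvg_cst.
  apply/cvgrPdist_lt => e e0; have [M M0 HM] := cvg_pinfty_lt K0 e0.
  exists (Num.bound M) => // n /= hn; rewrite distrC; apply: HM.
  have := archi_boundP (ltW M0); have : (Num.bound M)%:R <= n.+1%:R :> R by rewrite ler_nat leqW.
  lra.
Qed.

End Improper.

(** * The homogeneous solutions and their growth *)

Section Green.
Context {R : realType}.
Local Notation mu := (@lebesgue_measure R).
Variable k : R.
Hypothesis k0 : 0 < k.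
Implicit Types (r x y : R).

Definition exp_pos (r : R) : R := expR (k * r).
Definition exp_neg (r : R) : R := expR (- (k * r)).

Lemma exp_pos_gt0 r : 0 < exp_pos r. Proof. exact: expR_gt0. Qed.
Lemma exp_neg_gt0 r : 0 < exp_neg r. Proof. exact: expR_gt0. Qed.
Lemma exp_pos_neg r : exp_pos r * exp_neg r = 1. Proof. by rewrite /exp_pos /exp_neg -expRD subrr expR0. Qed.
Lemma exp_pos_derive r : is_derive r 1 exp_pos (k * exp_pos r).
Proof. by rewrite /exp_pos; differentiate; ring. Qed.
Lemma exp_neg_derive r : is_derive r 1 exp_neg (- k * exp_neg r).
Proof. by rewrite /exp_neg; differentiate; ring. Qed.

(* [phi] and [psi] span the kernel of L = - d^2/dr^2 + k^2 + 2/r^2; [phi] is the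
   regular solution at 0 and [psi] the one decaying at infinity. *)
Definition phi r : R := (k * r * (exp_pos r + exp_neg r) - (exp_pos r - exp_neg r)) / (2 * k ^+ 2 * r).
Definition dphi r : R := (exp_pos r - exp_neg r) / 2 - phi r / r.
Definition psi r : R := exp_neg r * (1 + (k * r)^-1).
Definition dpsi r : R := - k * psi r - exp_neg r / (k * r ^+ 2).

Lemma phi_derive r : 0 < r -> is_derive r 1 phi (dphi r).
Proof.
move=> r0; have h1 := exp_pos_derive r; have h2 := exp_neg_derive r.
have h3 : 2 * k ^+ 2 * r != 0 by rewrite gt_eqF// !mulr_gt0// exprn_gt0.
rewrite /phi; differentiate.
by rewrite /dphi /phi; field; rewrite !gt_eqF.
Qed.

Lemma dphi_derive r : 0 < r -> is_derive r 1 dphi ((k ^+ 2 + 2 / r ^+ 2) * phi r).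
Proof.
move=> r0; have h1 := exp_pos_derive r; have h2 := exp_neg_derive r; have h3 := phi_derive r0.
by rewrite /dphi; differentiate; rewrite /dphi /phi; field; rewrite !gt_eqF.
Qed.

Lemma psi_derive r : 0 < r -> is_derive r 1 psi (dpsi r).
Proof.
move=> r0; have h2 := exp_neg_derive r.
have h3 : k * r != 0 by rewrite gt_eqF// mulr_gt0.
rewrite /psi; differentiate; rewrite /dpsi /psi; field; rewrite !gt_eqF//.
Qed.

Lemma dpsi_derive r : 0 < r -> is_derive r 1 dpsi ((k ^+ 2 + 2 / r ^+ 2) * psi r).
Proof.
move=> r0; have h2 := exp_neg_derive r; have h3 := psi_derive r0.
have h4 : k * r ^+ 2 != 0 by rewrite gt_eqF// mulr_gt0// exprn_gt0.
by rewrite /dpsi; differentiate; rewrite /dpsi /psi; field; rewrite !gt_eqF.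
Qed.

(** This normalization makes [phi (min r s) * psi (max r s)] the Green kernel with no further
    factor. *)
Lemma wronskian r : 0 < r -> dphi r * psi r - phi r * dpsi r = 1.
Proof.
move=> r0; rewrite -(exp_pos_neg r) /dphi /dpsi /phi /psi.
by field; rewrite !gt_eqF.
Qed.

Lemma sinh_bound r : 0 <= r -> 0 <= exp_pos r - exp_neg r /\ exp_pos r - exp_neg r <= 2 * k * r * exp_pos r.
Proof.
move=> r0; have kr : 0 <= k * r by rewrite mulr_ge0// ltW.
have h1 : 1 <= exp_pos r by rewrite /exp_pos -expR0 ler_expR.
have h2 : exp_neg r <= 1 by rewrite /exp_neg expR_le1 oppr_le0.
split; first lra.
have := expR_ge1Dx (- (2 * k * r)).
have -> : expR (- (2 * k * r)) = exp_neg r * exp_neg r by rewrite /exp_neg -expRD; congr expR; ring.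
move=> h3; have -> : exp_pos r - exp_neg r = exp_pos r * (1 - exp_neg r * exp_neg r).
  by rewrite mulrBr mulr1 mulrA exp_pos_neg mul1r.
by rewrite mulrC ler_wpM2r; [lra|exact: ltW (exp_pos_gt0 r)|lra].
Qed.

(** The numerator of [phi] vanishes at 0 and has derivative
    [k^2 s (exp_pos s - exp_neg s) = O(s^2)]. Hence [phi = O(r^2)], which compensates the
    singularity [1 / r^2] of the source. *)
Lemma phi_num_bound r : 0 <= r ->
  0 <= k * r * (exp_pos r + exp_neg r) - (exp_pos r - exp_neg r) /\
  k * r * (exp_pos r + exp_neg r) - (exp_pos r - exp_neg r) <= 2 * k ^+ 3 * exp_pos r * r ^+ 3.
Proof.
rewrite le_eqVlt => /predU1P[<-|r0].
  by rewrite !mulr0 !mul0r /exp_pos /exp_neg !mulr0 oppr0 !subrr expr0n/= mulr0.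
pose h s := k * s * (exp_pos s + exp_neg s) - (exp_pos s - exp_neg s).
have dh s : 0 <= s -> s <= r -> is_derive s 1 h (k ^+ 2 * s * (exp_pos s - exp_neg s)).
  by move=> _ _; have h1 := exp_pos_derive s; have h2 := exp_neg_derive s; rewrite /h; differentiate; ring.
have [c [c0 cr e]] := MVT_cc r0 dh.
have h0 : h 0 = 0 by rewrite /h mulr0 mul0r /exp_pos /exp_neg mulr0 oppr0 subrr subrr.
move: e; rewrite h0 !subr0 -/(h r) => e; rewrite e.
have [s1 s2] := sinh_bound (ltW c0).
have k2c : 0 <= k ^+ 2 * c by rewrite mulr_ge0 ?sqr_ge0 ?ltW.
split; first by rewrite mulr_ge0// ?(ltW r0)// mulr_ge0.
have EE : exp_pos c <= exp_pos r by rewrite /exp_pos ler_expR ler_pM2l// ltW.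
have s3 : exp_pos c - exp_neg c <= 2 * k * r * exp_pos r.
  apply: le_trans s2 _; rewrite -!mulrA !ler_pM2l//.
  by apply: ler_pM; rewrite ?(ltW c0) ?(ltW cr)// ltW// exp_pos_gt0.
have -> : 2 * k ^+ 3 * exp_pos r * r ^+ 3 = (k ^+ 2 * r) * (2 * k * r * exp_pos r) * r by ring.
rewrite ler_wpM2r ?(ltW r0)//; apply: ler_pM => //.
by rewrite ler_pM2l ?exprn_gt0// ltW.
Qed.

Lemma phi_ge0 r : 0 < r -> 0 <= phi r.
Proof.
move=> r0; rewrite /phi divr_ge0//; first by have [] := phi_num_bound (ltW r0).
by rewrite !mulr_ge0 ?sqr_ge0// ltW.
Qed.

Lemma phi_le r : 0 < r -> phi r <= k * exp_pos r * r ^+ 2.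
Proof.
move=> r0; have [_ h] := phi_num_bound (ltW r0).
rewrite /phi ler_pdivrMr ?mulr_gt0 ?exprn_gt0//; apply: le_trans h _.
by rewrite le_eqVlt; apply/orP; left; apply/eqP; ring.
Qed.

Lemma dphi_le r : 0 < r -> `|dphi r| <= 2 * k * exp_pos r * r.
Proof.
move=> r0; have [s1 s2] := sinh_bound (ltW r0); have h1 := phi_le r0; have h2 := phi_ge0 r0.
have h3 : phi r / r <= k * exp_pos r * r.
  by rewrite ler_pdivrMr//; apply: le_trans h1 _; rewrite expr2 mulrA.
have h4 : 0 <= phi r / r by rewrite divr_ge0// ltW.
rewrite /dphi ler_norml; apply/andP; split; lra.
Qed.

Lemma psi_ge0 r : 0 < r -> 0 <= psi r.
Proof.
move=> r0; rewrite /psi mulr_ge0 ?addr_ge0 ?invr_ge0//; apply/ltW => //; first exact: exp_neg_gt0.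
by rewrite mulr_gt0.
Qed.

Lemma psi_le r : 1 <= r -> psi r <= (1 + k^-1) * exp_neg r /\ `|dpsi r| <= (k + 1 + k^-1) * exp_neg r.
Proof.
move=> r1; have r0 : 0 < r by lra.
have E0 := exp_neg_gt0 r; have i0 : 0 < k^-1 by rewrite invr_gt0.
have h1 : (k * r)^-1 <= k^-1 by rewrite lef_pV2 ?posrE ?mulr_gt0// ler_peMr// ltW.
have h2 : (k * r ^+ 2)^-1 <= k^-1.
  by rewrite lef_pV2 ?posrE ?mulr_gt0 ?exprn_gt0// ler_peMr ?(ltW k0)//; nra.
have p0 := psi_ge0 r0.
have p1 : psi r <= (1 + k^-1) * exp_neg r by rewrite /psi mulrC ler_wpM2r ?(ltW E0)//; lra.
split => //.
have h3 : 0 <= exp_neg r / (k * r ^+ 2) by rewrite divr_ge0 ?(ltW E0)// ltW// mulr_gt0// exprn_gt0.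
have h4 : exp_neg r / (k * r ^+ 2) <= k^-1 * exp_neg r by rewrite mulrC ler_wpM2r// ltW.
have h5 : k * psi r <= k * ((1 + k^-1) * exp_neg r) by rewrite ler_wpM2l// ltW.
have h6 : k * ((1 + k^-1) * exp_neg r) = (k + 1) * exp_neg r by field; rewrite gt_eqF.
have h7 : 0 <= k * psi r by rewrite mulr_ge0// ltW.
rewrite /dpsi ler_norml; apply/andP; split; lra.
Qed.

End Green.

(** * Green's identities and the integral operator *)

Section Operator.
Context {R : realType}.
Local Notation mu := (@lebesgue_measure R).
Variable k : R.
Hypothesis k0 : 0 < k.
Implicit Types (r s t x y : R) (g h e : R -> R).
Local Notation phi := (phi k).
Local Notation dphi := (dphi k).
Local Notation psi := (psi k).
Local Notation dpsi := (dpsi k).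

Lemma phi_continuous r : 0 < r -> {for r, continuous phi}.
Proof. by move=> r0; exact: is_derive_continuous (phi_derive k0 r0). Qed.
Lemma psi_continuous r : 0 < r -> {for r, continuous psi}.
Proof. by move=> r0; exact: is_derive_continuous (psi_derive k0 r0). Qed.

Section GreenIdentity.
Variables (e e1 e2 : R -> R) (C : R).
Hypotheses (de : forall r : R, 0 < r -> is_derive r 1 e (e1 r))
  (de1 : forall r : R, 0 < r -> is_derive r 1 e1 (e2 r))
  (ce2 : forall r : R, 0 < r -> {for r, continuous e2})
  (eC : forall r : R, 0 < r -> `|e r| <= C /\ `|e1 r| <= C).
Definition Lop r := - e2 r + (k ^+ 2 + 2 / r ^+ 2) * e r.
Hypothesis Le_ge0 : forall r : R, 0 < r -> 0 <= Lop r.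

Let C_ge0 : 0 <= C.
Proof. by have [h _] := eC ltr01; exact: le_trans h. Qed.

Lemma Lop_continuous r : 0 < r -> {for r, continuous Lop}.
Proof.
move=> r0; have h1 := ce2 r0; have h2 := is_derive_continuous (de r0).
by rewrite /Lop; cont; rewrite gt_eqF// exprn_gt0.
Qed.

(** Lagrange's identity [(phi' e - phi e')' = phi * L e]; the boundary term at 0 vanishes because
    [phi] and [dphi] are [O(s)] while [e] and [e1] are bounded. *)
Lemma green_right0 r : 0 < r ->
  (\int[mu]_(s in `]0%R, r[) (phi s * Lop s)%:E = (dphi r * e r - phi r * e1 r)%:E)%E.
Proof.
move=> r0; pose K s := dphi s * e s - phi s * e1 s.
have dK (s : R) : 0 < s -> is_derive s 1 K (phi s * Lop s).
  move=> s0; have h1 := de s0; have h2 := de1 s0; have h3 := phi_derive k0 s0.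
  have h4 := dphi_derive k0 s0; rewrite /K; differentiate; rewrite /Lop; ring.
have cG (s : R) : 0 < s -> {for s, continuous (fun s => phi s * Lop s)}.
  by move=> s0; apply: contM; [exact: phi_continuous|exact: Lop_continuous].
have G0 (s : R) : 0 < s -> 0 <= phi s * Lop s.
  by move=> s0; rewrite mulr_ge0 ?Le_ge0// phi_ge0.
apply: (integral_right0 r0 cG G0 dK).
have k00 := k0; have C0 := C_ge0.
apply: cvg_right0_ex => d d0; pose B := 3 * k * exp_pos k 1 * C + 1.
have E1 := exp_pos_gt0 k 1.
have B0 : 0 < B.
  have : 0 <= k * exp_pos k 1 * C by rewrite !mulr_ge0// ltW.
  by rewrite /B; lra.
exists (Num.min 1 (d / B)); first by rewrite lt_min ltr01 divr_gt0.
move=> s s0; rewrite lt_min => /andP[s1]; rewrite ltr_pdivlMr// => sB; rewrite subr0.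
have [h1 h2] := eC s0; have h3 := phi_le k0 s0; have h4 := phi_ge0 k0 s0; have h5 := dphi_le k0 s0.
have EE : exp_pos k s <= exp_pos k 1 by rewrite /exp_pos ler_expR ler_pM2l// ltW.
have kE : k * exp_pos k s * s <= k * exp_pos k 1 * s by rewrite ler_wpM2r ?(ltW s0)// ler_pM2l.
have h6 : phi s <= k * exp_pos k 1 * s.
  apply: le_trans h3 (le_trans _ kE).
  by rewrite ler_pM2l; [rewrite expr2 ger_pMr// ltW|rewrite mulr_gt0// exp_pos_gt0].
have h7 : `|dphi s| <= 2 * k * exp_pos k 1 * s by apply: le_trans h5 _; lra.
apply: le_lt_trans (ler_normB (dphi s * e s) (phi s * e1 s)) _.
rewrite (normrM (dphi s)) (normrM (phi s)) (ger0_norm h4).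
have h8 : `|dphi s| * `|e s| <= 2 * k * exp_pos k 1 * s * C by apply: ler_pM.
have h9 : phi s * `|e1 s| <= k * exp_pos k 1 * s * C by apply: ler_pM.
have : B * s = 3 * k * exp_pos k 1 * s * C + s by rewrite /B; ring.
lra.
Qed.

(** The same identity for [psi], whose exponential decay removes the boundary term at infinity. *)
Lemma green_pinfty r : 0 < r ->
  (\int[mu]_(s in `]r, +oo[) (psi s * Lop s)%:E = (psi r * e1 r - dpsi r * e r)%:E)%E.
Proof.
move=> r0; have -> : psi r * e1 r - dpsi r * e r = - (dpsi r * e r - psi r * e1 r) by ring.
pose K s := dpsi s * e s - psi s * e1 s.
have dK (s : R) : 0 < s -> is_derive s 1 K (psi s * Lop s).
  move=> s0; have h1 := de s0; have h2 := de1 s0; have h3 := psi_derive k0 s0.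
  have h4 := dpsi_derive k0 s0; rewrite /K; differentiate; rewrite /Lop; ring.
have cG (s : R) : 0 < s -> {for s, continuous (fun s => psi s * Lop s)}.
  by move=> s0; apply: contM; [exact: psi_continuous|exact: Lop_continuous].
have G0 (s : R) : 0 < s -> 0 <= psi s * Lop s.
  by move=> s0; rewrite mulr_ge0 ?Le_ge0// psi_ge0.
apply: (integral_pinfty r0 cG G0 dK).
have k00 := k0; have C0 := C_ge0.
apply: cvg_pinfty_ex => d d0; pose B := ((k + 1 + k^-1) + (1 + k^-1)) * C + 1.
have i0 : 0 < k^-1 by rewrite invr_gt0.
have B0 : 0 < B.
  by rewrite /B ltr_wpDl// mulr_ge0//; lra.
have [M M0 HM] := cvg_pinfty_lt (cvg_expRN k0) (divr_gt0 d0 B0).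
exists (Num.max 1 M) => s; rewrite gt_max => /andP[s1 sM]; rewrite subr0.
have s0 : 0 < s by lra.
have := HM s sM; rewrite subr0 -/(exp_neg k s) ger0_norm ?(ltW (exp_neg_gt0 _ _))// ltr_pdivlMr// => sB.
have [h1 h2] := eC s0; have [h3 h5] := psi_le k0 (ltW s1); have h4 := psi_ge0 k0 s0.
apply: le_lt_trans (ler_normB (dpsi s * e s) (psi s * e1 s)) _.
rewrite (normrM (dpsi s)) (normrM (psi s)) (ger0_norm h4).
have h8 : `|dpsi s| * `|e s| <= (k + 1 + k^-1) * exp_neg k s * C by apply: ler_pM.
have h9 : psi s * `|e1 s| <= (1 + k^-1) * exp_neg k s * C by apply: ler_pM.
have E0 := exp_neg_gt0 k s.
have : exp_neg k s * B = (k + 1 + k^-1) * exp_neg k s * C + (1 + k^-1) * exp_neg k s * C + exp_neg k s by rewrite /B; ring.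
lra.
Qed.

End GreenIdentity.

Definition unit_bounded g := measurable_fun `](0:R)%R, +oo[ g /\
  forall r : R, 0 < r -> 0 <= g r <= 1.

(* The equation u'' = k^2 u + (u^2 - 1) u / r^2 reads L u = src u, and [src] is
   increasing in u on [0, 1]. *)
Definition src g r : R := (3 * g r - g r ^+ 3) / r ^+ 2.

Lemma src_ge0 g r : unit_bounded g -> 0 < r -> 0 <= src g r.
Proof.
move=> [_ ag] r0; have /andP[g0 g1] := ag r r0.
rewrite /src divr_ge0 ?sqr_ge0//; have : g r ^+ 2 <= 1 by nra.
rewrite exprS; nra.
Qed.

Lemma src_le g h r : unit_bounded g -> unit_bounded h -> g r <= h r -> 0 < r -> src g r <= src h r.
Proof.
move=> [_ ag] [_ ah] gh r0; have /andP[g0 g1] := ag r r0; have /andP[h0 h1] := ah r r0.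
rewrite /src ler_wpM2r ?invr_ge0 ?sqr_ge0//.
rewrite -subr_ge0 (_ : _ - _ = (h r - g r) * (3 - (h r ^+ 2 + h r * g r + g r ^+ 2))); last by ring.
rewrite mulr_ge0 ?subr_ge0//; nra.
Qed.

Lemma src_le2 g r : unit_bounded g -> 0 < r -> src g r <= 2 / r ^+ 2.
Proof.
move=> [_ ag] r0; have /andP[g0 g1] := ag r r0.
rewrite /src ler_wpM2r ?invr_ge0 ?sqr_ge0//.
rewrite -subr_ge0 (_ : _ - _ = (1 - g r) * (1 - g r) * (2 + g r)); last by ring.
by rewrite mulr_ge0 ?mulr_ge0 ?subr_ge0//; lra.
Qed.

Lemma measurable_src g (w : R -> R) : unit_bounded g -> (forall r : R, 0 < r -> {for r, continuous w}) ->
  measurable_fun `](0:R)%R, +oo[ (fun r => (w r * src g r)%:E).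
Proof.
move=> [mg _] cw; apply/measurable_EFinP.
have mw := continuous_pos_measurable cw.
have mi : measurable_fun `](0:R)%R, +oo[ (fun r : R => (r ^+ 2)^-1).
  by apply: continuous_pos_measurable => r r0; cont; rewrite gt_eqF// exprn_gt0.
apply: measurable_funM => //; apply: measurable_funM => //.
apply: measurable_funB; first by apply: measurable_funM => //; exact: measurable_cst.
exact: measurable_funX.
Qed.

Definition left_int g r := (\int[mu]_(s in `]0%R, r[) (phi s * src g s)%:E)%E.
Definition right_int g r := (\int[mu]_(s in `]r, +oo[) (psi s * src g s)%:E)%E.
Definition green_op g r : R := psi r * fine (left_int g r) + phi r * fine (right_int g r).

Lemma sub_pos_0 r : `]0%R, r[ `<=` `](0:R)%R, +oo[.
Proof. by move=> s /=; rewrite !in_itv/= andbT => /andP[]. Qed.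
Lemma sub_pos_y r : 0 < r -> `]r, +oo[ `<=` `](0:R)%R, +oo[.
Proof. by move=> r0 s /=; rewrite !in_itv/= !andbT; exact: lt_trans. Qed.

Lemma left_int_ge0 g r : unit_bounded g -> (0 <= left_int g r)%E.
Proof.
move=> ag; apply: integral_ge0 => s /=; rewrite in_itv/= => /andP[s0 _].
by rewrite lee_fin mulr_ge0 ?src_ge0// phi_ge0.
Qed.
Lemma right_int_ge0 g r : unit_bounded g -> 0 < r -> (0 <= right_int g r)%E.
Proof.
move=> ag r0; apply: integral_ge0 => s /=; rewrite in_itv/= andbT => rs.
have s0 := lt_trans r0 rs.
by rewrite lee_fin mulr_ge0 ?src_ge0// psi_ge0.
Qed.

Lemma left_int_le (D : set R) g e : unit_bounded g -> D `<=` `](0:R)%R, +oo[ -> measurable (D : set (measurableTypeR R)) ->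
  (forall r : R, 0 < r -> {for r, continuous e}) -> (forall r : R, 0 < r -> src g r <= e r) ->
  (\int[mu]_(s in D) (phi s * src g s)%:E <= \int[mu]_(s in D) (phi s * e s)%:E)%E /\
  (\int[mu]_(s in D) (psi s * src g s)%:E <= \int[mu]_(s in D) (psi s * e s)%:E)%E.
Proof.
move=> ag Dpos mD ce ge.
have D0 s : D s -> 0 < s by move=> /Dpos; rewrite /= in_itv/= andbT.
have mpos (w : R -> R) : (forall r : R, 0 < r -> {for r, continuous w}) ->
    measurable_fun D (fun s => (w s)%:E).
  move=> cw; have mw : measurable_fun `](0:R)%R, +oo[ (EFin \o w).
    by apply/measurable_EFinP; exact: (continuous_pos_measurable cw).
  by apply: (measurable_funS _ Dpos mw); exact: measurable_itv.
split; apply: ge0_le_integral => //.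
- by move=> s /D0 s0; rewrite lee_fin mulr_ge0 ?src_ge0// phi_ge0.
- by apply: (measurable_funS _ Dpos (measurable_src ag phi_continuous)); exact: measurable_itv.
- by apply: mpos => s s0; apply: contM; [exact: phi_continuous|exact: ce].
- by move=> s /D0 s0; rewrite lee_fin ler_wpM2l ?ge// phi_ge0.
- by move=> s /D0 s0; rewrite lee_fin mulr_ge0 ?src_ge0// psi_ge0.
- by apply: (measurable_funS _ Dpos (measurable_src ag psi_continuous)); exact: measurable_itv.
- by apply: mpos => s s0; apply: contM; [exact: psi_continuous|exact: ce].
- by move=> s /D0 s0; rewrite lee_fin ler_wpM2l ?ge// psi_ge0.
Qed.

End Operator.

Section Operator2.
Context {R : realType}.
Local Notation mu := (@lebesgue_measure R).
Variable k : R.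
Hypothesis k0 : 0 < k.
Implicit Types (r s t x y : R) (g h e : R -> R).
Local Notation phi := (phi k).
Local Notation dphi := (dphi k).
Local Notation psi := (psi k).
Local Notation dpsi := (dpsi k).
Local Notation left_int := (left_int k).
Local Notation right_int := (right_int k).
Local Notation green_op := (green_op k).

(** The constant 1 satisfies [L 1 >= 2 / r^2 >= src g] for all [g] at once. Its Green integrals,
    [dphi] and [- dpsi], majorize those of [src g]: this gives finiteness, [green_op g <= 1], and
    continuity. *)
Lemma one_Lop (r : R) : Lop k (fun=> 1) (fun=> 0) r = k ^+ 2 + 2 / r ^+ 2.
Proof. by rewrite /Lop; ring. Qed.

Lemma one_Lop_ge0 (r : R) : 0 < r -> 0 <= Lop k (fun=> 1) (fun=> 0) r.
Proof. by move=> r0; rewrite one_Lop addr_ge0 ?divr_ge0 ?sqr_ge0. Qed.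

Lemma one_bounded (r : R) : 0 < r -> `|1 : R| <= 1 /\ `|0 : R| <= 1.
Proof. by rewrite normr1 normr0. Qed.

Lemma one_green_right0 (r : R) : 0 < r ->
  (\int[mu]_(s in `]0%R, r[) (phi s * Lop k (fun=> 1) (fun=> 0) s)%:E = (dphi r)%:E)%E.
Proof.
move=> r0; rewrite (@green_right0 R k k0 (fun=> 1) (fun=> 0) (fun=> 0) 1) //.
- by rewrite mulr1 mulr0 subr0.
- by move=> s _; exact: contC.
- exact: one_bounded.
- exact: one_Lop_ge0.
Qed.

Lemma one_green_pinfty (r : R) : 0 < r ->
  (\int[mu]_(s in `]r, +oo[) (psi s * Lop k (fun=> 1) (fun=> 0) s)%:E = (- dpsi r)%:E)%E.
Proof.
move=> r0; rewrite (@green_pinfty R k k0 (fun=> 1) (fun=> 0) (fun=> 0) 1) //.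
- by rewrite mulr1 mulr0 sub0r.
- by move=> s _; exact: contC.
- exact: one_bounded.
- exact: one_Lop_ge0.
Qed.

Lemma one_Lop_cont (r : R) : 0 < r -> {for r, continuous (Lop k (fun=> 1) (fun=> 0))}.
Proof.
move=> r0; have -> : Lop k (fun=> 1) (fun=> 0) = (fun r : R => k ^+ 2 + 2 / r ^+ 2).
  by apply/funext => s; exact: one_Lop.
by cont; rewrite gt_eqF// exprn_gt0.
Qed.

Lemma src_le_one g (r : R) : unit_bounded g -> 0 < r -> src g r <= Lop k (fun=> 1) (fun=> 0) r.
Proof. by move=> ag r0; rewrite one_Lop (le_trans (src_le2 ag r0))// lerDr sqr_ge0. Qed.

Lemma left_int_fin g (r : R) : unit_bounded g -> 0 < r -> left_int g r \is a fin_num.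
Proof.
move=> ag r0; rewrite ge0_fin_numE ?left_int_ge0//; apply: le_lt_trans (ltry (dphi r)).
rewrite -one_green_right0//.
have [h _] := left_int_le k0 ag (@sub_pos_0 _ r) (measurable_itv _) one_Lop_cont (fun r => src_le_one ag).
exact: h.
Qed.

Lemma right_int_fin g (r : R) : unit_bounded g -> 0 < r -> right_int g r \is a fin_num.
Proof.
move=> ag r0; rewrite ge0_fin_numE ?right_int_ge0//; apply: le_lt_trans (ltry (- dpsi r)).
rewrite -one_green_pinfty//.
have [_ h] := left_int_le k0 ag (sub_pos_y r0) (measurable_itv _) one_Lop_cont (fun r => src_le_one ag).
exact: h.
Qed.

Section Comparison.
Variables (e e1 e2 : R -> R) (C : R).
Hypotheses (de : forall r : R, 0 < r -> is_derive r 1 e (e1 r))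
  (de1 : forall r : R, 0 < r -> is_derive r 1 e1 (e2 r))
  (ce2 : forall r : R, 0 < r -> {for r, continuous e2})
  (eC : forall r : R, 0 < r -> `|e r| <= C /\ `|e1 r| <= C).

Let LopE (r : R) : 0 < r ->
  psi r * (dphi r * e r - phi r * e1 r) + phi r * (psi r * e1 r - dpsi r * e r) = e r.
Proof. by move=> r0; rewrite -[RHS]mul1r -(wronskian k0 r0); ring. Qed.

(** By [LopE] and Green's identities, [e] is the Green operator applied to [L e]; the kernel is
    nonnegative and [L e >= 2 / r^2 >= src g]. *)
Lemma green_op_le g (r : R) : unit_bounded g -> (forall r : R, 0 < r -> 2 / r ^+ 2 <= Lop k e e2 r) ->
  0 < r -> green_op g r <= e r.
Proof.
move=> ag eL r0.
have L0 (s : R) : 0 < s -> 0 <= Lop k e e2 s.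
  by move=> s0; apply: le_trans (eL s s0); rewrite divr_ge0 ?sqr_ge0.
have sL (s : R) : 0 < s -> src g s <= Lop k e e2 s.
  by move=> s0; apply: le_trans (src_le2 ag s0) (eL s s0).
have cL (s : R) (s0 : 0 < s) : {for s, continuous (Lop k e e2)} := @Lop_continuous R k e e1 e2 de ce2 s s0.
have [h1 _] := left_int_le k0 ag (@sub_pos_0 _ r) (measurable_itv _) cL sL.
have [_ h2] := left_int_le k0 ag (sub_pos_y r0) (measurable_itv _) cL sL.
move: h1 h2; rewrite (green_right0 k0 de de1 ce2 eC L0 r0) (green_pinfty k0 de de1 ce2 eC L0 r0).
rewrite -/(left_int g r) -/(right_int g r) -(fineK (left_int_fin ag r0)) -(fineK (right_int_fin ag r0)) !lee_fin.
move=> h1 h2; rewrite /green_op -[leRHS](LopE r0); apply: lerD.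
  by rewrite ler_wpM2l// psi_ge0.
by rewrite ler_wpM2l// phi_ge0.
Qed.

Lemma green_op_ge (r : R) : unit_bounded e -> (forall r : R, 0 < r -> 0 <= Lop k e e2 r <= src e r) ->
  0 < r -> e r <= green_op e r.
Proof.
move=> ae eL r0.
have L0 (s : R) : 0 < s -> 0 <= Lop k e e2 s by move=> /eL/andP[].
have Ls (s : R) : 0 < s -> Lop k e e2 s <= src e s by move=> /eL/andP[].
have h1 : ((dphi r * e r - phi r * e1 r)%:E <= left_int e r)%E.
  rewrite -(green_right0 k0 de de1 ce2 eC L0 r0).
  apply: ge0_le_integral_nonmeasurable_in => //.
  - by move=> s /=; rewrite in_itv/= => /andP[s0 _]; rewrite lee_fin mulr_ge0 ?L0// phi_ge0.
  - by move=> s /=; rewrite in_itv/= => /andP[s0 _]; rewrite lee_fin ler_wpM2l ?Ls// phi_ge0.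
have h2 : ((psi r * e1 r - dpsi r * e r)%:E <= right_int e r)%E.
  rewrite -(green_pinfty k0 de de1 ce2 eC L0 r0).
  apply: ge0_le_integral_nonmeasurable_in => //.
  - move=> s /=; rewrite in_itv/= andbT => rs; have s0 := lt_trans r0 rs.
    by rewrite lee_fin mulr_ge0 ?L0// psi_ge0.
  - move=> s /=; rewrite in_itv/= andbT => rs; have s0 := lt_trans r0 rs.
    by rewrite lee_fin ler_wpM2l ?Ls// psi_ge0.
move: h1 h2; rewrite -(fineK (left_int_fin ae r0)) -(fineK (right_int_fin ae r0)) !lee_fin.
move=> h1 h2; rewrite /green_op -[leLHS](LopE r0); apply: lerD.
  by rewrite ler_wpM2l// psi_ge0.
by rewrite ler_wpM2l// phi_ge0.
Qed.

End Comparison.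

Lemma left_int_mono g h (r : R) : unit_bounded g -> unit_bounded h -> (forall r : R, 0 < r -> g r <= h r) ->
  (left_int g r <= left_int h r)%E.
Proof.
move=> ag ah gh; apply: ge0_le_integral_nonmeasurable_in => // s /=; rewrite in_itv/= => /andP[s0 _].
  by rewrite lee_fin mulr_ge0 ?src_ge0// phi_ge0.
by rewrite lee_fin ler_wpM2l ?phi_ge0// src_le// gh.
Qed.

Lemma right_int_mono g h (r : R) : unit_bounded g -> unit_bounded h -> (forall r : R, 0 < r -> g r <= h r) -> 0 < r ->
  (right_int g r <= right_int h r)%E.
Proof.
move=> ag ah gh r0; apply: ge0_le_integral_nonmeasurable_in => // s /=; rewrite in_itv/= andbT => rs.
  by rewrite lee_fin mulr_ge0 ?src_ge0 ?psi_ge0//; exact: lt_trans rs.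
have s0 := lt_trans r0 rs.
by rewrite lee_fin ler_wpM2l ?psi_ge0// src_le// gh.
Qed.

Lemma green_op_mono g h (r : R) : unit_bounded g -> unit_bounded h -> (forall r : R, 0 < r -> g r <= h r) -> 0 < r ->
  green_op g r <= green_op h r.
Proof.
move=> ag ah gh r0; rewrite /green_op; apply: lerD.
  by rewrite ler_wpM2l ?psi_ge0// fine_le ?left_int_fin// left_int_mono.
by rewrite ler_wpM2l ?phi_ge0// fine_le ?right_int_fin// right_int_mono.
Qed.

Lemma green_op_ge0 g (r : R) : unit_bounded g -> 0 < r -> 0 <= green_op g r.
Proof.
move=> ag r0; apply: addr_ge0; apply: mulr_ge0.
- exact: psi_ge0.
- by apply: fine_ge0; exact: left_int_ge0.
- exact: phi_ge0.
- by apply: fine_ge0; exact: right_int_ge0.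
Qed.

Lemma green_op_le1 g (r : R) : unit_bounded g -> 0 < r -> green_op g r <= 1.
Proof.
move=> ag r0; apply: (@green_op_le (fun=> 1) (fun=> 0) (fun=> 0) 1) => //.
- by move=> s _; exact: contC.
- exact: one_bounded.
- by move=> s s0; rewrite one_Lop lerDr sqr_ge0.
Qed.

Lemma left_int_split g (s t : R) : unit_bounded g -> 0 < s -> s < t ->
  (left_int g t = left_int g s + \int[mu]_(r in `]s, t[) (phi r * src g r)%:E)%E.
Proof.
move=> ag s0 st; rewrite /left_int.
have mg := measurable_src ag (@phi_continuous _ k k0).
have E : `]0%R, t[%classic = `]0%R, s] `|` `]s, t[ :> set R.
  apply/seteqP; split => r /=; rewrite !in_itv/=.
    by move=> /andP[-> ->]; rewrite !andbT/=; case: (leP r s) => _; [left|right].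
  by move=> [/andP[-> rs]|/andP[sr ->]] /=; [apply: le_lt_trans st|rewrite andbT; apply: lt_trans sr].
rewrite E ge0_integral_setU//=.
- congr (_ + _)%E; have := @integral_itv_bndoo _ 0 s (fun r => (phi r * src g r)%:E) false false.
  apply; apply: measurable_funS mg; first exact: measurable_itv.
  exact: sub_pos_0.
- rewrite -E; apply: measurable_funS mg; first exact: measurable_itv.
  exact: sub_pos_0.
- move=> r; rewrite -[_ \/ _]/((`]0%R, s] `|` `]s, t[) r) -E /= in_itv/= => /andP[r0 _].
  by rewrite lee_fin mulr_ge0 ?src_ge0// phi_ge0.
- apply/disj_setPS => r /= []; rewrite !in_itv/= => /andP[_ rs] /andP[sr _].
  by have := le_lt_trans rs sr; rewrite ltxx.
Qed.

Lemma right_int_split g (s t : R) : unit_bounded g -> 0 < s -> s < t ->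
  (right_int g s = \int[mu]_(r in `]s, t[) (psi r * src g r)%:E + right_int g t)%E.
Proof.
move=> ag s0 st; rewrite /right_int.
have mg := measurable_src ag (@psi_continuous _ k k0).
have E : `]s, +oo[%classic = `]s, t] `|` `]t, +oo[ :> set R.
  apply/seteqP; split => r /=; rewrite !in_itv/= ?andbT.
    by move=> ->; rewrite /=; case: (leP r t) => _; [left|right].
  by move=> [/andP[-> _]//|tr]; exact: lt_trans tr.
have sub : `]s, t[ `<=` `](0:R)%R, +oo[.
  by move=> r /=; rewrite !in_itv/= andbT => /andP[sr _]; exact: lt_trans sr.
rewrite E ge0_integral_setU//=.
- congr (_ + _)%E; have := @integral_itv_bndoo _ s t (fun r => (psi r * src g r)%:E) false false.
  by apply; apply: measurable_funS mg; [exact: measurable_itv|exact: sub].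
- rewrite -E; apply: measurable_funS mg; first exact: measurable_itv.
  exact: sub_pos_y.
- move=> r; rewrite -[_ \/ _]/((`]s, t] `|` `]t, +oo[) r) -E /= in_itv/= andbT => sr.
  by rewrite lee_fin mulr_ge0 ?src_ge0 ?psi_ge0//; exact: lt_trans sr.
- apply/disj_setPS => r /= []; rewrite !in_itv/= andbT => /andP[_ rs] tr.
  by have := le_lt_trans rs tr; rewrite ltxx.
Qed.

End Operator2.

(** * Continuity of the operator, the subsolution and the supersolution *)

Section Existence.
Context {R : realType}.
Local Notation mu := (@lebesgue_measure R).
Variable k : R.
Hypothesis k0 : 0 < k.
Local Notation phi := (phi k).
Local Notation dphi := (dphi k).
Local Notation psi := (psi k).
Local Notation dpsi := (dpsi k).
Local Notation left_int := (left_int k).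
Local Notation right_int := (right_int k).
Local Notation green_op := (green_op k).

(** Serves for integrals of [src g] with [g] merely measurable: their increments are squeezed
    between 0 and those of [dphi] or [dpsi]. *)
Lemma increment_continuous (A K : R -> R) (r : R) :
  (forall s t : R, 0 < s -> s < t -> 0 <= A t - A s /\ A t - A s <= K t - K s) ->
  0 < r -> {for r, continuous K} -> {for r, continuous A}.
Proof.
move=> AK r0 cK; apply/cvgrPdist_le => e e0.
move/cvgrPdist_le : cK => /(_ e e0); apply: filterS2 (lt_nbhsr r0) => s s0 /=.
have [rs|sr|->] := ltgtP r s; last by rewrite !subrr.
- have [h1 h2] := AK r s r0 rs; rewrite !ler_norml => /andP[h3 h4].
  by apply/andP; split; lra.
- have [h1 h2] := AK s r s0 sr; rewrite !ler_norml => /andP[h3 h4].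
  by apply/andP; split; lra.
Qed.

Lemma adm_integral_le (w : R -> R) (g : R -> R) (s t : R) : unit_bounded g ->
  (forall r : R, 0 < r -> {for r, continuous w}) -> (forall r : R, 0 < r -> 0 <= w r) ->
  0 < s ->
  (0 <= \int[mu]_(r in `]s, t[) (w r * src g r)%:E)%E /\
  (\int[mu]_(r in `]s, t[) (w r * src g r)%:E <=
   \int[mu]_(r in `]s, t[) (w r * Lop k (fun=> 1) (fun=> 0) r)%:E)%E.
Proof.
move=> ag cw w0 s0; split.
  apply: integral_ge0 => r /=; rewrite in_itv/= => /andP[sr _].
  by rewrite lee_fin mulr_ge0 ?w0 ?src_ge0//; exact: lt_trans sr.
apply: ge0_le_integral_nonmeasurable_in => r /=; rewrite in_itv/= => /andP[sr _].
  by rewrite lee_fin mulr_ge0 ?w0 ?src_ge0//; exact: lt_trans sr.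
by rewrite lee_fin ler_wpM2l ?w0 ?src_le_one//; exact: lt_trans sr.
Qed.

Lemma left_int_continuous g (r : R) : unit_bounded g -> 0 < r -> {for r, continuous (fun r => fine (left_int g r))}.
Proof.
move=> ag r0; apply: (@increment_continuous _ dphi) => //; last first.
  exact: is_derive_continuous (dphi_derive k0 r0).
move=> s t s0 st; have t0 := lt_trans s0 st.
have [h1 h2] := adm_integral_le t ag (@phi_continuous _ k k0) (@phi_ge0 _ k k0) s0.
have dK (z : R) : 0 < z -> is_derive z 1 dphi (phi z * Lop k (fun=> 1) (fun=> 0) z).
  by move=> z0; apply: (is_derive_to (dphi_derive k0 z0)); rewrite one_Lop mulrC.
have cG (z : R) : 0 < z -> {for z, continuous (fun z => phi z * Lop k (fun=> 1) (fun=> 0) z)}.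
  by move=> z0; apply: contM; [exact: phi_continuous|exact: one_Lop_cont].
move: h2; rewrite (integral_derive cG dK s0 st) => h2.
have := left_int_split k0 ag s0 st; move: h1 h2; set I := (\int[mu]_(_ in _) _)%E => h1 h2.
have If : I \is a fin_num by rewrite ge0_fin_numE//; exact: le_lt_trans h2 (ltry _).
have [i Ii] : exists i, I = i%:E by exists (fine I); rewrite fineK.
move: h1 h2; rewrite Ii !lee_fin => h1 h2.
move=> h3; have -> : fine (left_int g t) = fine (left_int g s) + i; last by split; lra.
by rewrite h3 fineD ?left_int_fin.
Qed.

Lemma right_int_continuous g (r : R) : unit_bounded g -> 0 < r -> {for r, continuous (fun r => fine (right_int g r))}.
Proof.
move=> ag r0.
suff : {for r, continuous (fun r => - fine (right_int g r))}.
  move=> h; have := contN h; rewrite (_ : (fun r => - - _) = fun r => fine (right_int g r))//.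
  by apply/funext => s; rewrite opprK.
apply: (@increment_continuous _ dpsi) => //; last first.
  exact: is_derive_continuous (dpsi_derive k0 r0).
move=> s t s0 st; have t0 := lt_trans s0 st.
have [h1 h2] := adm_integral_le t ag (@psi_continuous _ k k0) (@psi_ge0 _ k k0) s0.
have dK (z : R) : 0 < z -> is_derive z 1 dpsi (psi z * Lop k (fun=> 1) (fun=> 0) z).
  by move=> z0; apply: (is_derive_to (dpsi_derive k0 z0)); rewrite one_Lop mulrC.
have cG (z : R) : 0 < z -> {for z, continuous (fun z => psi z * Lop k (fun=> 1) (fun=> 0) z)}.
  by move=> z0; apply: contM; [exact: psi_continuous|exact: one_Lop_cont].
move: h2; rewrite (integral_derive cG dK s0 st) => h2.
have := right_int_split k0 ag s0 st; move: h1 h2; set I := (\int[mu]_(_ in _) _)%E => h1 h2.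
have If : I \is a fin_num by rewrite ge0_fin_numE//; exact: le_lt_trans h2 (ltry _).
have [i Ii] : exists i, I = i%:E by exists (fine I); rewrite fineK.
move: h1 h2; rewrite Ii !lee_fin => h1 h2.
move=> h3; have -> : fine (right_int g s) = i + fine (right_int g t); last by split; lra.
by rewrite h3 fineD ?right_int_fin.
Qed.

Lemma green_op_continuous g (r : R) : unit_bounded g -> 0 < r -> {for r, continuous (green_op g)}.
Proof.
move=> ag r0; have h1 := left_int_continuous ag r0; have h2 := right_int_continuous ag r0.
have h3 := phi_continuous k0 r0; have h4 := psi_continuous k0 r0.
exact: (contD (contM h4 h1) (contM h3 h2)).
Qed.

Lemma green_op_unit_bounded g : unit_bounded g -> unit_bounded (green_op g).
Proof.
move=> ag; split; first by apply: continuous_pos_measurable => r; exact: green_op_continuous.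
by move=> r r0; rewrite green_op_ge0// green_op_le1.
Qed.

Lemma exp_neg_unit_bounded : unit_bounded (exp_neg k).
Proof.
split; first by apply: continuous_pos_measurable => r _; exact: is_derive_continuous (exp_neg_derive k r).
move=> r r0; rewrite (ltW (exp_neg_gt0 _ _))/= /exp_neg expR_le1 oppr_le0 mulr_ge0// ltW//.
Qed.

Lemma exp_neg_le_green_op (r : R) : 0 < r -> exp_neg k r <= green_op (exp_neg k) r.
Proof.
have k00 := k0.
have E1 (s : R) : 0 < s -> exp_neg k s <= 1 by move=> s0; have [_ /(_ s s0)/andP[]] := exp_neg_unit_bounded.
apply: (@green_op_ge _ k k0 (exp_neg k) (fun r => - k * exp_neg k r) (fun r => k ^+ 2 * exp_neg k r) (1 + k)).
- by move=> s _; exact: exp_neg_derive.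
- by move=> s _; have h := exp_neg_derive k s; differentiate; ring.
- by move=> s _; have h := is_derive_continuous (exp_neg_derive k s); cont.
- move=> s s0; have E0 := exp_neg_gt0 k s; have := E1 s s0 => e1.
  by rewrite (gtr0_norm E0) normrM normrN (gtr0_norm k0) (gtr0_norm E0); split; nra.
- exact: exp_neg_unit_bounded.
move=> s s0; have E0 := exp_neg_gt0 k s; have e1 := E1 s s0.
have -> : Lop k (exp_neg k) (fun r => k ^+ 2 * exp_neg k r) s = 2 * exp_neg k s / s ^+ 2 by rewrite /Lop; ring.
rewrite divr_ge0 ?sqr_ge0 ?mulr_ge0 ?(ltW E0)//= /src ler_wpM2r ?invr_ge0 ?sqr_ge0//.
rewrite -subr_ge0 (_ : _ - _ = exp_neg k s * (1 - exp_neg k s) * (1 + exp_neg k s)); last by ring.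
by rewrite !mulr_ge0//; lra.
Qed.

(** A source of size [2 / r^2] allows only algebraic decay, of order [1 / r^2]. With [d = k^2 / 10]
    the excess [L S - 2 / r^2] is [d S (8 - 6 S + 8 S^2)], which is positive; 10 is a convenient
    value, not an optimal one. *)
Lemma green_op_le_decaying g (r : R) : unit_bounded g -> 0 < r -> green_op g r <= (1 + k ^+ 2 / 10 * r ^+ 2)^-1.
Proof.
move=> ag; pose d := k ^+ 2 / 10; have d0 : 0 < d by rewrite divr_gt0// exprn_gt0.
pose S r : R := (1 + d * r ^+ 2)^-1.
have D0 (s : R) : 0 < 1 + d * s ^+ 2 by have := mulr_ge0 (ltW d0) (sqr_ge0 s); lra.
have S0 (s : R) : 0 < S s by rewrite invr_gt0.
have S1 (s : R) : S s <= 1 by rewrite invf_le1//; have := mulr_ge0 (ltW d0) (sqr_ge0 s); lra.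
(* This relation removes [s] and turns the excess into a polynomial in [S]. *)
have SD (s : R) : d * s ^+ 2 * S s = 1 - S s.
  by have := D0 s => D0s; rewrite /S; field; rewrite gt_eqF.
have dS (s : R) : is_derive s 1 S (- (2 * d * s * S s ^+ 2)).
  have D0s : 1 + d * s ^+ 2 != 0 by rewrite gt_eqF.
  by rewrite /S; differentiate; rewrite /=; field.
have dS1 (s : R) : is_derive s 1 (fun s => - (2 * d * s * S s ^+ 2))
    (- (2 * d * S s ^+ 2) + 8 * d ^+ 2 * s ^+ 2 * S s ^+ 3).
  by have h := dS s; differentiate; rewrite /=; ring.
apply: (@green_op_le _ k k0 S _ (fun s => - (2 * d * S s ^+ 2) + 8 * d ^+ 2 * s ^+ 2 * S s ^+ 3) (3 + 2 * d)
  (fun s _ => dS s) (fun s _ => dS1 s)) => //.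
- by move=> s _; have h := is_derive_continuous (dS s); cont.
- move=> s s0; have S0s := S0 s; have S1s := S1 s; have SDs := SD s.
  rewrite (gtr0_norm S0s) normrN ger0_norm; last first.
    by rewrite mulr_ge0 ?sqr_ge0// !mulr_ge0// ltW.
  split; first lra.
  have S2 : S s ^+ 2 <= S s by nra.
  have [s1|s1] := leP s 1.
    have h1 : d * s <= d by nra.
    have h2 : d * s * S s ^+ 2 <= d * s.
      by apply: ler_piMr; [rewrite mulr_ge0// ltW|lra].
    lra.
  have : d * s * S s ^+ 2 <= d * s ^+ 2 * S s.
    rewrite -subr_ge0 (_ : _ - _ = d * s * S s * (s - S s)); last by ring.
    by rewrite mulr_ge0//; [rewrite !mulr_ge0// ltW|lra].
  lra.
- move=> s s0; have S0s := S0 s; have S1s := S1 s; have SDs := SD s.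
  have -> : Lop k S (fun s => - (2 * d * S s ^+ 2) + 8 * d ^+ 2 * s ^+ 2 * S s ^+ 3) s =
     2 / s ^+ 2 + (2 * d * S s ^+ 2 - 8 * d * (d * s ^+ 2 * S s) * S s ^+ 2 + 10 * d * S s - 2 * d * S s).
    rewrite /Lop /S; have := D0 s => D0s.
    have -> : k ^+ 2 = 10 * d by rewrite /d; field.
    by field; rewrite !gt_eqF.
  rewrite SDs lerDl.
  rewrite (_ : _ - _ = d * S s * (8 - 6 * S s + 8 * S s ^+ 2)); last by ring.
  apply: mulr_ge0; first by rewrite mulr_ge0// ltW.
  by have := sqr_ge0 (S s); lra.
Qed.

End Existence.

(** * The monotone iteration and its limit *)

Section FixedPoint.
Context {R : realType}.
Local Notation mu := (@lebesgue_measure R).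
Variable k : R.
Hypothesis k0 : 0 < k.
Local Notation phi := (phi k).
Local Notation dphi := (dphi k).
Local Notation psi := (psi k).
Local Notation dpsi := (dpsi k).
Local Notation left_int := (left_int k).
Local Notation right_int := (right_int k).
Local Notation green_op := (green_op k).

Definition iterate (n : nat) : R -> R := iter n green_op (exp_neg k).
Definition green_fixpt (r : R) : R := limn (fun n => iterate n r).

Lemma iterate_unit_bounded n : unit_bounded (iterate n).
Proof. by elim: n => [|n IH]; [exact: exp_neg_unit_bounded|exact: green_op_unit_bounded]. Qed.

Lemma iterate_incr n (r : R) : 0 < r -> iterate n r <= iterate n.+1 r.
Proof.
elim: n r => [|n IH] r r0; first exact: exp_neg_le_green_op.
by apply: (green_op_mono k0 (iterate_unit_bounded n) (iterate_unit_bounded n.+1)).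
Qed.

Lemma iterate_nondecreasing (r : R) : 0 < r -> nondecreasing_seq (fun n => iterate n r).
Proof. by move=> r0; apply/nondecreasing_seqP => n; exact: iterate_incr. Qed.

Lemma iterate_bounds n (r : R) : 0 < r -> 0 <= iterate n r <= 1.
Proof. by have [_] := iterate_unit_bounded n; apply. Qed.

Lemma iterate_cvg (r : R) : 0 < r -> iterate n r @[n --> \oo] --> green_fixpt r.
Proof.
move=> r0; apply: nondecreasing_is_cvgn; first exact: iterate_nondecreasing.
by exists 1 => _ [n _ <-]; have /andP[] := iterate_bounds n r0.
Qed.

Lemma iterate_le_green_fixpt n (r : R) : 0 < r -> iterate n r <= green_fixpt r.
Proof.
move=> r0; apply: nondecreasing_cvgn_le; first exact: iterate_nondecreasing.
by apply/cvg_ex; exists (green_fixpt r); exact: iterate_cvg.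
Qed.

Lemma green_fixpt_unit_bounded : unit_bounded green_fixpt.
Proof.
split.
  apply: (@measurable_fun_cvg _ _ _ _ iterate); first by move=> n; have [] := iterate_unit_bounded n.
  by move=> r; rewrite /= in_itv/= andbT; exact: iterate_cvg.
move=> r r0; have cv := iterate_cvg r0.
rewrite (le_trans _ (iterate_le_green_fixpt 0 r0)); last by have /andP[] := iterate_bounds 0 r0.
apply: limr_le; first by apply/cvg_ex; eexists; exact: cv.
by apply: nearW => n; have /andP[] := iterate_bounds n r0.
Qed.

Lemma monotone_cvg_src (w : R -> R) (D : set R) : D `<=` `](0:R)%R, +oo[ ->
  measurable (D : set (measurableTypeR R)) ->
  (forall r : R, 0 < r -> {for r, continuous w}) -> (forall r : R, 0 < r -> 0 <= w r) ->
  (\int[mu]_(r in D) (w r * src (iterate n) r)%:E)%E @[n --> \oo] -->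
  (\int[mu]_(r in D) (w r * src green_fixpt r)%:E)%E.
Proof.
move=> Dpos mD cw w0.
have D0 s : D s -> 0 < s by move=> /Dpos; rewrite /= in_itv/= andbT.
have mg n : measurable_fun D (fun r => (w r * src (iterate n) r)%:E).
  apply: (measurable_funS _ Dpos (measurable_src (iterate_unit_bounded n) cw)).
  exact: measurable_itv.
have -> : (\int[mu]_(r in D) (w r * src green_fixpt r)%:E)%E =
    (\int[mu]_(r in D) limn (fun n => (w r * src (iterate n) r)%:E))%E.
  apply: eq_integral => r; rewrite inE => /D0 r0; apply/esym/cvg_lim => //.
  apply/fine_cvgP; split; first exact: nearW.
  have c : {for green_fixpt r, continuous (fun y : R => w r * ((3 * y - y ^+ 3) / r ^+ 2))}.
    by cont; exact: contC.
  exact: (cvg_comp _ _ (iterate_cvg r0) c).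
apply: cvg_monotone_convergence => //.
- by move=> n r /D0 r0; rewrite lee_fin mulr_ge0 ?w0// src_ge0//; exact: iterate_unit_bounded.
- move=> r /D0 r0 m n mn; rewrite lee_fin ler_wpM2l ?w0//.
  by apply: src_le => //; [exact: iterate_unit_bounded|exact: iterate_unit_bounded|exact: iterate_nondecreasing].
Qed.

Lemma green_fixptE (r : R) : 0 < r -> green_fixpt r = green_op green_fixpt r.
Proof.
move=> r0.
have c1 := monotone_cvg_src (@sub_pos_0 _ r) (measurable_itv _) (@phi_continuous _ k k0) (@phi_ge0 _ k k0).
have c2 := monotone_cvg_src (sub_pos_y r0) (measurable_itv _) (@psi_continuous _ k k0) (@psi_ge0 _ k k0).
have h1 : fine (left_int (iterate n) r) @[n --> \oo] --> fine (left_int green_fixpt r).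
  by apply: fine_cvg; rewrite fineK; [exact: c1|exact: (left_int_fin k0 green_fixpt_unit_bounded r0)].
have h2 : fine (right_int (iterate n) r) @[n --> \oo] --> fine (right_int green_fixpt r).
  by apply: fine_cvg; rewrite fineK; [exact: c2|exact: (right_int_fin k0 green_fixpt_unit_bounded r0)].
have h3 : iterate n.+1 r @[n --> \oo] --> green_op green_fixpt r.
  by apply: cvgD; exact: cvgMr.
have h4 : iterate n.+1 r @[n --> \oo] --> green_fixpt r.
  by have := iterate_cvg r0; rewrite -(cvg_shiftS (fun n => iterate n r)).
exact: (cvg_unique _ h4 h3).
Qed.

(** As a monotone limit the fixed point is only known to be measurable; regularity comes from the
    fixed-point equation, since [green_op] makes measurable functions continuous. *)
Lemma green_fixpt_continuous (r : R) : 0 < r -> {for r, continuous green_fixpt}.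
Proof.
move=> r0; have := green_op_continuous k0 green_fixpt_unit_bounded r0.
rewrite /prop_for /continuous_at -(green_fixptE r0) => h.
apply: cvg_trans h; apply: near_eq_cvg.
by apply: filterS (lt_nbhsr r0) => s s0; rewrite green_fixptE.
Qed.

Lemma src_fixpt_continuous (r : R) : 0 < r -> {for r, continuous (src green_fixpt)}.
Proof.
by move=> r0; have h := green_fixpt_continuous r0; rewrite /src; cont; rewrite gt_eqF// exprn_gt0.
Qed.

Lemma left_int_derive (r : R) : 0 < r ->
  is_derive r 1 (fun t => fine (left_int green_fixpt t)) (phi r * src green_fixpt r).
Proof.
move=> r0; pose x := r / 2; have [x0 xr] : 0 < x /\ x < r by rewrite /x; lra.
have cG (s : R) : 0 < s -> {for s, continuous (fun s => phi s * src green_fixpt s)}.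
  by move=> s0; exact: (contM (phi_continuous k0 s0) (src_fixpt_continuous s0)).
have [F dF eF] := antiderivative_itv cG x0 (y := r + 1) ltac:(lra).
have h := dF r (ltW xr) ltac:(lra).
have d1 : is_derive r 1 (fun t => (fine (left_int green_fixpt x) - F x) + F t) (phi r * src green_fixpt r).
  by differentiate; exact: add0r.
apply: near_eq_is_derive d1; near=> t.
have xt : x < t by near: t; exact: lt_nbhsr.
have tr : t <= r + 1 by near: t; apply: lt_le_nbhsl; lra.
have -> : fine (left_int green_fixpt t) = fine (left_int green_fixpt x) + (F t - F x).
  by rewrite (left_int_split k0 green_fixpt_unit_bounded x0 xt) (eF x t (lexx _) (ltW xt) tr) fineD ?(left_int_fin k0 green_fixpt_unit_bounded x0).
ring.
Unshelve. all: by end_near. Qed.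

Lemma right_int_derive (r : R) : 0 < r ->
  is_derive r 1 (fun t => fine (right_int green_fixpt t)) (- (psi r * src green_fixpt r)).
Proof.
move=> r0; pose x := r / 2; have [x0 xr] : 0 < x /\ x < r by rewrite /x; lra.
have cG (s : R) : 0 < s -> {for s, continuous (fun s => psi s * src green_fixpt s)}.
  by move=> s0; exact: (contM (psi_continuous k0 s0) (src_fixpt_continuous s0)).
have [F dF eF] := antiderivative_itv cG x0 (y := r + 1) ltac:(lra).
have h := dF r (ltW xr) ltac:(lra).
have d1 : is_derive r 1 (fun t => (fine (right_int green_fixpt x) + F x) - F t) (- (psi r * src green_fixpt r)).
  by differentiate; exact: add0r.
apply: near_eq_is_derive d1; near=> t.
have xt : x < t by near: t; exact: lt_nbhsr.
have tr : t <= r + 1 by near: t; apply: lt_le_nbhsl; lra.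
have t0 := lt_trans x0 xt.
have -> : fine (right_int green_fixpt x) = (F t - F x) + fine (right_int green_fixpt t).
  by rewrite (right_int_split k0 green_fixpt_unit_bounded x0 xt) (eF x t (lexx _) (ltW xt) tr) fineD ?(right_int_fin k0 green_fixpt_unit_bounded t0).
ring.
Unshelve. all: by end_near. Qed.

(** The terms in [src] from differentiating the two integrals cancel, so only [psi] and [phi] appear
    differentiated. *)
Definition green_fixpt_derive1 (r : R) : R :=
  dpsi r * fine (left_int green_fixpt r) + dphi r * fine (right_int green_fixpt r).

Lemma green_fixpt_ode : ode k green_fixpt green_fixpt_derive1.
Proof.
move=> r r0; have h1 := left_int_derive r0; have h2 := right_int_derive r0.
have h3 := phi_derive k0 r0; have h4 := dphi_derive k0 r0.
have h5 := psi_derive k0 r0; have h6 := dpsi_derive k0 r0.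
split.
  have d1 : is_derive r 1 (fun t => psi t * fine (left_int green_fixpt t) + phi t * fine (right_int green_fixpt t)) (green_fixpt_derive1 r).
    by differentiate; rewrite /green_fixpt_derive1; ring.
  apply: near_eq_is_derive d1; apply: filterS (lt_nbhsr r0) => t t0.
  by rewrite [RHS]green_fixptE.
rewrite /green_fixpt_derive1; differentiate.
(* In the second derivative the terms in [src] combine to the Wronskian instead of cancelling. *)
have W := wronskian k0 r0; have E := green_fixptE r0.
transitivity ((k ^+ 2 + 2 / r ^+ 2) * green_op green_fixpt r
   - (dphi r * psi r - phi r * dpsi r) * src green_fixpt r); first by rewrite /green_op; ring.
by rewrite -E W /src; ring.
Qed.

Lemma green_fixpt_ge0 (r : R) : 0 < r -> 0 <= green_fixpt r.
Proof. by move=> r0; have [_ /(_ r r0)/andP[]] := green_fixpt_unit_bounded. Qed.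

Lemma green_fixpt_bc : bc green_fixpt.
Proof.
split.
  apply: cvg_right0_ex => e e0.
  have E1 : exp_neg k r @[r --> 0^'+] --> (1 : R).
    have <- : exp_neg k 0 = 1 by rewrite /exp_neg mulr0 oppr0 expR0.
    apply: cvg_at_right_filter; exact: is_derive_continuous (exp_neg_derive k 0).
  have [d d0 Hd] := cvg_right0_lt E1 e0; exists d => // r r0 rd.
  have := Hd r r0 rd; rewrite !ltr_norml => /andP[h1 h2].
  have h3 := iterate_le_green_fixpt 0 r0; have [_ /(_ r r0)/andP[h4 h5]] := green_fixpt_unit_bounded.
  rewrite /iterate/= in h3; apply/andP; split; lra.
apply: cvg_pinfty_ex => e e0; have k20 : 0 < k ^+ 2 / 10 by rewrite divr_gt0// exprn_gt0.
exists (Num.max 1 (e^-1 / (k ^+ 2 / 10))) => r; rewrite gt_max => /andP[r1 re].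
have r0 : 0 < r by lra.
rewrite subr0 ger0_norm ?green_fixpt_ge0// green_fixptE//.
apply: le_lt_trans (green_op_le_decaying k0 green_fixpt_unit_bounded r0) _.
rewrite -[ltRHS]invrK ltf_pV2 ?posrE ?invr_gt0//; last first.
  by rewrite ltr_wpDr// mulr_ge0 ?sqr_ge0 ?ltW.
move: re; rewrite ltr_pdivrMr//; set c := k ^+ 2 / 10 => re.
have : c * r <= c * r ^+ 2 by rewrite ler_pM2l//; nra.
lra.
Qed.

End FixedPoint.

(** * The theorem *)

Section Main.
Context {R : realType}.
Variables (a b k : R).
Hypotheses (k0 : 0 < k) (abk : a * b = 2 * k ^+ 2).

Lemma solves_ode (u : R -> R) : solves a b u -> ode k u (derive1 u).
Proof.
move=> [H _] r r0; have [du ddu e] := H r r0; split.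
  by apply: DeriveDef; [exact: du|rewrite derive1E].
apply: DeriveDef; [exact: ddu|rewrite -derive1E e]; congr (_ + _).
have -> : 2^-1 * a * b * u r = 2^-1 * (a * b) * u r by ring.
by rewrite abk; field.
Qed.

Lemma ode_solves (u v : R -> R) : ode k u v -> bc u -> solves a b u.
Proof.
move=> Hode Hbc; split => // r r0; have [h1 h2] := Hode r r0.
have h3 : is_derive r 1 (derive1 u) (k ^+ 2 * u r + (u r ^+ 2 - 1) * u r / r ^+ 2).
  apply: near_eq_is_derive h2; apply: filterS (lt_nbhsr r0) => s s0.
  by rewrite (ode_derive1 Hode s0).
split; [by have [] := h1|by have [] := h3|].
have [_ e] := h3; rewrite derive1E e; congr (_ + _).
have -> : 2^-1 * a * b * u r = 2^-1 * (a * b) * u r by ring.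
by rewrite abk; field.
Qed.

Lemma nonneg_sol_energy_fin (u v : R -> R) : ode k u v -> bc u ->
  (forall r : R, 0 < r -> 0 <= u r) -> (energy a b u < +oo)%E.
Proof.
move=> Hode Hbc u_ge0; rewrite (energyE _ abk).
by apply: lt_trans (nonneg_sol_energy_lt k0 Hode Hbc u_ge0) (ltry _).
Qed.

Lemma nonneg_sol_minimizer (u v : R -> R) : ode k u v -> bc u ->
  (forall r : R, 0 < r -> 0 <= u r) -> minimizer a b u.
Proof.
move=> Hode Hbc u_ge0; split.
  by split => //; [exact: (sol_loc_abs_cont Hode)|exact: nonneg_sol_energy_fin Hode Hbc u_ge0].
move=> f [acf fy bcf]; rewrite !(energyE _ abk) in fy *.
have f0 : (0 <= \int[@lebesgue_measure R]_(r in `](0:R)%R, +oo[) (energy_density k f r)%:E)%E.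
  by apply: integral_ge0 => r _; rewrite lee_fin energy_density_ge0.
have := nonneg_sol_energy_le k0 Hode Hbc u_ge0 acf bcf
  (M := fine (\int[@lebesgue_measure R]_(r in `](0:R)%R, +oo[) (energy_density k f r)%:E)%E).
by rewrite fineK ?ge0_fin_numE//; apply.
Qed.

Lemma minimizer_unique (u v f : R -> R) : ode k u v -> bc u ->
  (forall r : R, 0 < r -> 0 <= u r) -> minimizer a b f -> forall r : R, 0 < r -> f r = u r.
Proof.
move=> Hode Hbc u_ge0 [[acf fy bcf] fmin].
have [uadm _] := nonneg_sol_minimizer Hode Hbc u_ge0.
have := fmin u uadm; have [_ uy _] := uadm; rewrite !(energyE _ abk) in uy * => fu.
exact: (nonneg_sol_unique_minimizer k0 Hode Hbc u_ge0 acf bcf uy fu).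
Qed.

End Main.

Unset Implicit Arguments.

Theorem theorem5p1 (R : realType) (a b : R) (ha : 0 < a) (hb : 0 < b) :
  (* (a) existence of a minimizing solution, and properties of such solutions *)
  ((exists u : R -> R, solves a b u /\ minimizer a b u) /\
   (forall u : R -> R, solves a b u -> minimizer a b u ->
      (forall r : R, 0 < r -> 0 < u r < 1) /\
      (forall r s : R, 0 < r -> r < s -> u s < u r) /\
      1 < fine (energy a b u) / Num.sqrt (2 * a * b) < Num.sqrt (1 + 4 * ln 2)))
  /\
  (* (b) finite-energy solutions *)
  (forall u : R -> R, solves a b u -> (energy a b u < +oo)%E ->
     derive1 u x @[x --> 0^'+] --> (0 : R) /\
     (forall eps : R, 0 < eps < 1 ->
        exists C M : R, forall r : R, M < r ->
          `|u r| <= C * expR (- (Num.sqrt (a * b / 2) * (1 - eps) * r)) /\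
          `|derive1 u r| <= C * expR (- (Num.sqrt (a * b / 2) * (1 - eps) * r))))
  /\
  (* (c) nonnegative solutions: bounds, uniqueness, unique minimizer *)
  ((forall u : R -> R, solves a b u -> (forall r : R, 0 < r -> 0 <= u r) ->
      forall r : R, 0 < r -> expR (- (Num.sqrt (a * b / 2) * r)) < u r < 1) /\
   (forall u v : R -> R,
      solves a b u -> (forall r : R, 0 < r -> 0 <= u r) -> (energy a b u < +oo)%E ->
      solves a b v -> (forall r : R, 0 < r -> 0 <= v r) -> (energy a b v < +oo)%E ->
      forall r : R, 0 < r -> u r = v r) /\
   (forall u v : R -> R, minimizer a b u -> minimizer a b v ->
      forall r : R, 0 < r -> u r = v r)).
Proof.
set k := Num.sqrt (a * b / 2).
have ab0 : 0 < a * b by rewrite mulr_gt0.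
have k0 : 0 < k by rewrite sqrtr_gt0 divr_gt0.
have abk : a * b = 2 * k ^+ 2 by rewrite sqr_sqrtr ?divr_ge0 ?(ltW ab0)//; field.
have sk : Num.sqrt (2 * a * b) = 2 * k.
  have -> : 2 * a * b = (2 * k) ^+ 2 by rewrite -mulrA abk; ring.
  by rewrite sqrtr_sqr ger0_norm// mulr_ge0// ltW.
have fixb := green_fixpt_bc k0; have fixo := green_fixpt_ode k0; have fix0 := @green_fixpt_ge0 _ _ k0.
split; last split; last split; [| | |split].
- split.
    exists (green_fixpt k); split; first exact: (ode_solves abk fixo fixb).
    exact: (nonneg_sol_minimizer k0 abk fixo fixb fix0).
  move=> u us umin; have Hode := solves_ode abk us; have [_ Hbc] := us.
  (* The sign of a minimizing solution is not given; it is read off from its equality with the fixed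
     point. *)
  have u_ge0 (r : R) : 0 < r -> 0 <= u r.
    by move=> r0; rewrite (minimizer_unique k0 abk fixo fixb fix0 umin r0) fix0.
  split; last split.
  + move=> r r0; apply/andP; split; first exact: (nonneg_sol_gt0 k0 Hode Hbc u_ge0 r0).
    exact: (nonneg_sol_lt1 k0 Hode Hbc r0).
  + move=> r s; exact: (nonneg_sol_decr k0 Hode Hbc u_ge0).
  have h1 := nonneg_sol_energy_gt k0 Hode Hbc u_ge0.
  have h2 := nonneg_sol_energy_lt k0 Hode Hbc u_ge0.
  have uy := nonneg_sol_energy_fin k0 abk Hode Hbc u_ge0.
  have u0 : (0 <= energy a b u)%E.
    by rewrite (energyE _ abk); apply: integral_ge0 => r _; rewrite lee_fin energy_density_ge0.
  have uf : energy a b u \is a fin_num by rewrite ge0_fin_numE.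
  move: h1 h2; rewrite -(energyE _ abk) -(fineK uf) !lte_fin sk => h1 h2.
  rewrite ltr_pdivlMr ?mulr_gt0// mul1r h1/= ltr_pdivrMr ?mulr_gt0//.
  by rewrite mulrC.
- move=> u us _; have Hode := solves_ode abk us; have [_ Hbc] := us.
  split; first exact: (sol_derive0 k0 Hode Hbc).
  move=> eps /andP[e0 e1].
  have l0 : 0 < k * (1 - eps) by rewrite mulr_gt0// subr_gt0.
  have lk : k * (1 - eps) < k by rewrite gtr_pMr// gtrBl.
  have [C [M [_ _ H]]] := sol_decay k0 Hode Hbc l0 lk.
  by exists C, M.
- move=> u us u_ge0 r r0; have Hode := solves_ode abk us; have [_ Hbc] := us.
  rewrite (nonneg_sol_gt k0 Hode Hbc u_ge0 r0)/=.
  exact: (nonneg_sol_lt1 k0 Hode Hbc r0).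
- move=> u v us u_ge0 _ vs v_ge0 _ r r0.
  have uo := solves_ode abk us; have [_ ub] := us.
  have vo := solves_ode abk vs; have [_ vb] := vs.
  exact: (minimizer_unique k0 abk vo vb v_ge0 (nonneg_sol_minimizer k0 abk uo ub u_ge0) r0).
- move=> u v um vm r r0.
  by rewrite (minimizer_unique k0 abk fixo fixb fix0 um r0) (minimizer_unique k0 abk fixo fixb fix0 vm r0).
Qed.
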